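(* Let $\mathbb K\in\{\mathbb R,\mathbb C\}$, $b=(b_0,\dots,b_9)\in\mathbb K^{10}$, and let $$\pi_2=\pi_2(b)=[X_b,\pi_1]-\pi_1(Q_b)\wedge\frac{\partial}{\partial x_0}+x_0\pi_1$$ be the quadratic Poisson bivector on $\mathfrak{gl}(3,\mathbb K)^*$ described in the context. Let $p:\mathfrak{gl}(3,\mathbb K)^*=\mathfrak{sl}(3,\mathbb K)^*\oplus\mathbb K^*\to\mathfrak{sl}(3,\mathbb K)^*$ be the natural projection. Then the following functions are Casimir functions of $\pi_2$: (1) $K_1=p^*C_3$, where $C_3$ is the cubic Casimir function of the Lie–Poisson bivector $P$ on $\mathfrak{sl}(3,\mathbb K)^*$ corresponding to the function $\mathrm{Trace}(x^3)$ under the identification $\mathfrak{sl}(3,\mathbb K)\cong\mathfrak{sl}(3,\mathbb K)^*$ by means of the Killing form; (2) $K_2=k+Bx_0$, where $B:=p^*C_2$, $C_2$ is the quadratic Casimir function of $P$ corresponding to the function $\mathrm{Trace}(x^2)$, and $k=k_b:=p^*(X_bC_2)$; (3) $K_3:=-3\,p^*(m-X_bQ_b)+3\,(p^*Q_b)\,x_0+x_0^3$, where $m=m_b$ is the cubic homogeneous polynomial on $\mathfrak{sl}(3,\mathbb K)^*$ corresponding to $X_b$ and $Q_b$, i.e. such that $[X_b,P(Q_b)]=P(m)$. The polynomials $k_b$ and $M_b:=m_b-X_bQ_b$ are given by the explicit formulas written out at the end of the context.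
   Context: $[\cdot,\cdot]$ is the Schouten bracket, normalized by $[X,f]=Xf$, $[X,Y]$ the Lie bracket for vector fields, $[R,Q]=-(-1)^{(r-1)(q-1)}[Q,R]$, $[R,Q\wedge S]=[R,Q]\wedge S+(-1)^{(r-1)q}Q\wedge[R,S]$ for $R,Q$ of degrees $r,q$. For a bivector $\eta$ and a function $f$, $\eta(f):=[\eta,f]$ (contraction of $\eta$ with $df$ over the second index). $f$ is a Casimir function of $\eta$ if $\eta(f)=0$. $P$ is the Lie–Poisson bivector on $\mathfrak{sl}(3,\mathbb K)^*$. Coordinates on $\mathfrak{sl}(3,\mathbb K)^*$: $x_{ij}$ ($i\ne j$), $y_{13}=x_{11}-x_{33}$, $y_{23}=x_{22}-x_{33}$, the linear functions given by the matrices $E_{ij}$, $E_{11}-E_{33}$, $E_{22}-E_{33}$; the bracket of $P$ is $\{x_{ij},x_{kl}\}=\delta_{jk}x_{il}-\delta_{il}x_{kj}$. Put $X_b=b_0X_0+\cdots+b_9X_9$, where the following $X_0,\dots,X_9$ generate the weight spaces of a 10-dimensional irreducible $\mathfrak{sl}(3)$-module $W^*$ (isomorphic to $S^3(V^* )$, $V$ the natural representation) of quadratic vector fields on $\mathfrak{sl}(3,\mathbb K)^*$: $$\begin{aligned} X_0={}&((4y_{13}-2y_{23})x_{12}-6x_{13}x_{32})\tfrac{\partial}{\partial x_{12}}+((-4y_{13}+2y_{23})x_{13}+6x_{12}x_{23})\tfrac{\partial}{\partial x_{13}}+((2y_{13}-4y_{23})x_{21}+6x_{23}x_{31})\tfrac{\partial}{\partial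 x_{21}}\\&+((-2y_{13}+4y_{23})x_{23}-6x_{13}x_{21})\tfrac{\partial}{\partial x_{23}}+((-2y_{13}-2y_{23})x_{31}-6x_{32}x_{21})\tfrac{\partial}{\partial x_{31}}+((2y_{13}+2y_{23})x_{32}+6x_{12}x_{31})\tfrac{\partial}{\partial x_{32}}\\&+(-2y_{13}^2-4y_{13}y_{23}+4y_{23}^2)\tfrac{\partial}{\partial y_{13}}+(-4y_{13}^2+4y_{13}y_{23}+2y_{23}^2)\tfrac{\partial}{\partial y_{23}},\\ X_1={}&-3x_{12}^2\tfrac{\partial}{\partial x_{12}}+6x_{13}x_{12}\tfrac{\partial}{\partial x_{13}}+(-3x_{12}x_{21}+3x_{13}x_{31}-3x_{23}x_{32}+y_{13}y_{23}+y_{23}^2)\tfrac{\partial}{\partial x_{21}}+(-2x_{13}y_{13}+4x_{13}y_{23})\tfrac{\partial}{\partial x_{23}}\\&+(3x_{12}x_{31}-x_{32}y_{13}+5x_{32}y_{23})\tfrac{\partial}{\partial x_{31}}-3x_{32}x_{12}\tfrac{\partial}{\partial x_{32}}+(2x_{12}y_{13}+5x_{12}y_{23}-3x_{13}x_{32})\tfrac{\partial}{\partial y_{13}}+(4x_{12}y_{13}+x_{12}y_{23}+3x_{13}x_{32})\tfrac{\partial}{\partial y_{23}},\\ X_2={}&-6x_{13}x_{12}\tfrac{\partial}{\partial x_{12}}+3x_{13}^2\tfrac{\partial}{\partial x_{13}}+(-3x_{13}x_{21}+x_{23}y_{13}+4x_{23}y_{23})\tfrac{\partial}{\partial x_{21}}+3x_{13}x_{23}\tfrac{\partial}{\partial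 x_{23}}\\&+(-3x_{12}x_{21}+3x_{13}x_{31}+3x_{23}x_{32}+y_{13}y_{23}-2y_{23}^2)\tfrac{\partial}{\partial x_{31}}+(2x_{12}y_{13}+2x_{12}y_{23})\tfrac{\partial}{\partial x_{32}}\\&+(6x_{12}x_{23}+2x_{13}y_{13}+2x_{13}y_{23})\tfrac{\partial}{\partial y_{13}}+(3x_{12}x_{23}+4x_{13}y_{13}-5x_{13}y_{23})\tfrac{\partial}{\partial y_{23}},\\ X_3={}&(3x_{12}x_{21}+3x_{13}x_{31}-3x_{23}x_{32}-y_{13}^2-y_{13}y_{23})\tfrac{\partial}{\partial x_{12}}+(-4x_{23}y_{13}+2x_{23}y_{23})\tfrac{\partial}{\partial x_{13}}+3x_{21}^2\tfrac{\partial}{\partial x_{21}}-6x_{23}x_{21}\tfrac{\partial}{\partial x_{23}}\\&+3x_{31}x_{21}\tfrac{\partial}{\partial x_{31}}+(-3x_{21}x_{32}-5x_{31}y_{13}+x_{31}y_{23})\tfrac{\partial}{\partial x_{32}}+(-x_{21}y_{13}-4x_{21}y_{23}-3x_{23}x_{31})\tfrac{\partial}{\partial y_{13}}\\&+(-5x_{21}y_{13}-2x_{21}y_{23}+3x_{23}x_{31})\tfrac{\partial}{\partial y_{23}},\\ X_4={}&(3x_{12}x_{23}-4x_{13}y_{13}-x_{13}y_{23})\tfrac{\partial}{\partial x_{12}}-3x_{13}x_{23}\tfrac{\partial}{\partial x_{13}}+6x_{23}x_{21}\tfrac{\partial}{\partial x_{21}}-3x_{23}^2\tfrac{\partial}{\partial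 x_{23}}+(-2x_{21}y_{13}-2x_{21}y_{23})\tfrac{\partial}{\partial x_{31}}\\&+(3x_{12}x_{21}-3x_{13}x_{31}-3x_{23}x_{32}+2y_{13}^2-y_{13}y_{23})\tfrac{\partial}{\partial x_{32}}+(-3x_{13}x_{21}+5x_{23}y_{13}-4x_{23}y_{23})\tfrac{\partial}{\partial y_{13}}\\&+(-6x_{13}x_{21}-2x_{23}y_{13}-2x_{23}y_{23})\tfrac{\partial}{\partial y_{23}},\\ X_5={}&(4x_{32}y_{13}-2x_{32}y_{23})\tfrac{\partial}{\partial x_{12}}+(-3x_{12}x_{21}-3x_{13}x_{31}+3x_{23}x_{32}+y_{13}^2-3y_{13}y_{23}+2y_{23}^2)\tfrac{\partial}{\partial x_{13}}-3x_{31}x_{21}\tfrac{\partial}{\partial x_{21}}\\&+(5x_{21}y_{13}-4x_{21}y_{23}+3x_{23}x_{31})\tfrac{\partial}{\partial x_{23}}-3x_{31}^2\tfrac{\partial}{\partial x_{31}}+6x_{31}x_{32}\tfrac{\partial}{\partial x_{32}}+(6x_{21}x_{32}-4x_{31}y_{13}+2x_{31}y_{23})\tfrac{\partial}{\partial y_{13}}\\&+(3x_{21}x_{32}-5x_{31}y_{13}+7x_{31}y_{23})\tfrac{\partial}{\partial y_{23}},\\ X_6={}&3x_{32}x_{12}\tfrac{\partial}{\partial x_{12}}+(4x_{12}y_{13}-5x_{12}y_{23}-3x_{13}x_{32})\tfrac{\partial}{\partial x_{13}}+(2x_{31}y_{13}-4x_{31}y_{23})\tfrac{\partial}{\partial x_{21}}\\&+(3x_{12}x_{21}-3x_{13}x_{31}+3x_{23}x_{32}-2y_{13}^2+3y_{13}y_{23}-y_{23}^2)\tfrac{\partial}{\partial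 x_{23}}-6x_{31}x_{32}\tfrac{\partial}{\partial x_{31}}+3x_{32}^2\tfrac{\partial}{\partial x_{32}}\\&+(-3x_{12}x_{31}-7x_{32}y_{13}+5x_{32}y_{23})\tfrac{\partial}{\partial y_{13}}+(-6x_{12}x_{31}-2x_{32}y_{13}+4x_{32}y_{23})\tfrac{\partial}{\partial y_{23}},\\ X_7={}&-9x_{12}^2\tfrac{\partial}{\partial x_{13}}+(-9x_{12}x_{31}+3x_{32}y_{13}+3x_{32}y_{23})\tfrac{\partial}{\partial x_{21}}+(6x_{12}y_{13}-3x_{12}y_{23}+9x_{13}x_{32})\tfrac{\partial}{\partial x_{23}}\\&+9x_{32}^2\tfrac{\partial}{\partial x_{31}}+18x_{32}x_{12}\tfrac{\partial}{\partial y_{13}}+9x_{32}x_{12}\tfrac{\partial}{\partial y_{23}},\\ X_8={}&9x_{13}^2\tfrac{\partial}{\partial x_{12}}-9x_{23}^2\tfrac{\partial}{\partial x_{21}}+(9x_{13}x_{21}-3x_{23}y_{13}+6x_{23}y_{23})\tfrac{\partial}{\partial x_{31}}+(-9x_{12}x_{23}-6x_{13}y_{13}+3x_{13}y_{23})\tfrac{\partial}{\partial x_{32}}\\&-9x_{13}x_{23}\tfrac{\partial}{\partial y_{13}}+9x_{13}x_{23}\tfrac{\partial}{\partial y_{23}},\\ X_9={}&(9x_{21}x_{32}-3x_{31}y_{13}-3x_{31}y_{23})\tfrac{\partial}{\partial x_{12}}+(3x_{21}y_{13}-6x_{21}y_{23}-9x_{23}x_{31})\tfrac{\partial}{\partial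 x_{13}}+9x_{21}^2\tfrac{\partial}{\partial x_{23}}-9x_{31}^2\tfrac{\partial}{\partial x_{32}}\\&-9x_{31}x_{21}\tfrac{\partial}{\partial y_{13}}-18x_{31}x_{21}\tfrac{\partial}{\partial y_{23}}. \end{aligned}$$ $U$ is the 27-dimensional irreducible submodule (highest weight $2\omega_1+2\omega_2$, $\omega_1,\omega_2$ the fundamental weights) of the space of homogeneous quadratic polynomials on $\mathfrak{sl}(3,\mathbb K)^*$, i.e. the submodule generated by $x_{13}^2$. $Q_b\in U$ is the quadratic polynomial with $[[X_b,P],[X_b,P]]=2P(Q_b)\wedge P$, given by $$\begin{aligned}Q_b=6\big(&(-4b_2b_4-12b_5b_7)x_{21}x_{13}+(12b_0b_7-8b_2b_3)x_{23}x_{13}+(-b_0^2+4b_1b_4-4b_2b_5+4b_3b_6)x_{13}x_{31}\\ &+(-4b_2b_6-12b_3b_8)x_{13}x_{32}+(-4b_0b_2-4b_1b_3+12b_6b_7)y_{13}x_{13}+(12b_5b_8+4b_6^2)x_{32}^2\\ &+(4b_0b_6+8b_1b_5)y_{23}x_{32}+(b_0^2-4b_3b_6)y_{13}^2+(-b_0^2-4b_1b_4+4b_2b_5+4b_3b_6)y_{23}y_{13}\\ &+(b_0^2-4b_2b_5)y_{23}^2+(-12b_1b_9-4b_4b_6)y_{23}x_{31}+(4b_5^2+12b_6b_9)x_{31}^2+(4b_3^2+12b_4b_7)x_{23}^2\\ &+(-4b_0b_3-4b_2b_4+12b_5b_7)y_{23}x_{23}+(-4b_0b_4+12b_2b_9-4b_3b_5)y_{23}x_{21}+(12b_3b_9+4b_4^2)x_{21}^2\\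 &+(-4b_1b_3-12b_6b_7)y_{23}x_{13}+(12b_1b_7+4b_2^2)x_{13}^2+(4b_0b_1+8b_2b_6)y_{23}x_{12}+(4b_1^2+12b_2b_8)x_{12}^2\\ &+(-4b_1b_5-12b_4b_8)x_{32}y_{13}+(4b_5b_6-36b_8b_9)x_{32}x_{31}+(4b_0b_5+8b_4b_6)y_{13}x_{31}\\ &+(-12b_2b_9-4b_3b_5)x_{23}x_{31}+(-b_0^2+4b_1b_4+4b_2b_5-4b_3b_6)x_{23}x_{32}+(-4b_2b_4-12b_5b_7)x_{23}y_{13}\\ &+(-4b_1b_3-12b_6b_7)x_{12}x_{23}+(-4b_1b_5-12b_4b_8)x_{31}x_{12}+(12b_0b_8-8b_1b_6)x_{32}x_{12}\\ &+(-4b_0b_1-4b_2b_6+12b_3b_8)x_{12}y_{13}+(4b_1b_2-36b_7b_8)x_{12}x_{13}\\ &+(-b_0^2-4b_1b_4+4b_2b_5+4b_3b_6)x_{12}x_{21}+(4b_3b_4-36b_7b_9)x_{21}x_{23}+(12b_0b_9-8b_4b_5)x_{31}x_{21}\\ &+(-12b_1b_9-4b_4b_6)x_{32}x_{21}+(4b_0b_4+8b_3b_5)x_{21}y_{13}\big).\end{aligned}$$ A cubic homogeneous polynomial $m_b$ with $[X_b,P(Q_b)]=P(m_b)$ exists for every $b$. On $\mathfrak{gl}(3,\mathbb K)^*=\mathfrak{sl}(3,\mathbb K)^*\oplus\mathbb K^*$ ($\mathbb K^*$ the dual line of the centre), $x_0$ is a linear coordinate proportional to the trace function, vanishing on $\mathfrak{sl}(3,\mathbb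 K)^*$; $\pi_1$ is the Lie–Poisson bivector of $\mathfrak{gl}(3,\mathbb K)^*$. In the formula for $\pi_2(b)$, $X_b$ and $Q_b$ are treated as objects on $\mathfrak{gl}(3,\mathbb K)^*$ independent of $x_0$ (with no $\partial/\partial x_0$ component). Explicit formula for $k_b=X_bC_2$: $$\begin{aligned}k_b=3(&b_0 x_{12} x_{21} y_{13}-b_0 x_{12} x_{21} y_{23}+3 b_0 x_{12} x_{23} x_{31}-3 b_0 x_{13} x_{21} x_{32}-b_0 x_{13} x_{31} y_{13}+b_0 x_{23} x_{32} y_{23}-b_0 y_{13}^2 y_{23}+b_0 y_{13} y_{23}^2\\ &-2 b_1 x_{12}^2 x_{21}+4 b_1 x_{12} x_{13} x_{31}-2 b_1 x_{12} x_{23} x_{32}+2 b_1 x_{12} y_{13} y_{23}-2 b_1 x_{13} x_{32} y_{13}+4 b_1 x_{13} x_{32} y_{23}\\ &-4 b_2 x_{12} x_{13} x_{21}+2 b_2 x_{12} x_{23} y_{13}+2 b_2 x_{12} x_{23} y_{23}+2 b_2 x_{13}^2 x_{31}+2 b_2 x_{13} x_{23} x_{32}+2 b_2 x_{13} y_{13} y_{23}-2 b_2 x_{13} y_{23}^2\\ &+4 b_3 x_{12} x_{21} x_{23}-2 b_3 x_{13} x_{21} y_{13}-2 b_3 x_{13} x_{21} y_{23}-2 b_3 x_{13} x_{23} x_{31}-2 b_3 x_{23}^2 x_{32}+2 b_3 x_{23} y_{13}^2-2 b_3 x_{23} y_{13} y_{23}\\ &+2 b_4 x_{12} x_{21}^2+2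 b_4 x_{13} x_{21} x_{31}-4 b_4 x_{21} x_{23} x_{32}-2 b_4 x_{21} y_{13} y_{23}-4 b_4 x_{23} x_{31} y_{13}+2 b_4 x_{23} x_{31} y_{23}\\ &-2 b_5 x_{12} x_{21} x_{31}-2 b_5 x_{13} x_{31}^2+4 b_5 x_{21} x_{32} y_{13}-2 b_5 x_{21} x_{32} y_{23}+4 b_5 x_{23} x_{31} x_{32}-2 b_5 x_{31} y_{13} y_{23}+2 b_5 x_{31} y_{23}^2\\ &+2 b_6 x_{12} x_{21} x_{32}+2 b_6 x_{12} x_{31} y_{13}-4 b_6 x_{12} x_{31} y_{23}-4 b_6 x_{13} x_{31} x_{32}+2 b_6 x_{23} x_{32}^2-2 b_6 x_{32} y_{13}^2+2 b_6 x_{32} y_{13} y_{23}\\ &-6 b_7 x_{12} x_{23}^2+6 b_7 x_{13}^2 x_{21}-6 b_7 x_{13} x_{23} y_{13}+6 b_7 x_{13} x_{23} y_{23}-6 b_8 x_{12}^2 x_{31}+6 b_8 x_{12} x_{32} y_{13}+6 b_8 x_{13} x_{32}^2\\ &+6 b_9 x_{21}^2 x_{32}-6 b_9 x_{21} x_{31} y_{23}-6 b_9 x_{23} x_{31}^2).\end{aligned}$$ Explicit formula for $M_b=m_b-X_bQ_b$: $$\begin{aligned}M_b=6(&(-16 b_3^3-72 b_3 b_4 b_7+216 b_7^2 b_9) x_{23}^3+(-16 b_5^3-72 b_5 b_6 b_9+216 b_8 b_9^2) x_{31}^3+(72 b_5 b_6 b_8+16 b_6^3-216 b_8^2 b_9)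 x_{32}^3\\ &+(4 b_0 b_1 b_4-8 b_0 b_2 b_5+4 b_0 b_3 b_6+12 b_1 b_2 b_9-12 b_1 b_3 b_5+12 b_2 b_4 b_6-24 b_3 b_4 b_8+12 b_5 b_6 b_7) y_{13}^3\\ &+(-12 b_0 b_1 b_4+12 b_0 b_3 b_6+36 b_1 b_2 b_9-12 b_1 b_3 b_5+12 b_2 b_4 b_6-36 b_5 b_6 b_7) y_{23}^3\\ &+(72 b_3 b_4 b_9+16 b_4^3-216 b_7 b_9^2) x_{21}^3+(72 b_1 b_2 b_7+16 b_2^3-216 b_7^2 b_8) x_{13}^3+(-16 b_1^3-72 b_1 b_2 b_8+216 b_7 b_8^2) x_{12}^3\\ &+(-48 b_0 b_5 b_6-48 b_1 b_5^2-144 b_4 b_5 b_8-96 b_4 b_6^2) x_{31} x_{32} y_{13}+(48 b_0 b_5 b_6+96 b_1 b_5^2+144 b_1 b_6 b_9+48 b_4 b_6^2) x_{31} x_{32} y_{23}\\ &+(-10 b_0^2 b_5-24 b_0 b_1 b_9-48 b_0 b_4 b_6-32 b_1 b_4 b_5+40 b_2 b_5^2-24 b_2 b_6 b_9-56 b_3 b_5 b_6+72 b_3 b_8 b_9+24 b_4^2 b_8) x_{31} y_{13} y_{23}\\ &+(10 b_0^2 b_6+48 b_0 b_1 b_5+24 b_0 b_4 b_8-24 b_1^2 b_9+32 b_1 b_4 b_6+56 b_2 b_5 b_6-72 b_2 b_8 b_9+24 b_3 b_5 b_8-40 b_3 b_6^2) x_{32} y_{13} y_{23}\\ &+(-12 b_0^2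 b_3+48 b_2 b_3 b_5+48 b_3^2 b_6+144 b_4 b_6 b_7) x_{12} x_{21} x_{23}\\ &+(6 b_0^2 b_5-72 b_0 b_1 b_9-24 b_2 b_5^2-216 b_2 b_6 b_9-24 b_3 b_5 b_6-216 b_3 b_8 b_9-72 b_4^2 b_8) x_{12} x_{21} x_{31}\\ &+(-6 b_0^2 b_6+72 b_0 b_4 b_8+72 b_1^2 b_9+24 b_2 b_5 b_6+216 b_2 b_8 b_9+216 b_3 b_5 b_8+24 b_3 b_6^2) x_{12} x_{21} x_{32}\\ &+(-3 b_0^3-54 b_0 b_1 b_4+12 b_0 b_2 b_5+30 b_0 b_3 b_6+90 b_1 b_2 b_9-30 b_1 b_3 b_5-42 b_2 b_4 b_6+36 b_3 b_4 b_8-162 b_5 b_6 b_7-324 b_7 b_8 b_9) x_{12} x_{21} y_{13}\\ &+(3 b_0^3+18 b_0 b_1 b_4-12 b_0 b_2 b_5+6 b_0 b_3 b_6+18 b_1 b_2 b_9+42 b_1 b_3 b_5+30 b_2 b_4 b_6-36 b_3 b_4 b_8+54 b_5 b_6 b_7+324 b_7 b_8 b_9) x_{12} x_{21} y_{23}\\ &+(-9 b_0^3-18 b_0 b_1 b_4+36 b_0 b_2 b_5+90 b_0 b_3 b_6+126 b_1 b_2 b_9-42 b_1 b_3 b_5+162 b_2 b_4 b_6-36 b_3 b_4 b_8-198 b_5 b_6 b_7+324 b_7 b_8 b_9) x_{12} x_{23} x_{31}\\ &+(6 b_0^2 b_1-72 b_0 b_3 b_8-24 b_1^2 b_4-24 b_1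 b_2 b_5-216 b_2 b_4 b_8-216 b_5 b_7 b_8-72 b_6^2 b_7) x_{12} x_{23} x_{32}\\ &+(-6 b_0^2 b_2-48 b_0 b_1 b_3+72 b_0 b_6 b_7-24 b_1 b_2 b_4+72 b_1 b_5 b_7+24 b_2^2 b_5-96 b_2 b_3 b_6+72 b_3^2 b_8+216 b_4 b_7 b_8) x_{12} x_{23} y_{13}\\ &+(-6 b_0^2 b_2-72 b_0 b_6 b_7-24 b_1 b_2 b_4-72 b_1 b_5 b_7+24 b_2^2 b_5+48 b_2 b_3 b_6-72 b_3^2 b_8-216 b_4 b_7 b_8) x_{12} x_{23} y_{23}\\ &+(144 b_0 b_5 b_8-48 b_1 b_5 b_6+144 b_4 b_6 b_8) x_{12} x_{31} x_{32}\\ &+(-6 b_0^2 b_6-72 b_0 b_4 b_8-72 b_1^2 b_9+48 b_1 b_4 b_6-24 b_2 b_5 b_6-216 b_2 b_8 b_9-72 b_3 b_5 b_8+24 b_3 b_6^2) x_{12} x_{31} y_{13}\\ &+(12 b_0^2 b_6+48 b_0 b_1 b_5+48 b_1 b_4 b_6+48 b_2 b_5 b_6-48 b_3 b_6^2) x_{12} x_{31} y_{23}\\ &+(54 b_0^2 b_8-24 b_0 b_1 b_6+24 b_1^2 b_5+72 b_2 b_5 b_8-24 b_2 b_6^2-144 b_3 b_6 b_8) x_{12} x_{32} y_{13}\\ &+(-48 b_1^2 b_5-144 b_1 b_4 b_8+48 b_2 b_6^2+144 b_3 b_6 b_8) x_{12} x_{32} y_{23}\\ &+(26 b_0^2 b_1+48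 b_0 b_2 b_6-24 b_0 b_3 b_8-8 b_1^2 b_4-8 b_1 b_2 b_5-32 b_1 b_3 b_6-24 b_2 b_4 b_8+72 b_5 b_7 b_8-120 b_6^2 b_7) x_{12} y_{13} y_{23}\\ &+(-144 b_0 b_4 b_7+48 b_2 b_3 b_4-144 b_3 b_5 b_7) x_{13} x_{21} x_{23}\\ &+(-6 b_0^2 b_4+72 b_0 b_2 b_9+216 b_1 b_3 b_9+24 b_1 b_4^2+24 b_3 b_4 b_6+72 b_5^2 b_7+216 b_6 b_7 b_9) x_{13} x_{21} x_{31}\\ &+(9 b_0^3-90 b_0 b_1 b_4-36 b_0 b_2 b_5+18 b_0 b_3 b_6+198 b_1 b_2 b_9-162 b_1 b_3 b_5+42 b_2 b_4 b_6+36 b_3 b_4 b_8-126 b_5 b_6 b_7-324 b_7 b_8 b_9) x_{13} x_{21} x_{32}\\ &+(6 b_0^2 b_3+72 b_0 b_5 b_7+24 b_1 b_3 b_4+216 b_1 b_7 b_9+72 b_2^2 b_9-48 b_2 b_3 b_5-24 b_3^2 b_6+72 b_4 b_6 b_7) x_{13} x_{21} y_{13}\\ &+(6 b_0^2 b_3+48 b_0 b_2 b_4-72 b_0 b_5 b_7+24 b_1 b_3 b_4-216 b_1 b_7 b_9-72 b_2^2 b_9+96 b_2 b_3 b_5-24 b_3^2 b_6-72 b_4 b_6 b_7) x_{13} x_{21} y_{23}\\ &+(6 b_0^2 b_3-72 b_0 b_5 b_7-24 b_1 b_3 b_4-216 b_1 b_7 b_9-72 b_2^2 b_9-24 b_3^2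 b_6-216 b_4 b_6 b_7) x_{13} x_{23} x_{31}\\ &+(-6 b_0^2 b_2+72 b_0 b_6 b_7+24 b_1 b_2 b_4+216 b_1 b_5 b_7+24 b_2^2 b_5+72 b_3^2 b_8+216 b_4 b_7 b_8) x_{13} x_{23} x_{32}\\ &+(-54 b_0^2 b_7+24 b_0 b_2 b_3+24 b_1 b_3^2-72 b_1 b_4 b_7-24 b_2^2 b_4+144 b_3 b_6 b_7) x_{13} x_{23} y_{13}\\ &+(54 b_0^2 b_7-24 b_0 b_2 b_3+24 b_1 b_3^2+72 b_1 b_4 b_7-24 b_2^2 b_4-144 b_2 b_5 b_7) x_{13} x_{23} y_{23}\\ &+(12 b_0^2 b_6-48 b_1 b_4 b_6-144 b_3 b_5 b_8-48 b_3 b_6^2) x_{13} x_{31} x_{32}\\ &+(3 b_0^3-30 b_0 b_1 b_4+36 b_0 b_2 b_5+6 b_0 b_3 b_6+18 b_1 b_2 b_9+42 b_1 b_3 b_5+30 b_2 b_4 b_6+108 b_3 b_4 b_8-90 b_5 b_6 b_7+324 b_7 b_8 b_9) x_{13} x_{31} y_{13}\\ &+(36 b_0 b_1 b_4-36 b_0 b_3 b_6-108 b_1 b_2 b_9-12 b_1 b_3 b_5+12 b_2 b_4 b_6+108 b_5 b_6 b_7) x_{13} x_{31} y_{23}\\ &+(6 b_0^2 b_1+48 b_0 b_2 b_6-72 b_0 b_3 b_8-24 b_1^2 b_4+24 b_1 b_2 b_5+96 b_1 b_3 b_6-72 b_2 b_4 b_8-216 b_5 b_7 b_8-72 b_6^2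 b_7) x_{13} x_{32} y_{13}\\ &+(-12 b_0^2 b_1-48 b_0 b_2 b_6+48 b_1^2 b_4-48 b_1 b_2 b_5-48 b_1 b_3 b_6) x_{13} x_{32} y_{23}\\ &+(10 b_0^2 b_2+24 b_0 b_6 b_7+8 b_1 b_2 b_4-120 b_1 b_5 b_7-40 b_2^2 b_5-64 b_2 b_3 b_6-24 b_3^2 b_8-72 b_4 b_7 b_8) x_{13} y_{13} y_{23}\\ &+(144 b_0 b_3 b_9+144 b_2 b_4 b_9-48 b_3 b_4 b_5) x_{21} x_{23} x_{31}+(12 b_0^2 b_4-144 b_1 b_3 b_9-48 b_1 b_4^2-48 b_2 b_4 b_5) x_{21} x_{23} x_{32}\\ &+(48 b_0 b_3 b_4+48 b_2 b_4^2+96 b_3^2 b_5+144 b_4 b_5 b_7) x_{21} x_{23} y_{13}+(144 b_2 b_3 b_9+48 b_2 b_4^2-48 b_3^2 b_5-144 b_4 b_5 b_7) x_{21} x_{23} y_{23}\\ &+(-144 b_0 b_6 b_9-144 b_1 b_5 b_9+48 b_4 b_5 b_6) x_{21} x_{31} x_{32}+(144 b_1 b_4 b_9-144 b_2 b_5 b_9-48 b_3 b_5^2+48 b_4^2 b_6) x_{21} x_{31} y_{13}\\ &+(-54 b_0^2 b_9+24 b_0 b_4 b_5+144 b_2 b_5 b_9+24 b_3 b_5^2-72 b_3 b_6 b_9-24 b_4^2 b_6) x_{21} x_{31} y_{23}\\ &+(-12 b_0^2 b_5-48 b_0 b_4 b_6-48 b_1 b_4 b_5+48 b_2 b_5^2-48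 b_3 b_5 b_6) x_{21} x_{32} y_{13}\\ &+(6 b_0^2 b_5+72 b_0 b_1 b_9-48 b_1 b_4 b_5-24 b_2 b_5^2+72 b_2 b_6 b_9+24 b_3 b_5 b_6+216 b_3 b_8 b_9+72 b_4^2 b_8) x_{21} x_{32} y_{23}\\ &+(-26 b_0^2 b_4+24 b_0 b_2 b_9-48 b_0 b_3 b_5+24 b_1 b_3 b_9+8 b_1 b_4^2+32 b_2 b_4 b_5+8 b_3 b_4 b_6+120 b_5^2 b_7-72 b_6 b_7 b_9) x_{21} y_{13} y_{23}\\ &+(-12 b_0^2 b_5+48 b_1 b_4 b_5+48 b_2 b_5^2+144 b_2 b_6 b_9) x_{23} x_{31} x_{32}\\ &+(12 b_0^2 b_4+48 b_0 b_3 b_5-48 b_1 b_4^2+48 b_2 b_4 b_5+48 b_3 b_4 b_6) x_{23} x_{31} y_{13}\\ &+(-6 b_0^2 b_4+72 b_0 b_2 b_9-48 b_0 b_3 b_5+72 b_1 b_3 b_9+24 b_1 b_4^2-96 b_2 b_4 b_5-24 b_3 b_4 b_6+72 b_5^2 b_7+216 b_6 b_7 b_9) x_{23} x_{31} y_{23}\\ &+(36 b_0 b_1 b_4-36 b_0 b_3 b_6-108 b_1 b_2 b_9-12 b_1 b_3 b_5+12 b_2 b_4 b_6+108 b_5 b_6 b_7) x_{23} x_{32} y_{13}\\ &+(-3 b_0^3-6 b_0 b_1 b_4+12 b_0 b_2 b_5-18 b_0 b_3 b_6-54 b_1 b_2 b_9-30 b_1 b_3 b_5-42 b_2 b_4 b_6+36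 b_3 b_4 b_8-18 b_5 b_6 b_7-324 b_7 b_8 b_9) x_{23} x_{32} y_{23}\\ &+(-10 b_0^2 b_3-24 b_0 b_5 b_7-8 b_1 b_3 b_4+72 b_1 b_7 b_9+24 b_2^2 b_9+64 b_2 b_3 b_5+40 b_3^2 b_6+120 b_4 b_6 b_7) x_{23} y_{13} y_{23}\\ &+(12 b_0^2 b_2-144 b_1 b_5 b_7-48 b_2^2 b_5-48 b_2 b_3 b_6) x_{12} x_{13} x_{21}+(144 b_0 b_1 b_7-48 b_1 b_2 b_3+144 b_2 b_6 b_7) x_{12} x_{13} x_{23}\\ &+(-12 b_0^2 b_1+48 b_1^2 b_4+48 b_1 b_3 b_6+144 b_2 b_4 b_8) x_{12} x_{13} x_{31}+(-144 b_0 b_2 b_8+48 b_1 b_2 b_6-144 b_1 b_3 b_8) x_{12} x_{13} x_{32}\\ &+(-48 b_1^2 b_3+144 b_1 b_6 b_7+48 b_2^2 b_6-144 b_2 b_3 b_8) x_{12} x_{13} y_{13}+(-48 b_0 b_1 b_2-48 b_1^2 b_3-144 b_1 b_6 b_7-96 b_2^2 b_6) x_{12} x_{13} y_{23}\\ &+(-6 b_0^2 b_6+24 b_1 b_4 b_6+24 b_2 b_5 b_6-216 b_2 b_8 b_9-72 b_3 b_5 b_8-24 b_3 b_6^2) x_{23} x_{32}^2\\ &+(10 b_0^2 b_3+24 b_0 b_2 b_4+24 b_0 b_5 b_7+32 b_1 b_3 b_4-72 b_1 b_7 b_9-24 b_2^2 b_9-16 b_2 b_3 b_5-40 b_3^2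 b_6-48 b_4 b_6 b_7) x_{23} y_{13}^2\\ &+(-8 b_0^2 b_3-24 b_0 b_2 b_4+24 b_0 b_5 b_7+8 b_1 b_3 b_4-72 b_1 b_7 b_9+48 b_2^2 b_9-16 b_2 b_3 b_5-16 b_3^2 b_6-48 b_4 b_6 b_7) x_{23} y_{23}^2\\ &+(-24 b_5^2 b_6-216 b_5 b_8 b_9-144 b_6^2 b_9) x_{31}^2 x_{32}+(-24 b_0 b_5^2+72 b_1 b_5 b_9-48 b_4 b_5 b_6+216 b_4 b_8 b_9) x_{31}^2 y_{13}\\ &+(-72 b_0 b_6 b_9-72 b_1 b_5 b_9+24 b_4 b_5 b_6) x_{31}^2 y_{23}+(144 b_5^2 b_8+24 b_5 b_6^2+216 b_6 b_8 b_9) x_{31} x_{32}^2\\ &+(-8 b_0^2 b_5+24 b_0 b_1 b_9+32 b_1 b_4 b_5-16 b_2 b_5^2+24 b_2 b_6 b_9+32 b_3 b_5 b_6-72 b_3 b_8 b_9+48 b_4^2 b_8) x_{31} y_{13}^2\\ &+(10 b_0^2 b_5+24 b_0 b_1 b_9+24 b_0 b_4 b_6-16 b_1 b_4 b_5-40 b_2 b_5^2-48 b_2 b_6 b_9+32 b_3 b_5 b_6-72 b_3 b_8 b_9-24 b_4^2 b_8) x_{31} y_{23}^2\\ &+(72 b_0 b_5 b_8-24 b_1 b_5 b_6+72 b_4 b_6 b_8) x_{32}^2 y_{13}+(24 b_0 b_6^2+48 b_1 b_5 b_6-216 b_1 b_8 b_9-72 b_4 b_6 b_8) x_{32}^2 y_{23}\\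 &+(-10 b_0^2 b_6-24 b_0 b_1 b_5-24 b_0 b_4 b_8+24 b_1^2 b_9+16 b_1 b_4 b_6-32 b_2 b_5 b_6+72 b_2 b_8 b_9+48 b_3 b_5 b_8+40 b_3 b_6^2) x_{32} y_{13}^2\\ &+(8 b_0^2 b_6-24 b_0 b_4 b_8-48 b_1^2 b_9-32 b_1 b_4 b_6-32 b_2 b_5 b_6+72 b_2 b_8 b_9-24 b_3 b_5 b_8+16 b_3 b_6^2) x_{32} y_{23}^2\\ &+(-5 b_0^3+2 b_0 b_1 b_4+20 b_0 b_2 b_5+14 b_0 b_3 b_6-30 b_1 b_2 b_9+18 b_1 b_3 b_5-18 b_2 b_4 b_6-12 b_3 b_4 b_8-66 b_5 b_6 b_7+108 b_7 b_8 b_9) y_{13}^2 y_{23}\\ &+(5 b_0^3+10 b_0 b_1 b_4-20 b_0 b_2 b_5-26 b_0 b_3 b_6-6 b_1 b_2 b_9+18 b_1 b_3 b_5-18 b_2 b_4 b_6+12 b_3 b_4 b_8+102 b_5 b_6 b_7-108 b_7 b_8 b_9) y_{13} y_{23}^2\\ &+(-24 b_1^2 b_2-216 b_1 b_7 b_8-144 b_2^2 b_8) x_{12}^2 x_{13}+(6 b_0^2 b_1+24 b_1^2 b_4-24 b_1 b_2 b_5-24 b_1 b_3 b_6+72 b_2 b_4 b_8+216 b_5 b_7 b_8) x_{12}^2 x_{21}\\ &+(-216 b_0 b_7 b_8+24 b_1^2 b_3+72 b_1 b_6 b_7+144 b_2 b_3 b_8) x_{12}^2 x_{23}+(18 b_0^2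 b_8+24 b_1^2 b_5+72 b_2 b_5 b_8-72 b_3 b_6 b_8) x_{12}^2 x_{31}\\ &+(-72 b_0 b_1 b_8+48 b_1^2 b_6+72 b_2 b_6 b_8+216 b_3 b_8^2) x_{12}^2 x_{32}+(24 b_0 b_1^2+72 b_0 b_2 b_8+24 b_1 b_2 b_6-216 b_6 b_7 b_8) x_{12}^2 y_{13}\\ &+(-24 b_0 b_1^2-48 b_1 b_2 b_6+72 b_1 b_3 b_8+216 b_6 b_7 b_8) x_{12}^2 y_{23}+(144 b_1^2 b_7+24 b_1 b_2^2+216 b_2 b_7 b_8) x_{12} x_{13}^2\\ &+(-6 b_0^2 b_4-72 b_1 b_3 b_9-24 b_1 b_4^2+24 b_2 b_4 b_5+24 b_3 b_4 b_6-216 b_6 b_7 b_9) x_{12} x_{21}^2\\ &+(18 b_0^2 b_7+24 b_1 b_3^2+72 b_1 b_4 b_7-72 b_2 b_5 b_7) x_{12} x_{23}^2+(-216 b_0 b_8 b_9+24 b_1 b_5^2+144 b_1 b_6 b_9+72 b_4 b_5 b_8) x_{12} x_{31}^2\\ &+(72 b_0 b_6 b_8-72 b_1 b_5 b_8-48 b_1 b_6^2-216 b_4 b_8^2) x_{12} x_{32}^2\\ &+(-8 b_0^2 b_1-24 b_0 b_2 b_6+24 b_0 b_3 b_8-16 b_1^2 b_4+8 b_1 b_2 b_5-16 b_1 b_3 b_6-48 b_2 b_4 b_8-72 b_5 b_7 b_8+48 b_6^2 b_7) x_{12} y_{13}^2\\ &+(-8 b_0^2 b_1+24 b_0 b_3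 b_8-16 b_1^2 b_4+32 b_1 b_2 b_5+32 b_1 b_3 b_6+24 b_2 b_4 b_8-72 b_5 b_7 b_8+48 b_6^2 b_7) x_{12} y_{23}^2\\ &+(-18 b_0^2 b_7-72 b_1 b_4 b_7-24 b_2^2 b_4+72 b_3 b_6 b_7) x_{13}^2 x_{21}+(72 b_0 b_2 b_7-72 b_1 b_3 b_7-48 b_2^2 b_3-216 b_6 b_7^2) x_{13}^2 x_{23}\\ &+(-6 b_0^2 b_2+24 b_1 b_2 b_4-72 b_1 b_5 b_7-24 b_2^2 b_5+24 b_2 b_3 b_6-216 b_4 b_7 b_8) x_{13}^2 x_{31}\\ &+(216 b_0 b_7 b_8-144 b_1 b_6 b_7-24 b_2^2 b_6-72 b_2 b_3 b_8) x_{13}^2 x_{32}+(-72 b_0 b_1 b_7-24 b_0 b_2^2-24 b_1 b_2 b_3+216 b_3 b_7 b_8) x_{13}^2 y_{13}\\ &+(72 b_0 b_1 b_7-24 b_1 b_2 b_3+72 b_2 b_6 b_7) x_{13}^2 y_{23}+(216 b_0 b_7 b_9-144 b_2 b_3 b_9-24 b_2 b_4^2-72 b_4 b_5 b_7) x_{13} x_{21}^2\\ &+(-72 b_0 b_3 b_7+48 b_2 b_3^2+72 b_2 b_4 b_7+216 b_5 b_7^2) x_{13} x_{23}^2\\ &+(6 b_0^2 b_5-24 b_1 b_4 b_5+24 b_2 b_5^2+72 b_2 b_6 b_9-24 b_3 b_5 b_6+216 b_3 b_8 b_9) x_{13} x_{31}^2\\ &+(-18 b_0^2 b_8+72 b_1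 b_4 b_8-72 b_2 b_5 b_8-24 b_2 b_6^2) x_{13} x_{32}^2\\ &+(8 b_0^2 b_2+24 b_0 b_1 b_3-24 b_0 b_6 b_7-8 b_1 b_2 b_4+48 b_1 b_5 b_7+16 b_2^2 b_5+16 b_2 b_3 b_6-48 b_3^2 b_8+72 b_4 b_7 b_8) x_{13} y_{13}^2\\ &+(-10 b_0^2 b_2-24 b_0 b_1 b_3-24 b_0 b_6 b_7-32 b_1 b_2 b_4+48 b_1 b_5 b_7+40 b_2^2 b_5+16 b_2 b_3 b_6+24 b_3^2 b_8+72 b_4 b_7 b_8) x_{13} y_{23}^2\\ &+(144 b_3^2 b_9+24 b_3 b_4^2+216 b_4 b_7 b_9) x_{21}^2 x_{23}+(72 b_0 b_4 b_9-216 b_2 b_9^2-72 b_3 b_5 b_9-48 b_4^2 b_5) x_{21}^2 x_{31}\\ &+(-18 b_0^2 b_9+72 b_2 b_5 b_9-72 b_3 b_6 b_9-24 b_4^2 b_6) x_{21}^2 x_{32}+(24 b_0 b_4^2-72 b_2 b_4 b_9+48 b_3 b_4 b_5-216 b_5 b_7 b_9) x_{21}^2 y_{13}\\ &+(-72 b_0 b_3 b_9-24 b_0 b_4^2-24 b_3 b_4 b_5+216 b_5 b_7 b_9) x_{21}^2 y_{23}+(-24 b_3^2 b_4-216 b_3 b_7 b_9-144 b_4^2 b_7) x_{21} x_{23}^2\\ &+(-72 b_0 b_5 b_9+216 b_1 b_9^2+48 b_4 b_5^2+72 b_4 b_6 b_9) x_{21} x_{31}^2+(216 b_0 b_8 b_9-72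 b_1 b_6 b_9-144 b_4 b_5 b_8-24 b_4 b_6^2) x_{21} x_{32}^2\\ &+(8 b_0^2 b_4-24 b_0 b_2 b_9-24 b_1 b_3 b_9+16 b_1 b_4^2-32 b_2 b_4 b_5-32 b_3 b_4 b_6-48 b_5^2 b_7+72 b_6 b_7 b_9) x_{21} y_{13}^2\\ &+(8 b_0^2 b_4-24 b_0 b_2 b_9+24 b_0 b_3 b_5+48 b_1 b_3 b_9+16 b_1 b_4^2+16 b_2 b_4 b_5-8 b_3 b_4 b_6-48 b_5^2 b_7+72 b_6 b_7 b_9) x_{21} y_{23}^2\\ &+(-216 b_0 b_7 b_9+72 b_2 b_3 b_9+24 b_3^2 b_5+144 b_4 b_5 b_7) x_{23}^2 x_{31}\\ &+(6 b_0^2 b_3-24 b_1 b_3 b_4+216 b_1 b_7 b_9-24 b_2 b_3 b_5+24 b_3^2 b_6+72 b_4 b_6 b_7) x_{23}^2 x_{32}\\ &+(-72 b_0 b_4 b_7+24 b_2 b_3 b_4-72 b_3 b_5 b_7) x_{23}^2 y_{13}+(24 b_0 b_3^2+72 b_0 b_4 b_7+24 b_2 b_3 b_4-216 b_2 b_7 b_9) x_{23}^2 y_{23}\\ &+(18 b_0^2 b_9-72 b_1 b_4 b_9+24 b_3 b_5^2+72 b_3 b_6 b_9) x_{23} x_{31}^2).\end{aligned}$$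
   Formalization: The printed formulas clash with X_b. X_b is kept; with b'=(2b0,b1,b2,b4,b3,b5,b6,b8,b7,b9), Q_b is -3/2 times the printed Q at b', k_b is the printed k at b' (for C_2 rescaled by 18, i.e. Trace/2), and M_b is 3/2 times the printed M at b' (for a suitable m_b). *)

(* Defs.v *)
From HB Require Import structures.
From mathcomp Require Import all_boot all_order all_algebra.
From mathcomp Require Import mpoly.
From mathcomp Require Import reals complex.
From mathcomp Require Import ring.
Set Implicit Arguments.
Unset Strict Implicit.
Unset Printing Implicit Defensive.
Import GRing.Theory.
Local Open Scope ring_scope.

Inductive real_or_complex (R : realType) : fieldType -> Prop :=
| IsReal : real_or_complex R R
| IsComplex : real_or_complex R R[i].

(* Polynomial multivector fields on K^n.  The components of a bivector [eta]
   and of a trivector [T] are the full skew-symmetric arrays, that is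
   eta = \sum_(i < j) eta i j d_i /\ d_j and
   T = \sum_(i < j < k) T (i, j, k) d_i /\ d_j /\ d_k. *)

Definition vfield (K : fieldType) (n : nat) := 'rV[{mpoly K[n]}]_n.
Definition bivector (K : fieldType) (n : nat) := 'M[{mpoly K[n]}]_n.
Definition trivector (K : fieldType) (n : nat) :=
  {ffun 'I_n * 'I_n * 'I_n -> {mpoly K[n]}}.

Definition wedge_vv (K : fieldType) (n : nat) (X Y : vfield K n) :
    bivector K n :=
  \matrix_(i, j) (X 0 i * Y 0 j - X 0 j * Y 0 i).

Definition wedge_vb (K : fieldType) (n : nat) (X : vfield K n)
    (eta : bivector K n) : trivector K n :=
  [ffun t : 'I_n * 'I_n * 'I_n => let: (i, j, k) := t in
     X 0 i * eta j k + X 0 j * eta k i + X 0 k * eta i j].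

(* The Schouten brackets of the degrees in use; [_v], [_b], [_f] stand for
   vector field, bivector and function.  The lemmas below are the graded
   Leibniz rules that, with [X, f] = Xf and the Lie bracket, fix the signs. *)

Definition schouten_vf (K : fieldType) (n : nat) (X : vfield K n)
    (f : {mpoly K[n]}) : {mpoly K[n]} :=
  \sum_i X 0 i * f^`M(i).

Definition schouten_vv (K : fieldType) (n : nat) (X Y : vfield K n) :
    vfield K n :=
  \row_i (schouten_vf X (Y 0 i) - schouten_vf Y (X 0 i)).

Definition schouten_vb (K : fieldType) (n : nat) (X : vfield K n)
    (eta : bivector K n) : bivector K n :=
  \matrix_(i, j) (schouten_vf X (eta i j)
    - \sum_l (eta l j * (X 0 i)^`M(l) + eta i l * (X 0 j)^`M(l))).

Definition schouten_bf (K : fieldType) (n : nat) (eta : bivector K n)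
    (f : {mpoly K[n]}) : vfield K n :=
  \row_i \sum_j eta i j * f^`M(j).

Definition schouten_bb (K : fieldType) (n : nat) (eta zeta : bivector K n) :
    trivector K n :=
  [ffun t : 'I_n * 'I_n * 'I_n => let: (i, j, k) := t in
     \sum_l (eta i l * (zeta j k)^`M(l) + zeta i l * (eta j k)^`M(l)
           + eta j l * (zeta k i)^`M(l) + zeta j l * (eta k i)^`M(l)
           + eta k l * (zeta i j)^`M(l) + zeta k l * (eta i j)^`M(l))].

Lemma schouten_vb_wedge (K : fieldType) (n : nat) (X Y Z : vfield K n) :
  schouten_vb X (wedge_vv Y Z)
  = wedge_vv (schouten_vv X Y) Z + wedge_vv Y (schouten_vv X Z).
Proof.
apply/matrixP=> i j; rewrite !mxE /schouten_vf.
rewrite !(mulrBl, mulrBr) !(mulr_suml, mulr_sumr).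
do !rewrite -?sumrB -?big_split /=.
apply: eq_bigr => l _; rewrite !mxE !(mderivB, mderivM).
by ring.
Qed.

Lemma schouten_bf_wedge (K : fieldType) (n : nat) (Y Z : vfield K n)
    (f : {mpoly K[n]}) :
  schouten_bf (wedge_vv Y Z) f = schouten_vf Z f *: Y - schouten_vf Y f *: Z.
Proof.
apply/matrixP=> i j; rewrite !mxE /schouten_vf !mulr_suml -sumrB.
by apply: eq_bigr => l _; rewrite !mxE !ord1; ring.
Qed.

Lemma schouten_bb_wedge (K : fieldType) (n : nat) (eta : bivector K n)
    (Y Z : vfield K n) (eta_skew : forall i j, eta i j = - eta j i) :
  schouten_bb eta (wedge_vv Y Z)
  = wedge_vb Y (schouten_vb Z eta) - wedge_vb Z (schouten_vb Y eta).
Proof.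
apply/ffunP=> -[[i j] k]; rewrite !ffunE !mxE /schouten_vf.
rewrite !(mulrBr, mulrDr) !mulr_sumr.
do !rewrite -?sumrN -?sumrB -?big_split /=.
apply: eq_bigr => l _; rewrite !mxE !(mderivB, mderivM).
by rewrite (eta_skew l i) (eta_skew l j) (eta_skew l k); ring.
Qed.

Definition casimir (K : fieldType) (n : nat) (eta : bivector K n)
    (f : {mpoly K[n]}) : Prop :=
  schouten_bf eta f = 0.

(* The coordinates on sl(3)^* are, in this order, x12, x13, x21, x23, x31, x32,
   y13, y23: the i-th one is the linear function given by [sl_basis i]. *)

Definition sl_basis (K : fieldType) (i : 'I_8) : 'M[K]_3 :=
  let o1 := @Ordinal 3 0 isT in let o2 := @Ordinal 3 1 isT in
  let o3 := @Ordinal 3 2 isT in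
  nth 0 [:: delta_mx o1 o2; delta_mx o1 o3; delta_mx o2 o1; delta_mx o2 o3;
            delta_mx o3 o1; delta_mx o3 o2; delta_mx o1 o1 - delta_mx o3 o3;
            delta_mx o2 o2 - delta_mx o3 o3] i.

Definition sl_coord (K : fieldType) (A : 'M[K]_3) (i : 'I_8) : K :=
  let o1 := @Ordinal 3 0 isT in let o2 := @Ordinal 3 1 isT in
  let o3 := @Ordinal 3 2 isT in
  nth 0 [:: A o1 o2; A o1 o3; A o2 o1; A o2 o3; A o3 o1; A o3 o2;
            A o1 o1; A o2 o2] i.

(* The ninth coordinate x0 on gl(3)^* is given by the central matrix
   [lambda%:M], so that it is [lambda] times the trace function. *)

Definition gl_basis (K : fieldType) (lambda : K) (i : 'I_9) : 'M[K]_3 :=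
  if unlift ord_max i is Some j then sl_basis K j else lambda%:M.

Definition gl_coord (K : fieldType) (lambda : K) (A : 'M[K]_3) (i : 'I_9) : K :=
  if unlift ord_max i is Some j then sl_coord (A - (\tr A / 3)%:M) j
  else \tr A / (3 * lambda).

Definition lie (K : fieldType) (A B : 'M[K]_3) : 'M[K]_3 := A *m B - B *m A.

Definition lie_poisson (K : fieldType) (n : nat) (basis : 'I_n -> 'M[K]_3)
    (coord : 'M[K]_3 -> 'I_n -> K) : bivector K n :=
  \matrix_(i, j) \sum_k coord (lie (basis i) (basis j)) k *: 'X_k.

Definition sl_poisson (K : fieldType) : bivector K 8 :=
  lie_poisson (@sl_basis K) (@sl_coord K).

Definition gl_poisson (K : fieldType) (lambda : K) : bivector K 9 :=
  lie_poisson (gl_basis lambda) (gl_coord lambda).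

Lemma sl_coordK (K : fieldType) (A : 'M[K]_3) :
  \tr A = 0 -> \sum_i sl_coord A i *: sl_basis K i = A.
Proof.
move=> trA0; have {}trA0 : A ord0 ord0 + (A (lift ord0 ord0) (lift ord0 ord0)
    + A (lift ord0 (lift ord0 ord0)) (lift ord0 (lift ord0 ord0))) = 0.
  by move: trA0; rewrite /mxtrace !big_ord_recl big_ord0 addr0.
apply/matrixP=> k l; rewrite !big_ord_recl big_ord0 !mxE.
case: k l => [[|[|[|//]]] lk] [[|[|[|//]]] ll];
  rewrite /sl_coord /sl_basis /=
    ?(subr0, sub0r) ?(mulr0, mulr1, mulrN1, addr0, add0r);
  try by congr (A _ _); apply/val_inj.
rewrite -opprD; apply/eqP; rewrite eqr_oppLR -addr_eq0; apply/eqP.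
rewrite -{}[RHS]trA0 addrA; congr (A _ _ + A _ _ + A _ _); exact/val_inj.
Qed.

Lemma sl_basisK (K : fieldType) (i j : 'I_8) :
  sl_coord (sl_basis K i) j = (i == j)%:R.
Proof.
by case: i j => [[|[|[|[|[|[|[|[|//]]]]]]]] li]
  [[|[|[|[|[|[|[|[|//]]]]]]]] lj]; rewrite /sl_coord /sl_basis /= !mxE /= ?subr0.
Qed.

Lemma gl_coordK (K : fieldType) (lambda : K) (A : 'M[K]_3) :
  3 * lambda != 0 -> \sum_i gl_coord lambda A i *: gl_basis lambda i = A.
Proof.
move=> nz; have nz3 : (3 : K) != 0 by apply: contraNneq nz => ->; rewrite mul0r.
rewrite big_ord_recr /= /gl_coord /gl_basis unlift_none.
under eq_bigr => i _.
  rewrite (_ : widen_ord _ i = lift ord_max i) ?liftK; first over.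
  by apply/val_inj; rewrite /= /bump leqNgt ltn_ord.
rewrite sl_coordK; last first.
  by rewrite raddfB /= mxtrace_scalar -[X in _ - X]mulr_natr divfK // subrr.
rewrite scale_scalar_mx (_ : _ * lambda = \tr A / 3) ?subrK //.
by field; move: nz; rewrite mulf_eq0 negb_or.
Qed.

(* The Killing form, and the function on sl(3)^* corresponding to Trace(x^d):
   [killing_dual] is the generic point of sl(3)^* transported to sl(3), that is
   the matrix x with entries in K[x12, ..., y23] such that
   killing x (sl_basis i) = 'X_i. *)

Definition killing (K : fieldType) (A B : 'M[K]_3) : K :=
  \sum_i sl_coord (lie A (lie B (sl_basis K i))) i.

Definition killing_gram (K : fieldType) : 'M[K]_8 :=
  \matrix_(i, j) killing (sl_basis K i) (sl_basis K j).

Definition killing_dual (K : fieldType) : 'M[{mpoly K[8]}]_3 :=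
  \sum_i \sum_j (invmx (killing_gram K) i j *: 'X_i)
                *: map_mx (@mpolyC 8 K) (sl_basis K j).

Definition killing_trace (K : fieldType) (d : nat) : {mpoly K[8]} :=
  \tr (killing_dual K ^+ d).

(* The irreducible submodule of quadratic polynomials generated by x13^2; an
   element x of sl(3) acts on functions by {x, -}. *)

Inductive in_U (K : fieldType) : {mpoly K[8]} -> Prop :=
| in_U_gen : in_U ('X_(@Ordinal 8 1 isT) ^+ 2)
| in_U_add p q : in_U p -> in_U q -> in_U (p + q)
| in_U_scale c p : in_U p -> in_U (c *: p)
| in_U_act i p : in_U p -> in_U (schouten_bf (sl_poisson K) p 0 i).

(* Component j of the quadratic vector field X_i, i = 0, ..., 9, is
   [nth 0 (nth [::] field_expr i) j]. *)

Definition field_expr (A : comNzRingType) (x : 'I_8 -> A) : seq (seq A) :=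
  let x12 := x (@Ordinal 8 0 isT) in let x13 := x (@Ordinal 8 1 isT) in
  let x21 := x (@Ordinal 8 2 isT) in let x23 := x (@Ordinal 8 3 isT) in
  let x31 := x (@Ordinal 8 4 isT) in let x32 := x (@Ordinal 8 5 isT) in
  let y13 := x (@Ordinal 8 6 isT) in let y23 := x (@Ordinal 8 7 isT) in
  [::
   [:: (4 * y13 - 2 * y23) * x12 - 6 * x13 * x32;
       (- 4 * y13 + 2 * y23) * x13 + 6 * x12 * x23;
       (2 * y13 - 4 * y23) * x21 + 6 * x23 * x31;
       (- 2 * y13 + 4 * y23) * x23 - 6 * x13 * x21;
       (- 2 * y13 - 2 * y23) * x31 - 6 * x32 * x21;
       (2 * y13 + 2 * y23) * x32 + 6 * x12 * x31;
       - 2 * y13 ^+ 2 - 4 * y13 * y23 + 4 * y23 ^+ 2;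
       - 4 * y13 ^+ 2 + 4 * y13 * y23 + 2 * y23 ^+ 2];
   [:: - 3 * x12 ^+ 2;
       6 * x13 * x12;
       - 3 * x12 * x21 + 3 * x13 * x31 - 3 * x23 * x32 + y13 * y23 + y23 ^+ 2;
       - 2 * x13 * y13 + 4 * x13 * y23;
       3 * x12 * x31 - x32 * y13 + 5 * x32 * y23;
       - 3 * x32 * x12;
       2 * x12 * y13 + 5 * x12 * y23 - 3 * x13 * x32;
       4 * x12 * y13 + x12 * y23 + 3 * x13 * x32];
   [:: - 6 * x13 * x12;
       3 * x13 ^+ 2;
       - 3 * x13 * x21 + x23 * y13 + 4 * x23 * y23;
       3 * x13 * x23;
       - 3 * x12 * x21 + 3 * x13 * x31 + 3 * x23 * x32 + y13 * y23
       - 2 * y23 ^+ 2;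
       2 * x12 * y13 + 2 * x12 * y23;
       6 * x12 * x23 + 2 * x13 * y13 + 2 * x13 * y23;
       3 * x12 * x23 + 4 * x13 * y13 - 5 * x13 * y23];
   [:: 3 * x12 * x21 + 3 * x13 * x31 - 3 * x23 * x32 - y13 ^+ 2 - y13 * y23;
       - 4 * x23 * y13 + 2 * x23 * y23;
       3 * x21 ^+ 2;
       - 6 * x23 * x21;
       3 * x31 * x21;
       - 3 * x21 * x32 - 5 * x31 * y13 + x31 * y23;
       - x21 * y13 - 4 * x21 * y23 - 3 * x23 * x31;
       - 5 * x21 * y13 - 2 * x21 * y23 + 3 * x23 * x31];
   [:: 3 * x12 * x23 - 4 * x13 * y13 - x13 * y23;
       - 3 * x13 * x23;
       6 * x23 * x21;
       - 3 * x23 ^+ 2;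
       - 2 * x21 * y13 - 2 * x21 * y23;
       3 * x12 * x21 - 3 * x13 * x31 - 3 * x23 * x32 + 2 * y13 ^+ 2
       - y13 * y23;
       - 3 * x13 * x21 + 5 * x23 * y13 - 4 * x23 * y23;
       - 6 * x13 * x21 - 2 * x23 * y13 - 2 * x23 * y23];
   [:: 4 * x32 * y13 - 2 * x32 * y23;
       - 3 * x12 * x21 - 3 * x13 * x31 + 3 * x23 * x32 + y13 ^+ 2
       - 3 * y13 * y23 + 2 * y23 ^+ 2;
       - 3 * x31 * x21;
       5 * x21 * y13 - 4 * x21 * y23 + 3 * x23 * x31;
       - 3 * x31 ^+ 2;
       6 * x31 * x32;
       6 * x21 * x32 - 4 * x31 * y13 + 2 * x31 * y23;
       3 * x21 * x32 - 5 * x31 * y13 + 7 * x31 * y23];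
   [:: 3 * x32 * x12;
       4 * x12 * y13 - 5 * x12 * y23 - 3 * x13 * x32;
       2 * x31 * y13 - 4 * x31 * y23;
       3 * x12 * x21 - 3 * x13 * x31 + 3 * x23 * x32 - 2 * y13 ^+ 2
       + 3 * y13 * y23 - y23 ^+ 2;
       - 6 * x31 * x32;
       3 * x32 ^+ 2;
       - 3 * x12 * x31 - 7 * x32 * y13 + 5 * x32 * y23;
       - 6 * x12 * x31 - 2 * x32 * y13 + 4 * x32 * y23];
   [:: 0;
       - 9 * x12 ^+ 2;
       - 9 * x12 * x31 + 3 * x32 * y13 + 3 * x32 * y23;
       6 * x12 * y13 - 3 * x12 * y23 + 9 * x13 * x32;
       9 * x32 ^+ 2;
       0;
       18 * x32 * x12;
       9 * x32 * x12];
   [:: 9 * x13 ^+ 2;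
       0;
       - 9 * x23 ^+ 2;
       0;
       9 * x13 * x21 - 3 * x23 * y13 + 6 * x23 * y23;
       - 9 * x12 * x23 - 6 * x13 * y13 + 3 * x13 * y23;
       - 9 * x13 * x23;
       9 * x13 * x23];
   [:: 9 * x21 * x32 - 3 * x31 * y13 - 3 * x31 * y23;
       3 * x21 * y13 - 6 * x21 * y23 - 9 * x23 * x31;
       0;
       9 * x21 ^+ 2;
       0;
       - 9 * x31 ^+ 2;
       - 9 * x31 * x21;
       - 18 * x31 * x21]].

(* The closed formulas below use the parameters in which
   X_b = b0/2 X_0 + b1 X_1 + b2 X_2 + b4 X_3 + b3 X_4 + b5 X_5 + b6 X_6
         + b8 X_7 + b7 X_8 + b9 X_9,
   hence [relabel].  The factors in [Q_poly] and [M_poly] are those for which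
   [[X_b, P], [X_b, P]] = 2 P(Q_b) /\ P and [X_b, P(Q_b)] = P(m_b), and
   [k_expr] is X_b applied to half the sum of the x_ij x_ji, that is to
   18 [killing_trace 2], the Killing form being 6 times the trace form. *)

Definition Q_expr (A : comNzRingType) (b : 'I_10 -> A) (x : 'I_8 -> A) : A :=
  let b0 := b (@Ordinal 10 0 isT) in let b1 := b (@Ordinal 10 1 isT) in
  let b2 := b (@Ordinal 10 2 isT) in let b3 := b (@Ordinal 10 3 isT) in
  let b4 := b (@Ordinal 10 4 isT) in let b5 := b (@Ordinal 10 5 isT) in
  let b6 := b (@Ordinal 10 6 isT) in let b7 := b (@Ordinal 10 7 isT) in
  let b8 := b (@Ordinal 10 8 isT) in let b9 := b (@Ordinal 10 9 isT) in
  let x12 := x (@Ordinal 8 0 isT) in let x13 := x (@Ordinal 8 1 isT) in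
  let x21 := x (@Ordinal 8 2 isT) in let x23 := x (@Ordinal 8 3 isT) in
  let x31 := x (@Ordinal 8 4 isT) in let x32 := x (@Ordinal 8 5 isT) in
  let y13 := x (@Ordinal 8 6 isT) in let y23 := x (@Ordinal 8 7 isT) in
  6 * (
    (- 4 * b2 * b4 - 12 * b5 * b7) * x21 * x13
    + (12 * b0 * b7 - 8 * b2 * b3) * x23 * x13
    + (- b0 ^+ 2 + 4 * b1 * b4 - 4 * b2 * b5 + 4 * b3 * b6) * x13 * x31
    + (- 4 * b2 * b6 - 12 * b3 * b8) * x13 * x32
    + (- 4 * b0 * b2 - 4 * b1 * b3 + 12 * b6 * b7) * y13 * x13
    + (12 * b5 * b8 + 4 * b6 ^+ 2) * x32 ^+ 2
    + (4 * b0 * b6 + 8 * b1 * b5) * y23 * x32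
    + (b0 ^+ 2 - 4 * b3 * b6) * y13 ^+ 2
    + (- b0 ^+ 2 - 4 * b1 * b4 + 4 * b2 * b5 + 4 * b3 * b6) * y23 * y13
    + (b0 ^+ 2 - 4 * b2 * b5) * y23 ^+ 2
    + (- 12 * b1 * b9 - 4 * b4 * b6) * y23 * x31
    + (4 * b5 ^+ 2 + 12 * b6 * b9) * x31 ^+ 2
    + (4 * b3 ^+ 2 + 12 * b4 * b7) * x23 ^+ 2
    + (- 4 * b0 * b3 - 4 * b2 * b4 + 12 * b5 * b7) * y23 * x23
    + (- 4 * b0 * b4 + 12 * b2 * b9 - 4 * b3 * b5) * y23 * x21
    + (12 * b3 * b9 + 4 * b4 ^+ 2) * x21 ^+ 2
    + (- 4 * b1 * b3 - 12 * b6 * b7) * y23 * x13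
    + (12 * b1 * b7 + 4 * b2 ^+ 2) * x13 ^+ 2
    + (4 * b0 * b1 + 8 * b2 * b6) * y23 * x12
    + (4 * b1 ^+ 2 + 12 * b2 * b8) * x12 ^+ 2
    + (- 4 * b1 * b5 - 12 * b4 * b8) * x32 * y13
    + (4 * b5 * b6 - 36 * b8 * b9) * x32 * x31
    + (4 * b0 * b5 + 8 * b4 * b6) * y13 * x31
    + (- 12 * b2 * b9 - 4 * b3 * b5) * x23 * x31
    + (- b0 ^+ 2 + 4 * b1 * b4 + 4 * b2 * b5 - 4 * b3 * b6) * x23 * x32
    + (- 4 * b2 * b4 - 12 * b5 * b7) * x23 * y13
    + (- 4 * b1 * b3 - 12 * b6 * b7) * x12 * x23
    + (- 4 * b1 * b5 - 12 * b4 * b8) * x31 * x12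
    + (12 * b0 * b8 - 8 * b1 * b6) * x32 * x12
    + (- 4 * b0 * b1 - 4 * b2 * b6 + 12 * b3 * b8) * x12 * y13
    + (4 * b1 * b2 - 36 * b7 * b8) * x12 * x13
    + (- b0 ^+ 2 - 4 * b1 * b4 + 4 * b2 * b5 + 4 * b3 * b6) * x12 * x21
    + (4 * b3 * b4 - 36 * b7 * b9) * x21 * x23
    + (12 * b0 * b9 - 8 * b4 * b5) * x31 * x21
    + (- 12 * b1 * b9 - 4 * b4 * b6) * x32 * x21
    + (4 * b0 * b4 + 8 * b3 * b5) * x21 * y13).

Definition k_expr (A : comNzRingType) (b : 'I_10 -> A) (x : 'I_8 -> A) : A :=
  let b0 := b (@Ordinal 10 0 isT) in let b1 := b (@Ordinal 10 1 isT) in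
  let b2 := b (@Ordinal 10 2 isT) in let b3 := b (@Ordinal 10 3 isT) in
  let b4 := b (@Ordinal 10 4 isT) in let b5 := b (@Ordinal 10 5 isT) in
  let b6 := b (@Ordinal 10 6 isT) in let b7 := b (@Ordinal 10 7 isT) in
  let b8 := b (@Ordinal 10 8 isT) in let b9 := b (@Ordinal 10 9 isT) in
  let x12 := x (@Ordinal 8 0 isT) in let x13 := x (@Ordinal 8 1 isT) in
  let x21 := x (@Ordinal 8 2 isT) in let x23 := x (@Ordinal 8 3 isT) in
  let x31 := x (@Ordinal 8 4 isT) in let x32 := x (@Ordinal 8 5 isT) in
  let y13 := x (@Ordinal 8 6 isT) in let y23 := x (@Ordinal 8 7 isT) in
  3 * (
    b0 * x12 * x21 * y13 - b0 * x12 * x21 * y23 + 3 * b0 * x12 * x23 * x31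
    - 3 * b0 * x13 * x21 * x32 - b0 * x13 * x31 * y13 + b0 * x23 * x32 * y23
    - b0 * y13 ^+ 2 * y23 + b0 * y13 * y23 ^+ 2 - 2 * b1 * x12 ^+ 2 * x21
    + 4 * b1 * x12 * x13 * x31 - 2 * b1 * x12 * x23 * x32
    + 2 * b1 * x12 * y13 * y23 - 2 * b1 * x13 * x32 * y13
    + 4 * b1 * x13 * x32 * y23 - 4 * b2 * x12 * x13 * x21
    + 2 * b2 * x12 * x23 * y13 + 2 * b2 * x12 * x23 * y23
    + 2 * b2 * x13 ^+ 2 * x31 + 2 * b2 * x13 * x23 * x32
    + 2 * b2 * x13 * y13 * y23 - 2 * b2 * x13 * y23 ^+ 2
    + 4 * b3 * x12 * x21 * x23 - 2 * b3 * x13 * x21 * y13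
    - 2 * b3 * x13 * x21 * y23 - 2 * b3 * x13 * x23 * x31
    - 2 * b3 * x23 ^+ 2 * x32 + 2 * b3 * x23 * y13 ^+ 2
    - 2 * b3 * x23 * y13 * y23 + 2 * b4 * x12 * x21 ^+ 2
    + 2 * b4 * x13 * x21 * x31 - 4 * b4 * x21 * x23 * x32
    - 2 * b4 * x21 * y13 * y23 - 4 * b4 * x23 * x31 * y13
    + 2 * b4 * x23 * x31 * y23 - 2 * b5 * x12 * x21 * x31
    - 2 * b5 * x13 * x31 ^+ 2 + 4 * b5 * x21 * x32 * y13
    - 2 * b5 * x21 * x32 * y23 + 4 * b5 * x23 * x31 * x32
    - 2 * b5 * x31 * y13 * y23 + 2 * b5 * x31 * y23 ^+ 2
    + 2 * b6 * x12 * x21 * x32 + 2 * b6 * x12 * x31 * y13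
    - 4 * b6 * x12 * x31 * y23 - 4 * b6 * x13 * x31 * x32
    + 2 * b6 * x23 * x32 ^+ 2 - 2 * b6 * x32 * y13 ^+ 2
    + 2 * b6 * x32 * y13 * y23 - 6 * b7 * x12 * x23 ^+ 2
    + 6 * b7 * x13 ^+ 2 * x21 - 6 * b7 * x13 * x23 * y13
    + 6 * b7 * x13 * x23 * y23 - 6 * b8 * x12 ^+ 2 * x31
    + 6 * b8 * x12 * x32 * y13 + 6 * b8 * x13 * x32 ^+ 2
    + 6 * b9 * x21 ^+ 2 * x32 - 6 * b9 * x21 * x31 * y23
    - 6 * b9 * x23 * x31 ^+ 2).

Definition M_expr (A : comNzRingType) (b : 'I_10 -> A) (x : 'I_8 -> A) : A :=
  let b0 := b (@Ordinal 10 0 isT) in let b1 := b (@Ordinal 10 1 isT) in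
  let b2 := b (@Ordinal 10 2 isT) in let b3 := b (@Ordinal 10 3 isT) in
  let b4 := b (@Ordinal 10 4 isT) in let b5 := b (@Ordinal 10 5 isT) in
  let b6 := b (@Ordinal 10 6 isT) in let b7 := b (@Ordinal 10 7 isT) in
  let b8 := b (@Ordinal 10 8 isT) in let b9 := b (@Ordinal 10 9 isT) in
  let x12 := x (@Ordinal 8 0 isT) in let x13 := x (@Ordinal 8 1 isT) in
  let x21 := x (@Ordinal 8 2 isT) in let x23 := x (@Ordinal 8 3 isT) in
  let x31 := x (@Ordinal 8 4 isT) in let x32 := x (@Ordinal 8 5 isT) in
  let y13 := x (@Ordinal 8 6 isT) in let y23 := x (@Ordinal 8 7 isT) in
  6 * (
    (- 16 * b3 ^+ 3 - 72 * b3 * b4 * b7 + 216 * b7 ^+ 2 * b9) * x23 ^+ 3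
    + (- 16 * b5 ^+ 3 - 72 * b5 * b6 * b9 + 216 * b8 * b9 ^+ 2) * x31 ^+ 3
    + (72 * b5 * b6 * b8 + 16 * b6 ^+ 3 - 216 * b8 ^+ 2 * b9) * x32 ^+ 3
    + (4 * b0 * b1 * b4 - 8 * b0 * b2 * b5 + 4 * b0 * b3 * b6
      + 12 * b1 * b2 * b9 - 12 * b1 * b3 * b5 + 12 * b2 * b4 * b6
      - 24 * b3 * b4 * b8 + 12 * b5 * b6 * b7) * y13 ^+ 3
    + (- 12 * b0 * b1 * b4 + 12 * b0 * b3 * b6 + 36 * b1 * b2 * b9
      - 12 * b1 * b3 * b5 + 12 * b2 * b4 * b6 - 36 * b5 * b6 * b7) * y23 ^+ 3
    + (72 * b3 * b4 * b9 + 16 * b4 ^+ 3 - 216 * b7 * b9 ^+ 2) * x21 ^+ 3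
    + (72 * b1 * b2 * b7 + 16 * b2 ^+ 3 - 216 * b7 ^+ 2 * b8) * x13 ^+ 3
    + (- 16 * b1 ^+ 3 - 72 * b1 * b2 * b8 + 216 * b7 * b8 ^+ 2) * x12 ^+ 3
    + (- 48 * b0 * b5 * b6 - 48 * b1 * b5 ^+ 2 - 144 * b4 * b5 * b8
      - 96 * b4 * b6 ^+ 2) * x31 * x32 * y13
    + (48 * b0 * b5 * b6 + 96 * b1 * b5 ^+ 2 + 144 * b1 * b6 * b9
      + 48 * b4 * b6 ^+ 2) * x31 * x32 * y23
    + (- 10 * b0 ^+ 2 * b5 - 24 * b0 * b1 * b9 - 48 * b0 * b4 * b6
      - 32 * b1 * b4 * b5 + 40 * b2 * b5 ^+ 2 - 24 * b2 * b6 * b9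
      - 56 * b3 * b5 * b6 + 72 * b3 * b8 * b9
      + 24 * b4 ^+ 2 * b8) * x31 * y13 * y23
    + (10 * b0 ^+ 2 * b6 + 48 * b0 * b1 * b5 + 24 * b0 * b4 * b8
      - 24 * b1 ^+ 2 * b9 + 32 * b1 * b4 * b6 + 56 * b2 * b5 * b6
      - 72 * b2 * b8 * b9 + 24 * b3 * b5 * b8
      - 40 * b3 * b6 ^+ 2) * x32 * y13 * y23
    + (- 12 * b0 ^+ 2 * b3 + 48 * b2 * b3 * b5 + 48 * b3 ^+ 2 * b6
      + 144 * b4 * b6 * b7) * x12 * x21 * x23
    + (6 * b0 ^+ 2 * b5 - 72 * b0 * b1 * b9 - 24 * b2 * b5 ^+ 2
      - 216 * b2 * b6 * b9 - 24 * b3 * b5 * b6 - 216 * b3 * b8 * b9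
      - 72 * b4 ^+ 2 * b8) * x12 * x21 * x31
    + (- 6 * b0 ^+ 2 * b6 + 72 * b0 * b4 * b8 + 72 * b1 ^+ 2 * b9
      + 24 * b2 * b5 * b6 + 216 * b2 * b8 * b9 + 216 * b3 * b5 * b8
      + 24 * b3 * b6 ^+ 2) * x12 * x21 * x32
    + (- 3 * b0 ^+ 3 - 54 * b0 * b1 * b4 + 12 * b0 * b2 * b5
      + 30 * b0 * b3 * b6 + 90 * b1 * b2 * b9 - 30 * b1 * b3 * b5
      - 42 * b2 * b4 * b6 + 36 * b3 * b4 * b8 - 162 * b5 * b6 * b7
      - 324 * b7 * b8 * b9) * x12 * x21 * y13
    + (3 * b0 ^+ 3 + 18 * b0 * b1 * b4 - 12 * b0 * b2 * b5 + 6 * b0 * b3 * b6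
      + 18 * b1 * b2 * b9 + 42 * b1 * b3 * b5 + 30 * b2 * b4 * b6
      - 36 * b3 * b4 * b8 + 54 * b5 * b6 * b7
      + 324 * b7 * b8 * b9) * x12 * x21 * y23
    + (- 9 * b0 ^+ 3 - 18 * b0 * b1 * b4 + 36 * b0 * b2 * b5
      + 90 * b0 * b3 * b6 + 126 * b1 * b2 * b9 - 42 * b1 * b3 * b5
      + 162 * b2 * b4 * b6 - 36 * b3 * b4 * b8 - 198 * b5 * b6 * b7
      + 324 * b7 * b8 * b9) * x12 * x23 * x31
    + (6 * b0 ^+ 2 * b1 - 72 * b0 * b3 * b8 - 24 * b1 ^+ 2 * b4
      - 24 * b1 * b2 * b5 - 216 * b2 * b4 * b8 - 216 * b5 * b7 * b8
      - 72 * b6 ^+ 2 * b7) * x12 * x23 * x32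
    + (- 6 * b0 ^+ 2 * b2 - 48 * b0 * b1 * b3 + 72 * b0 * b6 * b7
      - 24 * b1 * b2 * b4 + 72 * b1 * b5 * b7 + 24 * b2 ^+ 2 * b5
      - 96 * b2 * b3 * b6 + 72 * b3 ^+ 2 * b8
      + 216 * b4 * b7 * b8) * x12 * x23 * y13
    + (- 6 * b0 ^+ 2 * b2 - 72 * b0 * b6 * b7 - 24 * b1 * b2 * b4
      - 72 * b1 * b5 * b7 + 24 * b2 ^+ 2 * b5 + 48 * b2 * b3 * b6
      - 72 * b3 ^+ 2 * b8 - 216 * b4 * b7 * b8) * x12 * x23 * y23
    + (144 * b0 * b5 * b8 - 48 * b1 * b5 * b6
      + 144 * b4 * b6 * b8) * x12 * x31 * x32
    + (- 6 * b0 ^+ 2 * b6 - 72 * b0 * b4 * b8 - 72 * b1 ^+ 2 * b9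
      + 48 * b1 * b4 * b6 - 24 * b2 * b5 * b6 - 216 * b2 * b8 * b9
      - 72 * b3 * b5 * b8 + 24 * b3 * b6 ^+ 2) * x12 * x31 * y13
    + (12 * b0 ^+ 2 * b6 + 48 * b0 * b1 * b5 + 48 * b1 * b4 * b6
      + 48 * b2 * b5 * b6 - 48 * b3 * b6 ^+ 2) * x12 * x31 * y23
    + (54 * b0 ^+ 2 * b8 - 24 * b0 * b1 * b6 + 24 * b1 ^+ 2 * b5
      + 72 * b2 * b5 * b8 - 24 * b2 * b6 ^+ 2
      - 144 * b3 * b6 * b8) * x12 * x32 * y13
    + (- 48 * b1 ^+ 2 * b5 - 144 * b1 * b4 * b8 + 48 * b2 * b6 ^+ 2
      + 144 * b3 * b6 * b8) * x12 * x32 * y23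
    + (26 * b0 ^+ 2 * b1 + 48 * b0 * b2 * b6 - 24 * b0 * b3 * b8
      - 8 * b1 ^+ 2 * b4 - 8 * b1 * b2 * b5 - 32 * b1 * b3 * b6
      - 24 * b2 * b4 * b8 + 72 * b5 * b7 * b8
      - 120 * b6 ^+ 2 * b7) * x12 * y13 * y23
    + (- 144 * b0 * b4 * b7 + 48 * b2 * b3 * b4
      - 144 * b3 * b5 * b7) * x13 * x21 * x23
    + (- 6 * b0 ^+ 2 * b4 + 72 * b0 * b2 * b9 + 216 * b1 * b3 * b9
      + 24 * b1 * b4 ^+ 2 + 24 * b3 * b4 * b6 + 72 * b5 ^+ 2 * b7
      + 216 * b6 * b7 * b9) * x13 * x21 * x31
    + (9 * b0 ^+ 3 - 90 * b0 * b1 * b4 - 36 * b0 * b2 * b5 + 18 * b0 * b3 * b6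
      + 198 * b1 * b2 * b9 - 162 * b1 * b3 * b5 + 42 * b2 * b4 * b6
      + 36 * b3 * b4 * b8 - 126 * b5 * b6 * b7
      - 324 * b7 * b8 * b9) * x13 * x21 * x32
    + (6 * b0 ^+ 2 * b3 + 72 * b0 * b5 * b7 + 24 * b1 * b3 * b4
      + 216 * b1 * b7 * b9 + 72 * b2 ^+ 2 * b9 - 48 * b2 * b3 * b5
      - 24 * b3 ^+ 2 * b6 + 72 * b4 * b6 * b7) * x13 * x21 * y13
    + (6 * b0 ^+ 2 * b3 + 48 * b0 * b2 * b4 - 72 * b0 * b5 * b7
      + 24 * b1 * b3 * b4 - 216 * b1 * b7 * b9 - 72 * b2 ^+ 2 * b9
      + 96 * b2 * b3 * b5 - 24 * b3 ^+ 2 * b6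
      - 72 * b4 * b6 * b7) * x13 * x21 * y23
    + (6 * b0 ^+ 2 * b3 - 72 * b0 * b5 * b7 - 24 * b1 * b3 * b4
      - 216 * b1 * b7 * b9 - 72 * b2 ^+ 2 * b9 - 24 * b3 ^+ 2 * b6
      - 216 * b4 * b6 * b7) * x13 * x23 * x31
    + (- 6 * b0 ^+ 2 * b2 + 72 * b0 * b6 * b7 + 24 * b1 * b2 * b4
      + 216 * b1 * b5 * b7 + 24 * b2 ^+ 2 * b5 + 72 * b3 ^+ 2 * b8
      + 216 * b4 * b7 * b8) * x13 * x23 * x32
    + (- 54 * b0 ^+ 2 * b7 + 24 * b0 * b2 * b3 + 24 * b1 * b3 ^+ 2
      - 72 * b1 * b4 * b7 - 24 * b2 ^+ 2 * b4
      + 144 * b3 * b6 * b7) * x13 * x23 * y13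
    + (54 * b0 ^+ 2 * b7 - 24 * b0 * b2 * b3 + 24 * b1 * b3 ^+ 2
      + 72 * b1 * b4 * b7 - 24 * b2 ^+ 2 * b4
      - 144 * b2 * b5 * b7) * x13 * x23 * y23
    + (12 * b0 ^+ 2 * b6 - 48 * b1 * b4 * b6 - 144 * b3 * b5 * b8
      - 48 * b3 * b6 ^+ 2) * x13 * x31 * x32
    + (3 * b0 ^+ 3 - 30 * b0 * b1 * b4 + 36 * b0 * b2 * b5 + 6 * b0 * b3 * b6
      + 18 * b1 * b2 * b9 + 42 * b1 * b3 * b5 + 30 * b2 * b4 * b6
      + 108 * b3 * b4 * b8 - 90 * b5 * b6 * b7
      + 324 * b7 * b8 * b9) * x13 * x31 * y13
    + (36 * b0 * b1 * b4 - 36 * b0 * b3 * b6 - 108 * b1 * b2 * b9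
      - 12 * b1 * b3 * b5 + 12 * b2 * b4 * b6
      + 108 * b5 * b6 * b7) * x13 * x31 * y23
    + (6 * b0 ^+ 2 * b1 + 48 * b0 * b2 * b6 - 72 * b0 * b3 * b8
      - 24 * b1 ^+ 2 * b4 + 24 * b1 * b2 * b5 + 96 * b1 * b3 * b6
      - 72 * b2 * b4 * b8 - 216 * b5 * b7 * b8
      - 72 * b6 ^+ 2 * b7) * x13 * x32 * y13
    + (- 12 * b0 ^+ 2 * b1 - 48 * b0 * b2 * b6 + 48 * b1 ^+ 2 * b4
      - 48 * b1 * b2 * b5 - 48 * b1 * b3 * b6) * x13 * x32 * y23
    + (10 * b0 ^+ 2 * b2 + 24 * b0 * b6 * b7 + 8 * b1 * b2 * b4
      - 120 * b1 * b5 * b7 - 40 * b2 ^+ 2 * b5 - 64 * b2 * b3 * b6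
      - 24 * b3 ^+ 2 * b8 - 72 * b4 * b7 * b8) * x13 * y13 * y23
    + (144 * b0 * b3 * b9 + 144 * b2 * b4 * b9
      - 48 * b3 * b4 * b5) * x21 * x23 * x31
    + (12 * b0 ^+ 2 * b4 - 144 * b1 * b3 * b9 - 48 * b1 * b4 ^+ 2
      - 48 * b2 * b4 * b5) * x21 * x23 * x32
    + (48 * b0 * b3 * b4 + 48 * b2 * b4 ^+ 2 + 96 * b3 ^+ 2 * b5
      + 144 * b4 * b5 * b7) * x21 * x23 * y13
    + (144 * b2 * b3 * b9 + 48 * b2 * b4 ^+ 2 - 48 * b3 ^+ 2 * b5
      - 144 * b4 * b5 * b7) * x21 * x23 * y23
    + (- 144 * b0 * b6 * b9 - 144 * b1 * b5 * b9
      + 48 * b4 * b5 * b6) * x21 * x31 * x32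
    + (144 * b1 * b4 * b9 - 144 * b2 * b5 * b9 - 48 * b3 * b5 ^+ 2
      + 48 * b4 ^+ 2 * b6) * x21 * x31 * y13
    + (- 54 * b0 ^+ 2 * b9 + 24 * b0 * b4 * b5 + 144 * b2 * b5 * b9
      + 24 * b3 * b5 ^+ 2 - 72 * b3 * b6 * b9
      - 24 * b4 ^+ 2 * b6) * x21 * x31 * y23
    + (- 12 * b0 ^+ 2 * b5 - 48 * b0 * b4 * b6 - 48 * b1 * b4 * b5
      + 48 * b2 * b5 ^+ 2 - 48 * b3 * b5 * b6) * x21 * x32 * y13
    + (6 * b0 ^+ 2 * b5 + 72 * b0 * b1 * b9 - 48 * b1 * b4 * b5
      - 24 * b2 * b5 ^+ 2 + 72 * b2 * b6 * b9 + 24 * b3 * b5 * b6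
      + 216 * b3 * b8 * b9 + 72 * b4 ^+ 2 * b8) * x21 * x32 * y23
    + (- 26 * b0 ^+ 2 * b4 + 24 * b0 * b2 * b9 - 48 * b0 * b3 * b5
      + 24 * b1 * b3 * b9 + 8 * b1 * b4 ^+ 2 + 32 * b2 * b4 * b5
      + 8 * b3 * b4 * b6 + 120 * b5 ^+ 2 * b7
      - 72 * b6 * b7 * b9) * x21 * y13 * y23
    + (- 12 * b0 ^+ 2 * b5 + 48 * b1 * b4 * b5 + 48 * b2 * b5 ^+ 2
      + 144 * b2 * b6 * b9) * x23 * x31 * x32
    + (12 * b0 ^+ 2 * b4 + 48 * b0 * b3 * b5 - 48 * b1 * b4 ^+ 2
      + 48 * b2 * b4 * b5 + 48 * b3 * b4 * b6) * x23 * x31 * y13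
    + (- 6 * b0 ^+ 2 * b4 + 72 * b0 * b2 * b9 - 48 * b0 * b3 * b5
      + 72 * b1 * b3 * b9 + 24 * b1 * b4 ^+ 2 - 96 * b2 * b4 * b5
      - 24 * b3 * b4 * b6 + 72 * b5 ^+ 2 * b7
      + 216 * b6 * b7 * b9) * x23 * x31 * y23
    + (36 * b0 * b1 * b4 - 36 * b0 * b3 * b6 - 108 * b1 * b2 * b9
      - 12 * b1 * b3 * b5 + 12 * b2 * b4 * b6
      + 108 * b5 * b6 * b7) * x23 * x32 * y13
    + (- 3 * b0 ^+ 3 - 6 * b0 * b1 * b4 + 12 * b0 * b2 * b5
      - 18 * b0 * b3 * b6 - 54 * b1 * b2 * b9 - 30 * b1 * b3 * b5
      - 42 * b2 * b4 * b6 + 36 * b3 * b4 * b8 - 18 * b5 * b6 * b7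
      - 324 * b7 * b8 * b9) * x23 * x32 * y23
    + (- 10 * b0 ^+ 2 * b3 - 24 * b0 * b5 * b7 - 8 * b1 * b3 * b4
      + 72 * b1 * b7 * b9 + 24 * b2 ^+ 2 * b9 + 64 * b2 * b3 * b5
      + 40 * b3 ^+ 2 * b6 + 120 * b4 * b6 * b7) * x23 * y13 * y23
    + (12 * b0 ^+ 2 * b2 - 144 * b1 * b5 * b7 - 48 * b2 ^+ 2 * b5
      - 48 * b2 * b3 * b6) * x12 * x13 * x21
    + (144 * b0 * b1 * b7 - 48 * b1 * b2 * b3
      + 144 * b2 * b6 * b7) * x12 * x13 * x23
    + (- 12 * b0 ^+ 2 * b1 + 48 * b1 ^+ 2 * b4 + 48 * b1 * b3 * b6
      + 144 * b2 * b4 * b8) * x12 * x13 * x31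
    + (- 144 * b0 * b2 * b8 + 48 * b1 * b2 * b6
      - 144 * b1 * b3 * b8) * x12 * x13 * x32
    + (- 48 * b1 ^+ 2 * b3 + 144 * b1 * b6 * b7 + 48 * b2 ^+ 2 * b6
      - 144 * b2 * b3 * b8) * x12 * x13 * y13
    + (- 48 * b0 * b1 * b2 - 48 * b1 ^+ 2 * b3 - 144 * b1 * b6 * b7
      - 96 * b2 ^+ 2 * b6) * x12 * x13 * y23
    + (- 6 * b0 ^+ 2 * b6 + 24 * b1 * b4 * b6 + 24 * b2 * b5 * b6
      - 216 * b2 * b8 * b9 - 72 * b3 * b5 * b8
      - 24 * b3 * b6 ^+ 2) * x23 * x32 ^+ 2
    + (10 * b0 ^+ 2 * b3 + 24 * b0 * b2 * b4 + 24 * b0 * b5 * b7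
      + 32 * b1 * b3 * b4 - 72 * b1 * b7 * b9 - 24 * b2 ^+ 2 * b9
      - 16 * b2 * b3 * b5 - 40 * b3 ^+ 2 * b6
      - 48 * b4 * b6 * b7) * x23 * y13 ^+ 2
    + (- 8 * b0 ^+ 2 * b3 - 24 * b0 * b2 * b4 + 24 * b0 * b5 * b7
      + 8 * b1 * b3 * b4 - 72 * b1 * b7 * b9 + 48 * b2 ^+ 2 * b9
      - 16 * b2 * b3 * b5 - 16 * b3 ^+ 2 * b6
      - 48 * b4 * b6 * b7) * x23 * y23 ^+ 2
    + (- 24 * b5 ^+ 2 * b6 - 216 * b5 * b8 * b9
      - 144 * b6 ^+ 2 * b9) * x31 ^+ 2 * x32
    + (- 24 * b0 * b5 ^+ 2 + 72 * b1 * b5 * b9 - 48 * b4 * b5 * b6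
      + 216 * b4 * b8 * b9) * x31 ^+ 2 * y13
    + (- 72 * b0 * b6 * b9 - 72 * b1 * b5 * b9
      + 24 * b4 * b5 * b6) * x31 ^+ 2 * y23
    + (144 * b5 ^+ 2 * b8 + 24 * b5 * b6 ^+ 2
      + 216 * b6 * b8 * b9) * x31 * x32 ^+ 2
    + (- 8 * b0 ^+ 2 * b5 + 24 * b0 * b1 * b9 + 32 * b1 * b4 * b5
      - 16 * b2 * b5 ^+ 2 + 24 * b2 * b6 * b9 + 32 * b3 * b5 * b6
      - 72 * b3 * b8 * b9 + 48 * b4 ^+ 2 * b8) * x31 * y13 ^+ 2
    + (10 * b0 ^+ 2 * b5 + 24 * b0 * b1 * b9 + 24 * b0 * b4 * b6
      - 16 * b1 * b4 * b5 - 40 * b2 * b5 ^+ 2 - 48 * b2 * b6 * b9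
      + 32 * b3 * b5 * b6 - 72 * b3 * b8 * b9
      - 24 * b4 ^+ 2 * b8) * x31 * y23 ^+ 2
    + (72 * b0 * b5 * b8 - 24 * b1 * b5 * b6
      + 72 * b4 * b6 * b8) * x32 ^+ 2 * y13
    + (24 * b0 * b6 ^+ 2 + 48 * b1 * b5 * b6 - 216 * b1 * b8 * b9
      - 72 * b4 * b6 * b8) * x32 ^+ 2 * y23
    + (- 10 * b0 ^+ 2 * b6 - 24 * b0 * b1 * b5 - 24 * b0 * b4 * b8
      + 24 * b1 ^+ 2 * b9 + 16 * b1 * b4 * b6 - 32 * b2 * b5 * b6
      + 72 * b2 * b8 * b9 + 48 * b3 * b5 * b8
      + 40 * b3 * b6 ^+ 2) * x32 * y13 ^+ 2
    + (8 * b0 ^+ 2 * b6 - 24 * b0 * b4 * b8 - 48 * b1 ^+ 2 * b9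
      - 32 * b1 * b4 * b6 - 32 * b2 * b5 * b6 + 72 * b2 * b8 * b9
      - 24 * b3 * b5 * b8 + 16 * b3 * b6 ^+ 2) * x32 * y23 ^+ 2
    + (- 5 * b0 ^+ 3 + 2 * b0 * b1 * b4 + 20 * b0 * b2 * b5
      + 14 * b0 * b3 * b6 - 30 * b1 * b2 * b9 + 18 * b1 * b3 * b5
      - 18 * b2 * b4 * b6 - 12 * b3 * b4 * b8 - 66 * b5 * b6 * b7
      + 108 * b7 * b8 * b9) * y13 ^+ 2 * y23
    + (5 * b0 ^+ 3 + 10 * b0 * b1 * b4 - 20 * b0 * b2 * b5 - 26 * b0 * b3 * b6
      - 6 * b1 * b2 * b9 + 18 * b1 * b3 * b5 - 18 * b2 * b4 * b6
      + 12 * b3 * b4 * b8 + 102 * b5 * b6 * b7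
      - 108 * b7 * b8 * b9) * y13 * y23 ^+ 2
    + (- 24 * b1 ^+ 2 * b2 - 216 * b1 * b7 * b8
      - 144 * b2 ^+ 2 * b8) * x12 ^+ 2 * x13
    + (6 * b0 ^+ 2 * b1 + 24 * b1 ^+ 2 * b4 - 24 * b1 * b2 * b5
      - 24 * b1 * b3 * b6 + 72 * b2 * b4 * b8
      + 216 * b5 * b7 * b8) * x12 ^+ 2 * x21
    + (- 216 * b0 * b7 * b8 + 24 * b1 ^+ 2 * b3 + 72 * b1 * b6 * b7
      + 144 * b2 * b3 * b8) * x12 ^+ 2 * x23
    + (18 * b0 ^+ 2 * b8 + 24 * b1 ^+ 2 * b5 + 72 * b2 * b5 * b8
      - 72 * b3 * b6 * b8) * x12 ^+ 2 * x31
    + (- 72 * b0 * b1 * b8 + 48 * b1 ^+ 2 * b6 + 72 * b2 * b6 * b8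
      + 216 * b3 * b8 ^+ 2) * x12 ^+ 2 * x32
    + (24 * b0 * b1 ^+ 2 + 72 * b0 * b2 * b8 + 24 * b1 * b2 * b6
      - 216 * b6 * b7 * b8) * x12 ^+ 2 * y13
    + (- 24 * b0 * b1 ^+ 2 - 48 * b1 * b2 * b6 + 72 * b1 * b3 * b8
      + 216 * b6 * b7 * b8) * x12 ^+ 2 * y23
    + (144 * b1 ^+ 2 * b7 + 24 * b1 * b2 ^+ 2
      + 216 * b2 * b7 * b8) * x12 * x13 ^+ 2
    + (- 6 * b0 ^+ 2 * b4 - 72 * b1 * b3 * b9 - 24 * b1 * b4 ^+ 2
      + 24 * b2 * b4 * b5 + 24 * b3 * b4 * b6
      - 216 * b6 * b7 * b9) * x12 * x21 ^+ 2
    + (18 * b0 ^+ 2 * b7 + 24 * b1 * b3 ^+ 2 + 72 * b1 * b4 * b7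
      - 72 * b2 * b5 * b7) * x12 * x23 ^+ 2
    + (- 216 * b0 * b8 * b9 + 24 * b1 * b5 ^+ 2 + 144 * b1 * b6 * b9
      + 72 * b4 * b5 * b8) * x12 * x31 ^+ 2
    + (72 * b0 * b6 * b8 - 72 * b1 * b5 * b8 - 48 * b1 * b6 ^+ 2
      - 216 * b4 * b8 ^+ 2) * x12 * x32 ^+ 2
    + (- 8 * b0 ^+ 2 * b1 - 24 * b0 * b2 * b6 + 24 * b0 * b3 * b8
      - 16 * b1 ^+ 2 * b4 + 8 * b1 * b2 * b5 - 16 * b1 * b3 * b6
      - 48 * b2 * b4 * b8 - 72 * b5 * b7 * b8
      + 48 * b6 ^+ 2 * b7) * x12 * y13 ^+ 2
    + (- 8 * b0 ^+ 2 * b1 + 24 * b0 * b3 * b8 - 16 * b1 ^+ 2 * b4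
      + 32 * b1 * b2 * b5 + 32 * b1 * b3 * b6 + 24 * b2 * b4 * b8
      - 72 * b5 * b7 * b8 + 48 * b6 ^+ 2 * b7) * x12 * y23 ^+ 2
    + (- 18 * b0 ^+ 2 * b7 - 72 * b1 * b4 * b7 - 24 * b2 ^+ 2 * b4
      + 72 * b3 * b6 * b7) * x13 ^+ 2 * x21
    + (72 * b0 * b2 * b7 - 72 * b1 * b3 * b7 - 48 * b2 ^+ 2 * b3
      - 216 * b6 * b7 ^+ 2) * x13 ^+ 2 * x23
    + (- 6 * b0 ^+ 2 * b2 + 24 * b1 * b2 * b4 - 72 * b1 * b5 * b7
      - 24 * b2 ^+ 2 * b5 + 24 * b2 * b3 * b6
      - 216 * b4 * b7 * b8) * x13 ^+ 2 * x31
    + (216 * b0 * b7 * b8 - 144 * b1 * b6 * b7 - 24 * b2 ^+ 2 * b6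
      - 72 * b2 * b3 * b8) * x13 ^+ 2 * x32
    + (- 72 * b0 * b1 * b7 - 24 * b0 * b2 ^+ 2 - 24 * b1 * b2 * b3
      + 216 * b3 * b7 * b8) * x13 ^+ 2 * y13
    + (72 * b0 * b1 * b7 - 24 * b1 * b2 * b3
      + 72 * b2 * b6 * b7) * x13 ^+ 2 * y23
    + (216 * b0 * b7 * b9 - 144 * b2 * b3 * b9 - 24 * b2 * b4 ^+ 2
      - 72 * b4 * b5 * b7) * x13 * x21 ^+ 2
    + (- 72 * b0 * b3 * b7 + 48 * b2 * b3 ^+ 2 + 72 * b2 * b4 * b7
      + 216 * b5 * b7 ^+ 2) * x13 * x23 ^+ 2
    + (6 * b0 ^+ 2 * b5 - 24 * b1 * b4 * b5 + 24 * b2 * b5 ^+ 2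
      + 72 * b2 * b6 * b9 - 24 * b3 * b5 * b6
      + 216 * b3 * b8 * b9) * x13 * x31 ^+ 2
    + (- 18 * b0 ^+ 2 * b8 + 72 * b1 * b4 * b8 - 72 * b2 * b5 * b8
      - 24 * b2 * b6 ^+ 2) * x13 * x32 ^+ 2
    + (8 * b0 ^+ 2 * b2 + 24 * b0 * b1 * b3 - 24 * b0 * b6 * b7
      - 8 * b1 * b2 * b4 + 48 * b1 * b5 * b7 + 16 * b2 ^+ 2 * b5
      + 16 * b2 * b3 * b6 - 48 * b3 ^+ 2 * b8
      + 72 * b4 * b7 * b8) * x13 * y13 ^+ 2
    + (- 10 * b0 ^+ 2 * b2 - 24 * b0 * b1 * b3 - 24 * b0 * b6 * b7
      - 32 * b1 * b2 * b4 + 48 * b1 * b5 * b7 + 40 * b2 ^+ 2 * b5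
      + 16 * b2 * b3 * b6 + 24 * b3 ^+ 2 * b8
      + 72 * b4 * b7 * b8) * x13 * y23 ^+ 2
    + (144 * b3 ^+ 2 * b9 + 24 * b3 * b4 ^+ 2
      + 216 * b4 * b7 * b9) * x21 ^+ 2 * x23
    + (72 * b0 * b4 * b9 - 216 * b2 * b9 ^+ 2 - 72 * b3 * b5 * b9
      - 48 * b4 ^+ 2 * b5) * x21 ^+ 2 * x31
    + (- 18 * b0 ^+ 2 * b9 + 72 * b2 * b5 * b9 - 72 * b3 * b6 * b9
      - 24 * b4 ^+ 2 * b6) * x21 ^+ 2 * x32
    + (24 * b0 * b4 ^+ 2 - 72 * b2 * b4 * b9 + 48 * b3 * b4 * b5
      - 216 * b5 * b7 * b9) * x21 ^+ 2 * y13
    + (- 72 * b0 * b3 * b9 - 24 * b0 * b4 ^+ 2 - 24 * b3 * b4 * b5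
      + 216 * b5 * b7 * b9) * x21 ^+ 2 * y23
    + (- 24 * b3 ^+ 2 * b4 - 216 * b3 * b7 * b9
      - 144 * b4 ^+ 2 * b7) * x21 * x23 ^+ 2
    + (- 72 * b0 * b5 * b9 + 216 * b1 * b9 ^+ 2 + 48 * b4 * b5 ^+ 2
      + 72 * b4 * b6 * b9) * x21 * x31 ^+ 2
    + (216 * b0 * b8 * b9 - 72 * b1 * b6 * b9 - 144 * b4 * b5 * b8
      - 24 * b4 * b6 ^+ 2) * x21 * x32 ^+ 2
    + (8 * b0 ^+ 2 * b4 - 24 * b0 * b2 * b9 - 24 * b1 * b3 * b9
      + 16 * b1 * b4 ^+ 2 - 32 * b2 * b4 * b5 - 32 * b3 * b4 * b6
      - 48 * b5 ^+ 2 * b7 + 72 * b6 * b7 * b9) * x21 * y13 ^+ 2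
    + (8 * b0 ^+ 2 * b4 - 24 * b0 * b2 * b9 + 24 * b0 * b3 * b5
      + 48 * b1 * b3 * b9 + 16 * b1 * b4 ^+ 2 + 16 * b2 * b4 * b5
      - 8 * b3 * b4 * b6 - 48 * b5 ^+ 2 * b7
      + 72 * b6 * b7 * b9) * x21 * y23 ^+ 2
    + (- 216 * b0 * b7 * b9 + 72 * b2 * b3 * b9 + 24 * b3 ^+ 2 * b5
      + 144 * b4 * b5 * b7) * x23 ^+ 2 * x31
    + (6 * b0 ^+ 2 * b3 - 24 * b1 * b3 * b4 + 216 * b1 * b7 * b9
      - 24 * b2 * b3 * b5 + 24 * b3 ^+ 2 * b6
      + 72 * b4 * b6 * b7) * x23 ^+ 2 * x32
    + (- 72 * b0 * b4 * b7 + 24 * b2 * b3 * b4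
      - 72 * b3 * b5 * b7) * x23 ^+ 2 * y13
    + (24 * b0 * b3 ^+ 2 + 72 * b0 * b4 * b7 + 24 * b2 * b3 * b4
      - 216 * b2 * b7 * b9) * x23 ^+ 2 * y23
    + (18 * b0 ^+ 2 * b9 - 72 * b1 * b4 * b9 + 24 * b3 * b5 ^+ 2
      + 72 * b3 * b6 * b9) * x23 * x31 ^+ 2).

Definition relabel (A : comNzRingType) (b : 'I_10 -> A) (i : 'I_10) : A :=
  let b0 := b (@Ordinal 10 0 isT) in let b1 := b (@Ordinal 10 1 isT) in
  let b2 := b (@Ordinal 10 2 isT) in let b3 := b (@Ordinal 10 3 isT) in
  let b4 := b (@Ordinal 10 4 isT) in let b5 := b (@Ordinal 10 5 isT) in
  let b6 := b (@Ordinal 10 6 isT) in let b7 := b (@Ordinal 10 7 isT) in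
  let b8 := b (@Ordinal 10 8 isT) in let b9 := b (@Ordinal 10 9 isT) in
  nth 0 [:: 2 * b0; b1; b2; b4; b3; b5; b6; b8; b7; b9] i.

Definition X_field (K : fieldType) (b : 'I_10 -> K) : vfield K 8 :=
  \row_j \sum_i b i *: nth 0 (nth [::] (field_expr (fun l => 'X_l)) i) j.

Definition closed_form (K : fieldType) (b : 'I_10 -> K)
    (F : forall A : comNzRingType, ('I_10 -> A) -> ('I_8 -> A) -> A) :
    {mpoly K[8]} :=
  F _ (fun i => (relabel b i)%:MP) (fun l => 'X_l).

Definition Q_poly (K : fieldType) (b : 'I_10 -> K) : {mpoly K[8]} :=
  - (3 / 2) *: closed_form b Q_expr.

Definition k_poly (K : fieldType) (b : 'I_10 -> K) : {mpoly K[8]} :=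
  closed_form b k_expr.

Definition M_poly (K : fieldType) (b : 'I_10 -> K) : {mpoly K[8]} :=
  (3 / 2) *: closed_form b M_expr.

(* On gl(3)^*, x0 is ['X_ord_max] and the pullback p^* is [mwiden]. *)

Definition vf_widen (K : fieldType) (n : nat) (X : vfield K n) :
    vfield K n.+1 :=
  \row_i if unlift ord_max i is Some j then mwiden (X 0 j) else 0.

Definition partial_x0 (K : fieldType) (n : nat) : vfield K n.+1 :=
  delta_mx 0 ord_max.

Definition pi2 (K : fieldType) (lambda : K) (b : 'I_10 -> K) : bivector K 9 :=
  let pi1 := gl_poisson lambda in
  schouten_vb (vf_widen (X_field b)) pi1
  - wedge_vv (schouten_bf pi1 (mwiden (Q_poly b))) (partial_x0 K 8)
  + 'X_ord_max *: pi1.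

(* Main.v *)
From Stdlib Require Import ZArith.
Require Import Defs.
From HB Require Import structures.
From mathcomp Require Import all_boot all_order all_algebra.
From mathcomp Require Import mpoly.
From mathcomp Require Import reals complex.
From mathcomp Require Import ring ssrZ.
Set Implicit Arguments.
Unset Strict Implicit.
Unset Printing Implicit Defensive.
Import GRing.Theory.
Local Open Scope ring_scope.

(** Write [P] for the Lie-Poisson bivector of sl(3)^*, [X] and [Q] for the
    vector field and the quadratic polynomial attached to b, and pi = [X, P].

    On gl(3)^* the bivector pi_1 is the lift of [P] (gl_poisson_widen), so pi_2
    has the blocks pi + x0 P in the directions of sl(3)^* and the components
    of P(Q) against d/dx0.  Applied to g0 + g1 x0 + c x0^3, with g0 and g1
    lifted from sl(3)^*, it is a polynomial in x0 whose coefficients only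
    involve pi, P and P(Q); hence a list of equations on sl(3)^* that makes
    such a function a Casimir function of pi_2 (casimir_pi2).  All three
    functions of the theorem have this shape: (g0, g1, c) is (C3, 0, 0),
    (X C2, C2, 0) and (-3 M, 3 Q, 1) with M = m - X Q.

    The rule [X, P](f) = [X, P(f)] - P(X f) (schouten_vb_bf) and the skewness
    of pi and P reduce these equations to
<<
      P(C2) = P(C3) = 0,   X C3 = 0,   pi(X C2) = C2 P(Q),
      pi(Q) = P(M),        pi(M) = - Q P(Q).
>>
    For instance P(Q) kills C3 because P(Q)(C3) = - P(C3)(Q), and pi kills C3
    because pi(C3) = - P(X C3).  The same rule shows that pi(Q) = P(M) says
    exactly [X, P(Q)] = P(m).

    With M = M_b the remaining equations, as well as [pi, pi] = 2 P(Q) /\ P,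
    are identities with integer coefficients in the ten parameters b_i and the
    eight coordinates.  They are verified by computing in a representation of
    integer polynomials by nested lists of coefficients, which maps to
    polynomials over any field K by a ring morphism compatible with the
    partial derivatives (pevalM, peval_deriv).  That Q lies in U is certified
    by a combination of 27 iterated brackets of x13^2 with coordinates.

    An arbitrary admissible m differs from M_b + X Q by a cubic Casimir function
    of P, and these are the multiples of C3 (cubic_casimir): the Cartan
    coordinates y13, y23 force the monomials to have weight zero, which leaves
    12 coefficients, and linear algebra on these leaves one.  As pi kills C3,
    the equation for pi(M) does not depend on the choice of m. *)

(** * Brackets of polynomial multivector fields *)

Section Schouten.
Variables (K : fieldType) (n : nat).
Implicit Types (X : vfield K n) (P : bivector K n) (f g : {mpoly K[n]}).

Definition skew P := forall i j, P i j = - P j i.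

Lemma schouten_vfZr X c f : schouten_vf X (c *: f) = c *: schouten_vf X f.
Proof. by rewrite scaler_sumr; apply: eq_bigr => i _; rewrite mderivZ scalerAr. Qed.
Lemma schouten_bfD P f g : schouten_bf P (f + g) = schouten_bf P f + schouten_bf P g.
Proof.
apply/rowP => i; rewrite !mxE -big_split.
by apply: eq_bigr => j _; rewrite mderivD mulrDr.
Qed.
Lemma schouten_bfB P f g : schouten_bf P (f - g) = schouten_bf P f - schouten_bf P g.
Proof.
apply/rowP => i; rewrite !mxE -sumrB.
by apply: eq_bigr => j _; rewrite mderivB mulrBr.
Qed.
Lemma schouten_bfZ P c f : schouten_bf P (c *: f) = c%:MP *: schouten_bf P f.
Proof.
apply/rowP => i; rewrite !mxE mulr_sumr.
by apply: eq_bigr => j _; rewrite mderivZ -mul_mpolyC mulrCA.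
Qed.
Lemma schouten_bf0 P : schouten_bf P 0 = 0.
Proof. by apply/rowP => i; rewrite !mxE big1 // => j _; rewrite mderiv0 mulr0. Qed.

Lemma skew_vb X P : skew P -> skew (schouten_vb X P).
Proof.
move=> skP i j; rewrite !mxE -sumrN.
have -> : schouten_vf X (P i j) = - schouten_vf X (P j i).
  by rewrite (skP i j) /schouten_vf -sumrN; apply: eq_bigr => l _; rewrite mderivN mulrN.
rewrite opprB [RHS]addrC; congr (_ + _).
apply: eq_bigr => l _.
by rewrite (skP l j) (skP l i); ring.
Qed.

(** Both sides are the function obtained by pairing [P] with df and dg. *)
Lemma schouten_vf_bf_skew P f g : skew P ->
  schouten_vf (schouten_bf P f) g = - schouten_vf (schouten_bf P g) f.
Proof.
move=> skP; rewrite /schouten_vf -sumrN.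
under eq_bigr => i _ do rewrite mxE mulr_suml.
rewrite exchange_big; apply: eq_bigr => i _ /=; rewrite mxE mulr_suml -sumrN.
by apply: eq_bigr => j _; rewrite (skP j i); ring.
Qed.

Lemma mpoly_self_opp (p : {mpoly K[n]}) : (2%:R : K) != 0 -> p = - p -> p = 0.
Proof.
move=> nz2 /eqP; rewrite -addr_eq0 -mulr2n -scaler_nat scaler_eq0 (negPf nz2).
by move/eqP.
Qed.

Lemma schouten_vf_bf_diag P f : (2%:R : K) != 0 -> skew P ->
  schouten_vf (schouten_bf P f) f = 0.
Proof. by move=> nz2 skP; apply/mpoly_self_opp/schouten_vf_bf_skew. Qed.

Definition alternating (T : trivector K n) := forall i j k,
  T (i, j, k) = T (j, k, i) /\ T (i, j, k) = - T (j, i, k).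

Lemma alternating_bb P : skew P -> alternating (schouten_bb P P).
Proof.
move=> skP i j k; rewrite !ffunE -sumrN.
split; apply: eq_bigr => l _; first by ring.
rewrite (skP j i) (skP k i) (skP k j) !mderivN; ring.
Qed.

Lemma alternating_vb X P : skew P -> alternating (wedge_vb X P).
Proof.
move=> skP i j k; rewrite !ffunE; split; first by ring.
by rewrite (skP j i) (skP k i) (skP k j); ring.
Qed.

Lemma alternatingMn (T : trivector K n) r : alternating T -> alternating (T *+ r).
Proof.
move=> altT i j k; have [cycT swapT] := altT i j k.
by rewrite !ffunMnE -mulNrn -swapT -cycT.
Qed.

(** Of the 512 components of a trivector on sl(3)^*, the 56 with increasing
    indices determine the others; this keeps the computation for the bracket
    of pi with itself short. *)
Lemma alternating_eq (S T : trivector K n) :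
    (2%:R : K) != 0 -> alternating S -> alternating T ->
    (forall i j k : 'I_n, (i < j < k)%N -> S (i, j, k) = T (i, j, k)) -> S = T.
Proof.
move=> nz2 altS altT eqST; apply/ffunP => -[[i j] k].
pose D i j k := S (i, j, k) - T (i, j, k).
have cyc a b c : D a b c = D b c a by rewrite /D (altS a b c).1 (altT a b c).1.
have swap a b c : D a b c = - D b a c.
  by rewrite /D (altS a b c).2 (altT a b c).2; ring.
have D_diag a b : D a a b = 0 by exact/mpoly_self_opp.
have D_min (a b c : 'I_n) : (a < b)%N -> (a < c)%N -> D a b c = 0.
  move=> lt_ab lt_ac; case: (ltngtP b c) => [lt_bc|lt_cb|/ord_inj ->].
  - by rewrite /D eqST ?subrr // lt_ab.
  - by rewrite cyc cyc swap /D eqST ?subrr ?oppr0 // lt_ac.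
  - by rewrite cyc D_diag.
suff : D i j k = 0 by move/eqP; rewrite subr_eq0 => /eqP.
case: (ltngtP i j) => [lt_ij|lt_ji|/ord_inj ->]; last exact: D_diag.
  case: (ltngtP i k) => [lt_ik|lt_ki|/ord_inj eq_ik]; first exact: D_min.
    by rewrite cyc cyc D_min // (ltn_trans lt_ki).
  by rewrite eq_ik cyc cyc D_diag.
case: (ltngtP j k) => [lt_jk|lt_kj|/ord_inj ->]; first by rewrite cyc D_min.
  by rewrite cyc cyc D_min // (ltn_trans lt_kj).
by rewrite cyc D_diag.
Qed.

(** The graded Jacobi identity for a vector field, a bivector and a function.
    The terms with second derivatives of f cancel by symmetry. *)
Lemma schouten_vb_bf X P f :
  schouten_bf (schouten_vb X P) f
  = schouten_vv X (schouten_bf P f) - schouten_bf P (schouten_vf X f).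
Proof.
apply/rowP => i; rewrite !mxE.
have -> : schouten_vf X (\sum_j P i j * f^`M(j))
  = \sum_l \sum_j X 0 l * ((P i j)^`M(l) * f^`M(j) + P i j * f^`M(j)^`M(l)).
  apply: eq_bigr => l _; rewrite raddf_sum mulr_sumr.
  by apply: eq_bigr => j _ /=; rewrite mderivM.
have -> : schouten_vf (schouten_bf P f) (X 0 i)
  = \sum_l \sum_j P l j * f^`M(j) * (X 0 i)^`M(l).
  by apply: eq_bigr => l _; rewrite mxE mulr_suml.
have -> : \sum_j P i j * (schouten_vf X f)^`M(j)
  = \sum_l \sum_j (P i l * (X 0 j)^`M(l) * f^`M(j)
      + X 0 l * (P i j * f^`M(l)^`M(j))).
  under [RHS]eq_bigr => l _ do rewrite big_split.
  rewrite [RHS]big_split [X in _ = _ + X]exchange_big -big_split.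
  apply: eq_bigr => j _ /=; rewrite raddf_sum mulr_sumr -big_split.
  by apply: eq_bigr => l _ /=; rewrite mderivM; ring.
under eq_bigr => j _ do rewrite mxE /schouten_vf mulrBl !mulr_suml -sumrB.
rewrite exchange_big -!sumrB; apply: eq_bigr => l _ /=.
rewrite -!sumrB; apply: eq_bigr => j _.
by rewrite (mderiv_comm l j); ring.
Qed.
End Schouten.

(** * Bivectors pulled back to one more variable *)

Section Widen.
Variables (K : fieldType) (n : nat).
Implicit Types (X : vfield K n) (P : bivector K n) (f g : {mpoly K[n]}).

Lemma lift_max_widen (i : 'I_n) : lift ord_max i = widen_ord (leqnSn n) i.
Proof. by apply/ord_inj; rewrite lift_max. Qed.

Lemma big_ord_lift_max (V : nmodType) (F : 'I_n.+1 -> V) :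
  \sum_i F i = \sum_(i < n) F (lift ord_max i) + F ord_max.
Proof.
by rewrite big_ord_recr; congr (_ + _); apply: eq_bigr => i _; rewrite lift_max_widen.
Qed.

Lemma mwiden_var (i : 'I_n) : 'X_(lift ord_max i) = mwiden 'X_i :> {mpoly K[n.+1]}.
Proof. by rewrite mwidenX mnmwiden1 lift_max_widen. Qed.

Lemma mderiv_mwiden (i : 'I_n) f : (mwiden f)^`M(lift ord_max i) = mwiden f^`M(i).
Proof.
elim/mpolyind: f => [|c m f _ _ IH]; first by rewrite !(mwiden0, mderiv0).
rewrite mwidenD !mderivD mwidenD {}IH; congr (_ + _).
rewrite mwidenZ !mderivZ mwidenZ mwidenX !mderivX lift_max_widen mnmwiden_widen.
rewrite mwidenZ mwidenX; congr (_ *: (_ *: 'X_[_])); apply/mnmP => j.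
case: (unliftP ord_max j) => [l ->|->]; rewrite mnmBE mnm1E.
  by rewrite !lift_max_widen !mnmwiden_widen mnmBE mnm1E.
rewrite !mnmwiden_ordmax -lift_max_widen eq_sym (negbTE (neq_lift _ _)).
by [].
Qed.

Lemma mderiv_mwiden_max f : (mwiden f)^`M(ord_max) = 0.
Proof.
elim/mpolyind: f => [|c m f _ _ IH]; first by rewrite mwiden0 mderiv0.
by rewrite mwidenD mderivD IH mwidenZ mderivZ mwidenX mderivX mnmwiden_ordmax
  scale0r scaler0 addr0.
Qed.

Definition b_widen P : bivector K n.+1 := \matrix_(i, j)
  if unlift ord_max i is Some k then
    if unlift ord_max j is Some l then mwiden (P k l) else 0 else 0.

Lemma schouten_vf_widen X f :
  schouten_vf (vf_widen X) (mwiden f) = mwiden (schouten_vf X f).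
Proof.
rewrite /schouten_vf big_ord_lift_max mderiv_mwiden_max mulr0 addr0 raddf_sum.
by apply: eq_bigr => i _ /=; rewrite mwidenM mderiv_mwiden mxE liftK.
Qed.

Lemma schouten_vf0 (X : vfield K n.+1) : schouten_vf X 0 = 0.
Proof. by rewrite /schouten_vf big1 // => i _; rewrite mderiv0 mulr0. Qed.

Lemma schouten_bf_widen P f :
  schouten_bf (b_widen P) (mwiden f) = vf_widen (schouten_bf P f).
Proof.
apply/rowP => i; rewrite mxE [RHS]mxE big_ord_lift_max mderiv_mwiden_max mulr0 addr0.
case: (unliftP ord_max i) => [k ->|->]; last first.
  by rewrite big1 // => j _; rewrite mxE unlift_none mul0r.
rewrite mxE raddf_sum; apply: eq_bigr => j _ /=.
by rewrite mxE !liftK mderiv_mwiden mwidenM.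
Qed.

Lemma schouten_vb_widen X P :
  schouten_vb (vf_widen X) (b_widen P) = b_widen (schouten_vb X P).
Proof.
apply/matrixP => i j; rewrite mxE [RHS]mxE big_ord_lift_max.
have vmax : vf_widen X 0 ord_max = 0 by rewrite mxE unlift_none.
have vlift k : vf_widen X 0 (lift ord_max k) = mwiden (X 0 k) by rewrite mxE liftK.
have bmaxl k : b_widen P ord_max k = 0 by rewrite mxE unlift_none.
have bmaxr k : b_widen P k ord_max = 0 by rewrite mxE unlift_none; case: unlift.
have blift k l : b_widen P (lift ord_max k) (lift ord_max l) = mwiden (P k l).
  by rewrite mxE !liftK.
case: (unliftP ord_max i) => [k ->|->]; rewrite ?unlift_none ?liftK; last first.
  rewrite vmax !bmaxl schouten_vf0 mderiv0 mulr0 mul0r !addr0 big1 ?subr0 // => l _.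
  by rewrite bmaxl mderiv0 mulr0 mul0r addr0.
case: (unliftP ord_max j) => [l ->|->]; rewrite ?unlift_none ?liftK; last first.
  rewrite vmax !bmaxr schouten_vf0 mderiv0 mulr0 mul0r !addr0 big1 ?subr0 // => l _.
  by rewrite bmaxr mderiv0 mulr0 mul0r addr0.
rewrite bmaxl bmaxr !mul0r !addr0 blift schouten_vf_widen [X in _ = mwiden X]mxE mwidenB.
congr (_ - _); rewrite raddf_sum; apply: eq_bigr => m _ /=.
by rewrite !blift !vlift !mderiv_mwiden mwidenD !mwidenM.
Qed.
End Widen.

(** * The equations for a Casimir function of pi_2 *)

Lemma entry_add_wedge (K : fieldType) n (A B : bivector K n) (V W : vfield K n) x i j :
  (A - wedge_vv V W + x *: B) i j
  = A i j - (V 0 i * W 0 j - V 0 j * W 0 i) + x * B i j.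
Proof. by rewrite !mxE. Qed.

Section Pi2.
Variables (K : fieldType) (lambda : K) (b : 'I_10 -> K).

(** The last basis vector of gl(3) is central, and brackets are traceless, so
    neither the last row nor the coordinate x0 occurs in pi_1. *)
Lemma gl_poisson_widen : gl_poisson lambda = b_widen (sl_poisson K).
Proof.
have gl_max : gl_basis lambda ord_max = lambda%:M by rewrite /gl_basis unlift_none.
have gl_lift k : gl_basis lambda (lift ord_max k) = sl_basis K k.
  by rewrite /gl_basis liftK.
have coord0 k : gl_coord lambda 0 k = 0.
  rewrite /gl_coord mxtrace0 !mul0r raddf0 subr0; case: unlift => // l.
  by case: l => [[|[|[|[|[|[|[|[|//]]]]]]]] ll]; rewrite /sl_coord /= mxE.
apply/matrixP => i j; rewrite [RHS]mxE mxE.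
case: (unliftP ord_max i) => [k ->|->]; rewrite ?unlift_none ?liftK; last first.
  rewrite big1 // => l _; rewrite gl_max /lie scalar_mxC subrr coord0.
  by rewrite scale0r.
case: (unliftP ord_max j) => [l ->|->]; rewrite ?unlift_none ?liftK; last first.
  rewrite big1 // => l _; rewrite gl_max /lie scalar_mxC subrr coord0.
  by rewrite scale0r.
rewrite !gl_lift.
have tr0 : \tr (lie (sl_basis K k) (sl_basis K l)) = 0.
  by rewrite raddfB /= mxtrace_mulC subrr.
rewrite big_ord_lift_max {2}/gl_coord unlift_none tr0 mul0r scale0r addr0.
rewrite mxE raddf_sum; apply: eq_bigr => m _ /=.
by rewrite /gl_coord liftK tr0 mul0r raddf0 subr0 mwidenZ mwiden_var.
Qed.

Let P := sl_poisson K.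
Let X := X_field b.
Let Q := Q_poly b.

(** The first three hypotheses are the coefficients of 1, x0 and x0^2 in the
    components along sl(3)^*, the last two those of 1 and x0 in the component
    along d/dx0. *)
Lemma casimir_pi2 (g0 g1 : {mpoly K[8]}) (c : K) :
    schouten_bf (schouten_vb X P) g0 = g1 *: schouten_bf P Q ->
    schouten_bf (schouten_vb X P) g1 + schouten_bf P g0 = 0 ->
    schouten_bf P g1 = (3%:R * c)%:MP *: schouten_bf P Q ->
    schouten_vf (schouten_bf P Q) g0 = 0 ->
    schouten_vf (schouten_bf P Q) g1 = 0 ->
  casimir (pi2 lambda b)
    (mwiden g0 + mwiden g1 * 'X_ord_max + c *: 'X_ord_max ^+ 3).
Proof.
move=> eq0 eq1 eq2 eq3 eq4; set x0 : {mpoly K[9]} := 'X_ord_max.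
set f := (X in casimir _ X).
have Dx0 : x0^`M(ord_max) = 1.
  rewrite mderivX mnm1E eqxx scale1r -mpolyX0; congr 'X_[_].
  by apply/mnmP => l; rewrite !mnmE subnn.
have Dx0' i : x0^`M(lift ord_max i) = 0.
  by rewrite mderivX mnm1E (negbTE (neq_lift _ _)) scale0r.
have f_lift i : f^`M(lift ord_max i) = mwiden g0^`M(i) + mwiden g1^`M(i) * x0.
  rewrite !mderivD mderivZ !exprS expr0 mulr1 !mderivM !Dx0' !mderiv_mwiden.
  by rewrite !(mulr0, mul0r, addr0) scaler0 addr0.
have f_max : f^`M(ord_max) = mwiden g1 + (3%:R * c)%:MP * x0 ^+ 2.
  rewrite !mderivD mderivZ !exprS expr0 mulr1 !mderivM !Dx0 !mderiv_mwiden_max.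
  by rewrite -mul_mpolyC rmorphM rmorph_nat /=; ring.
rewrite /casimir; apply/rowP => i; rewrite !mxE big_ord_lift_max f_max.
under eq_bigr => j _ do rewrite f_lift.
rewrite /pi2 gl_poisson_widen schouten_vb_widen schouten_bf_widen.
set PQ := schouten_bf _ (Q_poly b) in eq0 eq2 eq3 eq4 *.
set pi := schouten_vb _ _ in eq0 eq1 *.
have pmax : partial_x0 K 8 0 ord_max = 1 by rewrite mxE !eqxx.
have plift j : partial_x0 K 8 0 (lift ord_max j) = 0.
  by rewrite mxE eqxx eq_sym (negbTE (neq_lift _ _)).
have vmax : vf_widen PQ 0 ord_max = 0 by rewrite mxE unlift_none.
have vlift k : vf_widen PQ 0 (lift ord_max k) = mwiden (PQ 0 k).
  by rewrite mxE liftK.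
have bmaxl (eta : bivector K 8) k : b_widen eta ord_max k = 0.
  by rewrite mxE unlift_none.
have bmaxr (eta : bivector K 8) k : b_widen eta k ord_max = 0.
  by rewrite mxE unlift_none; case: unlift.
have blift (eta : bivector K 8) k l :
  b_widen eta (lift ord_max k) (lift ord_max l) = mwiden (eta k l).
  by rewrite mxE !liftK.
set eta := _ - _ + _.
have etaE k l : eta k l = b_widen pi k l
    - (vf_widen PQ 0 k * partial_x0 K 8 0 l - vf_widen PQ 0 l * partial_x0 K 8 0 k)
    + x0 * b_widen P k l.
  exact: entry_add_wedge.
have eta_ll k l : eta (lift ord_max k) (lift ord_max l)
    = mwiden (pi k l) + x0 * mwiden (P k l).
  by rewrite etaE !blift !plift !mulr0 subrr subr0.
have eta_lm k : eta (lift ord_max k) ord_max = - mwiden (PQ 0 k).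
  by rewrite etaE !bmaxr plift pmax vlift !(mulr0, mulr1) addr0 subr0 add0r.
have eta_ml k : eta ord_max (lift ord_max k) = mwiden (PQ 0 k).
  by rewrite etaE !bmaxl plift pmax vlift !(mulr0, mulr1) addr0 !sub0r opprK.
have eta_mm : eta ord_max ord_max = 0.
  by rewrite etaE !bmaxl vmax !(mulr0, mul0r) subrr subr0 addr0.
case: (unliftP ord_max i) => [k ->|->]; last first.
  rewrite eta_mm mul0r addr0.
  transitivity (mwiden (schouten_vf PQ g0) + mwiden (schouten_vf PQ g1) * x0).
    rewrite !raddf_sum mulr_suml -big_split; apply: eq_bigr => j _ /=.
    by rewrite eta_ml !mwidenM; ring.
  by rewrite eq3 eq4 mwiden0 mul0r addr0.
rewrite eta_lm.
transitivity (mwiden (schouten_bf pi g0 0 k)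
  + x0 * mwiden ((schouten_bf pi g1 + schouten_bf P g0) 0 k)
  + x0 ^+ 2 * mwiden (schouten_bf P g1 0 k)
  - mwiden (PQ 0 k) * (mwiden g1 + (3%:R * c)%:MP * x0 ^+ 2)).
  rewrite mulNr; congr (_ - _); rewrite !mxE mwidenD !raddf_sum mulrDr !mulr_sumr.
  rewrite -!big_split; apply: eq_bigr => j _ /=.
  by rewrite eta_ll !mwidenM; ring.
rewrite eq0 eq1 eq2 !mxE !mwidenM mwiden0 mwidenC; ring.
Qed.
End Pi2.

(** * Integer polynomials that compute *)

(** A polynomial in the variables 0, ..., n-1, as the list of its coefficients
    in the variable n-1.  Horner evaluation and structural recursion make the
    soundness proofs short, and sparse polynomials stay small because [::]
    stands for zero at every level above 0. *)
Fixpoint zpoly (n : nat) : Type := if n is m.+1 then seq (zpoly m) else Z.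

Definition pzero (n : nat) : zpoly n :=
  match n with 0 => Z.zero | _.+1 => [::] end.

Fixpoint pconst (n : nat) (c : Z) : zpoly n :=
  match n with 0 => c | m.+1 => [:: pconst m c] end.

Fixpoint pvar (n i : nat) : zpoly n :=
  match n with
  | 0 => Z.zero
  | m.+1 => if i == m then [:: pzero m; pconst m Z.one] else [:: pvar m i]
  end.

Definition piszero (n : nat) : zpoly n -> bool :=
  match n with 0 => Z.eqb Z.zero | _.+1 => fun p => if p is [::] then true else false end.

(** Dropping zero leading coefficients, so that products do not run through
    polynomials that have cancelled. *)
Definition pcons (m : nat) (a : zpoly m) (p : zpoly m.+1) : zpoly m.+1 :=
  if p is [::] then if piszero a then [::] else [:: a] else a :: p.

Fixpoint padd (n : nat) : zpoly n -> zpoly n -> zpoly n :=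
  match n with
  | 0 => Z.add
  | m.+1 => fix add p q :=
      match p, q with
      | [::], _ => q
      | _, [::] => p
      | a :: p', b :: q' => pcons (padd a b) (add p' q')
      end
  end.

Fixpoint pscale (n : nat) (c : Z) : zpoly n -> zpoly n :=
  match n with 0 => Z.mul c | m.+1 => foldr (fun a => pcons (pscale c a)) [::] end.

Definition popp (n : nat) (p : zpoly n) : zpoly n := pscale (Z.opp Z.one) p.

Definition psub (n : nat) (p q : zpoly n) : zpoly n := padd p (popp q).

Definition pshift (m : nat) (p : zpoly m.+1) : zpoly m.+1 :=
  if p is [::] then [::] else pzero m :: p.

Fixpoint pmul (n : nat) : zpoly n -> zpoly n -> zpoly n :=
  match n with
  | 0 => Z.mul
  | m.+1 => fun p q => foldr (fun a r =>
      if piszero a then @pshift m r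
      else @padd m.+1 (map (@pmul m a) q) (@pshift m r)) [::] p
  end.

Fixpoint pderiv_list (m : nat) (k : Z) (l : seq (zpoly m)) : seq (zpoly m) :=
  if l is a :: l' then pcons (pscale k a) (pderiv_list (Z.succ k) l') else [::].

Fixpoint pderiv (n i : nat) : zpoly n -> zpoly n :=
  match n with
  | 0 => fun=> Z.zero
  | m.+1 => fun p =>
      if i == m then pderiv_list Z.one (behead p)
      else foldr (fun a => pcons (@pderiv m i a)) [::] p
  end.

Fixpoint pis0 (n : nat) : zpoly n -> bool :=
  match n with 0 => Z.eqb Z.zero | m.+1 => all (@pis0 m) end.

Definition peq (n : nat) (p q : zpoly n) : bool := pis0 (psub p q).

(** Binary integers are used because the coefficients reach several thousands
    and are multiplied together. *)
Definition zr (A : nzRingType) (z : Z) : A := (int_of_Z z)%:~R.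

Fixpoint peval (A : nzRingType) (e : nat -> A) (n : nat) : zpoly n -> A :=
  match n with
  | 0 => @zr A
  | m.+1 => foldr (fun a r => peval e a + e m * r) 0
  end.

Lemma zr0 (A : nzRingType) : zr A Z.zero = 0. Proof. by []. Qed.
Lemma zr1 (A : nzRingType) : zr A Z.one = 1. Proof. by []. Qed.
Lemma zrD (A : nzRingType) : {morph zr A : x y / Z.add x y >-> x + y}.
Proof. by move=> x y; rewrite /zr -[Z.add x y]/(x + y)%R !rmorphD. Qed.
Lemma zrM (A : nzRingType) : {morph zr A : x y / Z.mul x y >-> x * y}.
Proof. by move=> x y; rewrite /zr -[Z.mul x y]/(x * y)%R !rmorphM. Qed.
Lemma zrN (A : nzRingType) : {morph zr A : x / Z.opp x >-> - x}.
Proof. by move=> x; rewrite /zr -[Z.opp x]/(- x)%R !rmorphN. Qed.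
Lemma zr_nat (A : nzRingType) (k : nat) : zr A (Z.of_nat k) = k%:R.
Proof. by rewrite /zr; case: k => //= k; rewrite SuccNat2Pos.id_succ. Qed.
Lemma rmorph_zr (A B : nzRingType) (f : {rmorphism A -> B}) z :
  f (zr A z) = zr B z.
Proof. by rewrite rmorph_int. Qed.

Section Eval.
Variables (A : comNzRingType) (e : nat -> A).
Local Notation ev := (peval e).

Lemma peval0 n : ev (pzero n) = 0. Proof. by case: n. Qed.

Lemma peval_iszero n (p : zpoly n) : piszero p -> ev p = 0.
Proof. by case: n p => [p /Z.eqb_spec <-|n []]. Qed.

Lemma peval_cons m a (p : zpoly m.+1) :
  ev (pcons a p) = ev a + e m * ev p.
Proof.
case: p => [|b p] //=; case: ifP => [/peval_iszero ->|_] //=.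
by rewrite mulr0 addr0.
Qed.

Lemma pevalC n c : ev (pconst n c) = zr A c.
Proof. by elim: n => //= n ->; rewrite mulr0 addr0. Qed.

Lemma pevalX n i : (i < n)%N -> ev (pvar n i) = e i.
Proof.
elim: n => [|n IH]; rewrite ?ltn0 // ltnS leq_eqVlt /=; case: eqP => [-> _|_ /= /IH ->].
  by rewrite /= peval0 pevalC mulr0 zr1 addr0 add0r mulr1.
by rewrite mulr0 addr0.
Qed.

Lemma pevalD n : {morph @peval A e n : p q / padd p q >-> p + q}.
Proof.
elim: n => [|n IH]; first exact: zrD.
elim=> [|a p IHp] [|b q]; rewrite ?add0r ?addr0 //.
transitivity (ev (pcons (padd a b) (@padd n.+1 p q))); first by [].
by rewrite peval_cons IH IHp /=; ring.
Qed.

Lemma pevalZ n c p : @peval A e n (pscale c p) = zr A c * peval e p.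
Proof.
elim: n p => [p|n IH]; first exact: zrM.
elim=> [|a p IHp]; rewrite ?mulr0 //.
transitivity (ev (pcons (pscale c a) (@pscale n.+1 c p))); first by [].
by rewrite peval_cons IH IHp /=; ring.
Qed.

Lemma pevalN n : {morph @peval A e n : p / popp p >-> - p}.
Proof. by move=> p; rewrite pevalZ zrN zr1 mulN1r. Qed.

Lemma pevalB n : {morph @peval A e n : p q / psub p q >-> p - q}.
Proof. by move=> p q; rewrite pevalD pevalN. Qed.

Lemma peval_shift m p : ev (@pshift m p) = e m * ev p.
Proof. by case: p => [|a p] /=; rewrite ?mulr0 // peval0 add0r. Qed.

Lemma pevalM n : {morph @peval A e n : p q / pmul p q >-> p * q}.
Proof.
elim: n => [|n IH]; first exact: zrM.
elim=> [|a p IHp] q; first by rewrite mul0r.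
transitivity (ev (if piszero a then @pshift n (@pmul n.+1 p q)
    else @padd n.+1 (map (@pmul n a) q) (@pshift n (@pmul n.+1 p q)))).
  by [].
case: ifP => [/peval_iszero a0|_].
  by rewrite peval_shift IHp [ev (a :: p : zpoly n.+1)]/= a0 add0r mulrA.
rewrite pevalD peval_shift IHp [ev (a :: p : zpoly n.+1)]/= mulrDl mulrA.
congr (_ + _); elim: q {IHp} => [|b q IHq]; first by rewrite mulr0.
transitivity (ev (pmul a b) + e n * @peval A e n.+1 (map (@pmul n a) q)).
  by [].
by rewrite IH IHq /=; ring.
Qed.

Lemma peval_eq0 n p : @pis0 n p -> ev p = 0.
Proof.
elim: n p => [p /Z.eqb_spec <- //|n IH].
by elim=> //= a p IHp /andP[/IH -> /IHp ->]; rewrite mulr0 addr0.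
Qed.

Lemma peval_eq n (p q : zpoly n) : peq p q -> ev p = ev q.
Proof. by move/peval_eq0; rewrite pevalB => /eqP; rewrite subr_eq0 => /eqP. Qed.

(** The coefficients of a polynomial in the variable n only involve smaller ones. *)
Lemma peval_deriv_ge n i (p : zpoly n) : (n <= i)%N -> ev (pderiv i p) = 0.
Proof.
elim: n p => [|n IH] p lt_ni //=; rewrite gtn_eqF //.
elim: p => [|a p IHp] //=.
by rewrite [LHS]peval_cons IH ?(ltnW lt_ni) // [X in _ + _ * X]IHp mulr0 addr0.
Qed.

(** Stated for any derivation D of the target that sends the i-th variable to
    1 and the others to 0, so that it does not depend on how the parameters
    and the coordinates are interpreted. *)
Lemma peval_deriv (D : A -> A) n i (p : zpoly n) :
    {morph D : x y / x + y} -> (forall x y, D (x * y) = D x * y + x * D y) ->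
    (forall k, (k < n)%N -> D (e k) = (k == i)%:R) ->
  D (ev p) = ev (pderiv i p).
Proof.
move=> DD DM De.
have D0 : D 0 = 0 by apply: (addrI (D 0)); rewrite -DD !addr0.
have D1 : D 1 = 0.
  have /eqP := DM 1 1; rewrite !mulr1 mul1r -subr_eq0 opprD addrA subrr add0r.
  by rewrite oppr_eq0 => /eqP.
have DN x : D (- x) = - D x by apply/eqP; rewrite -addr_eq0 -DD addNr D0.
have Dn k : D k%:R = 0 by elim: k => [|k IH]; rewrite ?D0 // -natr1 DD IH D1 addr0.
have Dz z : D (zr A z) = 0.
  by rewrite /zr; case: (int_of_Z z) => k; rewrite ?NegzE ?mulrNz ?DN Dn ?oppr0.
elim: n p De => [p _|n IH p De]; first exact: Dz.
have {}IH := IH _ (fun k lt_kn => De k (ltnW lt_kn)).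
have De_n : D (e n) = (i == n)%:R by rewrite De // eq_sym.
pose H : zpoly n.+1 -> A := @peval A e n.+1.
have Hcons a l : H (a :: l) = ev a + e n * H l by [].
have Hpcons a l : H (pcons a l) = ev a + e n * H l by exact: peval_cons.
change (D (H p) = H (if i == n then pderiv_list Z.one (behead p)
  else foldr (fun a => pcons (pderiv i a)) [::] p)).
case: eqP De_n => [i_n|ne_in] De_n; last first.
  elim: p => [|a p IHp]; first exact: D0.
  by rewrite Hpcons Hcons DD DM IH IHp De_n mul0r add0r.
have Da (a : zpoly n) : D (ev a) = 0 by rewrite IH peval_deriv_ge // i_n.
have step a l : D (H (a :: l)) = H l + e n * D (H l).
  by rewrite Hcons DD DM Da De_n add0r mul1r.
case: p => [|a l]; first exact: D0.
(* With x the variable, this is x^(1-k) times the derivative of x^k l: the list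
   l stands behind k coefficients that have been stripped. *)
have Dl k : H (pderiv_list k l) = zr A k * H l + e n * D (H l).
  elim: l k {a} => [|a l IHl] k; first by rewrite [H _]/= D0 !mulr0 addr0.
  by rewrite Hpcons pevalZ IHl -Z.add_1_r zrD zr1 step Hcons; ring.
by rewrite step [behead _]/= Dl zr1 mul1r.
Qed.
End Eval.

Arguments peval : simpl never.

Definition psum_seq (T : Type) (n : nat) (s : seq T) (F : T -> zpoly n) :
    zpoly n :=
  foldr (fun i => padd (F i)) (pzero n) s.

Definition psum (n k : nat) (F : nat -> zpoly n) : zpoly n :=
  psum_seq (iota 0 k) F.

Lemma peval_sum_seq (A : comNzRingType) (e : nat -> A) (T : Type) n (s : seq T)
    (F : T -> zpoly n) :
  peval e (psum_seq s F) = \sum_(i <- s) peval e (F i).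
Proof.
elim: s => [|i s IH]; first by rewrite big_nil peval0.
by rewrite big_cons -IH -pevalD.
Qed.

Lemma peval_sum (A : comNzRingType) (e : nat -> A) n k (F : nat -> zpoly n) :
  peval e (psum k F) = \sum_(i < k) peval e (F i).
Proof.
by rewrite peval_sum_seq -(big_mkord xpredT (fun i => peval e (F i)))
  /index_iota subn0.
Qed.

Definition ppow (n : nat) (p : zpoly n) (k : nat) : zpoly n :=
  iter k (pmul p) (pconst n Z.one).

Definition pprod (n k : nat) (F : nat -> zpoly n) : zpoly n :=
  foldr (fun i => pmul (F i)) (pconst n Z.one) (iota 0 k).

Lemma peval_pow (A : comNzRingType) (e : nat -> A) n (p : zpoly n) k :
  peval e (ppow p k) = peval e p ^+ k.
Proof.
elim: k => [|k IH]; first by rewrite pevalC zr1.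
by rewrite exprS -IH -pevalM.
Qed.

Lemma peval_prod (A : comNzRingType) (e : nat -> A) n k (F : nat -> zpoly n) :
  peval e (pprod k F) = \prod_(i < k) peval e (F i).
Proof.
rewrite -(big_mkord xpredT (fun i => peval e (F i))) /pprod /index_iota subn0.
elim: (iota 0 _) => [|i s IH]; rewrite ?big_nil ?big_cons /= ?pevalC ?zr1 //.
by rewrite pevalM IH.
Qed.

Lemma peval_morph (A B : comNzRingType) (f : {rmorphism A -> B})
    (e : nat -> A) n (p : zpoly n) :
  f (peval e p) = peval (fun k => f (e k)) p.
Proof.
elim: n p => [p|n IH]; first exact: rmorph_zr.
elim=> [|a p IHp]; first exact: rmorph0.
transitivity (f (peval e a + e n * @peval A e n.+1 p)); first by [].
by rewrite rmorphD rmorphM IH IHp.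
Qed.

Lemma eq_peval (A : comNzRingType) (e1 e2 : nat -> A) n (p : zpoly n) :
  (forall k, (k < n)%N -> e1 k = e2 k) -> peval e1 p = peval e2 p.
Proof.
elim: n p => [//|n IH] p eq_e.
have {}IH (a : zpoly n) : peval e1 a = peval e2 a.
  by apply: IH => k lt_k; rewrite eq_e // ltnW.
elim: p => [//|a p IHp].
transitivity (peval e1 a + e1 n * @peval A e1 n.+1 p); first by [].
by rewrite IH IHp eq_e.
Qed.

Fixpoint pembed (n d : nat) (p : zpoly d) : zpoly (n + d) :=
  match n with
  | 0 => p
  | m.+1 => pcons (pembed m p) [::]
  end.

Lemma peval_embed (A : comNzRingType) (e : nat -> A) n d (p : zpoly d) :
  peval e (pembed n p) = peval e p.
Proof.
elim: n => // n IH; transitivity (peval e (@pcons (n + d) (pembed n p) [::])).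
  by [].
by rewrite peval_cons IH [X in _ + _ * X]/= mulr0 addr0.
Qed.

Fixpoint psubst (n d : nat) (v : nat -> Z) : zpoly (n + d) -> zpoly d :=
  match n with
  | 0 => id
  | m.+1 => fun p =>
      foldr (fun a r => padd (@psubst m d v a) (pscale (v m) r)) (pzero d) p
  end.

Lemma peval_subst (A : comNzRingType) (e : nat -> A) n d v (p : zpoly (n + d)) :
  (forall i, (i < n)%N -> e (i + d)%N = zr A (v i)) ->
  peval e (psubst v p) = peval e p.
Proof.
elim: n p => [//|n IH] p e_v.
have {}IH (a : zpoly (n + d)) : peval e (psubst v a) = peval e a.
  by apply: IH => i lt_in; rewrite e_v // ltnW.
elim: p => [|a p IHp]; first exact: peval0.
transitivity (peval e (padd (psubst v a) (pscale (v n) (@psubst n.+1 d v p)))).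
  by [].
by rewrite pevalD pevalZ IH IHp -e_v.
Qed.

Arguments psubst : simpl never.

Lemma peval_scale_eq (A : comNzRingType) (e : nat -> A) n c1 c2 (p q : zpoly n) :
  peq (pscale c1 p) (pscale c2 q) -> zr A c1 * peval e p = zr A c2 * peval e q.
Proof. by move/(peval_eq e); rewrite !pevalZ. Qed.

Lemma peval_scale_nat_eq (A : comNzRingType) (e : nat -> A) n k (p q : zpoly n) :
  peq (pscale (Z.of_nat k) p) q -> k%:R * peval e p = peval e q.
Proof. by move/(peval_eq e) <-; rewrite pevalZ zr_nat. Qed.

(** * Brackets of integer polynomials *)

(** Vector fields and bivectors on sl(3)^* become lists of components. *)
Definition tab (T : Type) (F : nat -> T) : seq T := map F (iota 0 8).

Lemma nth_tab (T : Type) (x0 : T) F (i : 'I_8) : nth x0 (tab F) i = F i.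
Proof. by rewrite /tab (nth_map 0) ?size_iota // nth_iota. Qed.

(** The d inner variables are parameters, interpreted as constants; the eight
    outer ones are the coordinates.  Having the coordinates outside makes the
    coefficient of a monomial in them a polynomial in the parameters. *)
Section Schouten.
Variable d : nat.
Local Notation N := (8 + d)%N.

Definition xvar (i : nat) : zpoly N := pvar N (d + i)%N.
Definition xderiv (i : nat) (p : zpoly N) : zpoly N := pderiv (d + i)%N p.

Definition vco (X : seq (zpoly N)) (i : nat) : zpoly N := nth (pzero N) X i.
Definition bco (eta : seq (seq (zpoly N))) (i j : nat) : zpoly N :=
  nth (pzero N) (nth [::] eta i) j.
Definition btab (F : nat -> nat -> zpoly N) := tab (fun i => tab (F i)).

Definition zschouten_vf (X : seq (zpoly N)) (f : zpoly N) : zpoly N :=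
  psum 8 (fun i => pmul (vco X i) (xderiv i f)).

Definition zschouten_vb (X : seq (zpoly N)) (eta : seq (seq (zpoly N))) :=
  btab (fun i j => psub (zschouten_vf X (bco eta i j))
    (psum 8 (fun l => padd (pmul (bco eta l j) (xderiv l (vco X i)))
                         (pmul (bco eta i l) (xderiv l (vco X j)))))).

Definition zschouten_bf (eta : seq (seq (zpoly N))) (f : zpoly N) :=
  tab (fun i => psum 8 (fun j => pmul (bco eta i j) (xderiv j f))).

Variables (K : fieldType) (a : nat -> K).

Definition env (k : nat) : {mpoly K[8]} :=
  if (k < d)%N then (a k)%:MP else 'X_(inord (k - d)).

Local Notation ev := (peval env).

Definition evv (X : seq (zpoly N)) : vfield K 8 := \row_i ev (vco X i).
Definition evb (eta : seq (seq (zpoly N))) : bivector K 8 :=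
  \matrix_(i, j) ev (bco eta i j).

Lemma peval_xvar (i : 'I_8) : ev (xvar i) = 'X_i.
Proof.
rewrite pevalX; last by rewrite addnC ltn_add2r.
by rewrite /env ltnNge leq_addr addKn inord_val.
Qed.

Lemma peval_xderiv (i : 'I_8) (p : zpoly N) : ev (xderiv i p) = (ev p)^`M(i).
Proof.
symmetry; apply: peval_deriv => [p1 p2|p1 p2|k lt_k]; first exact: mderivD.
  exact: mderivM.
rewrite /env; case: ltnP => [lt_kd|le_dk].
  by rewrite mderivC ltn_eqF // ltn_addr.
rewrite -{2}(subnKC le_dk) eqn_add2l mderivX mnmE.
have lt_kd8 : (k - d < 8)%N by rewrite ltn_subLR // addnC.
have -> : (k - d == i)%N = (inord (k - d) == i).
  by rewrite -(inj_eq val_inj) /= inordK.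
case: eqP => [->|_]; rewrite ?scale0r // scale1r -mpolyX0; congr 'X_[_].
by apply/mnmP => l; rewrite !mnmE subnn.
Qed.

Lemma evv_tab F : evv (tab F) = \row_i ev (F i).
Proof. by apply/rowP => i; rewrite !mxE /vco nth_tab. Qed.

Lemma evb_btab F : evb (btab F) = \matrix_(i, j) ev (F i j).
Proof. by apply/matrixP => i j; rewrite !mxE /bco !nth_tab. Qed.

Lemma zschouten_vfE X f : ev (zschouten_vf X f) = schouten_vf (evv X) (ev f).
Proof.
by rewrite peval_sum; apply: eq_bigr => i _; rewrite pevalM peval_xderiv mxE.
Qed.

Lemma zschouten_vbE X eta :
  evb (zschouten_vb X eta) = schouten_vb (evv X) (evb eta).
Proof.
rewrite evb_btab; apply/matrixP => i j; rewrite !mxE pevalB zschouten_vfE.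
rewrite peval_sum; congr (_ - _); apply: eq_bigr => l _.
by rewrite !mxE pevalD !pevalM !peval_xderiv.
Qed.

Lemma zschouten_bfE eta f :
  evv (zschouten_bf eta f) = schouten_bf (evb eta) (ev f).
Proof.
rewrite evv_tab; apply/rowP => i; rewrite !mxE peval_sum.
by apply: eq_bigr => j _; rewrite pevalM peval_xderiv mxE.
Qed.

Definition zvscale (p : zpoly N) (X : seq (zpoly N)) : seq (zpoly N) :=
  map (pmul p) X.

Lemma zvscaleE p X : evv (zvscale p X) = ev p *: evv X.
Proof.
apply/rowP => i; rewrite !mxE /vco; case: (ltnP i (size X)) => [lt_i|le_i].
  by rewrite (nth_map (pzero N)) // pevalM.
by rewrite !nth_default ?size_map // peval0 mulr0.
Qed.

Lemma evv_nil : evv [::] = 0.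
Proof. by apply/rowP => i; rewrite !mxE /vco nth_nil peval0. Qed.

Lemma zschouten_vf_val X f V F :
  evv X = V -> ev f = F -> ev (zschouten_vf X f) = schouten_vf V F.
Proof. by move=> <- <-; exact: zschouten_vfE. Qed.

Lemma zschouten_bf_val eta f E F :
  evb eta = E -> ev f = F -> evv (zschouten_bf eta f) = schouten_bf E F.
Proof. by move=> <- <-; exact: zschouten_bfE. Qed.

Definition veq (X Y : seq (zpoly N)) : Prop :=
  forall i, (i < 8)%N -> peq (vco X i) (vco Y i).

Lemma evv_eq X Y : veq X Y -> evv X = evv Y.
Proof. by move=> eqXY; apply/rowP => i; rewrite !mxE; exact/peval_eq/eqXY. Qed.

(** Half of the component of the bracket of [eta] with itself. *)
Definition zjacobi (eta : seq (seq (zpoly N))) (i j k : nat) : zpoly N :=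
  psum 8 (fun l => padd (pmul (bco eta i l) (xderiv l (bco eta j k)))
    (padd (pmul (bco eta j l) (xderiv l (bco eta k i)))
          (pmul (bco eta k l) (xderiv l (bco eta i j))))).

Definition zwedge_vb (X : seq (zpoly N)) (eta : seq (seq (zpoly N)))
    (i j k : nat) : zpoly N :=
  padd (padd (pmul (vco X i) (bco eta j k)) (pmul (vco X j) (bco eta k i)))
    (pmul (vco X k) (bco eta i j)).

Definition sorted_triples : seq (nat * nat * nat) :=
  [seq t <- [seq (ij, k) | ij <- [seq (i, j) | i <- iota 0 8, j <- iota 0 8],
                           k <- iota 0 8] | (t.1.1 < t.1.2 < t.2)%N].

Definition teq (S T : nat -> nat -> nat -> zpoly N) : bool :=
  all (fun t => peq (S t.1.1 t.1.2 t.2) (T t.1.1 t.1.2 t.2)) sorted_triples.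

Lemma schouten_bb_eq_wedge eta X zeta :
    (2%:R : K) != 0 -> skew (evb eta) -> skew (evb zeta) ->
    teq (zjacobi eta) (zwedge_vb X zeta) ->
  schouten_bb (evb eta) (evb eta) = wedge_vb (evv X) (evb zeta) *+ 2.
Proof.
move=> nz2 sk_eta sk_zeta /allP eqST; apply: alternating_eq => //.
- exact: alternating_bb.
- exact/alternatingMn/alternating_vb.
move=> i j k lt_ijk; rewrite !ffunE /=.
have inI (l : 'I_8) : (l : nat) \in iota 0 8 by rewrite mem_iota /=.
have /eqST : ((i : nat, j : nat), k : nat) \in sorted_triples.
  by rewrite mem_filter lt_ijk !allpairs_f.
move=> /(peval_eq env); rewrite peval_sum !pevalD !pevalM !mxE => <-.
rewrite -big_split; apply: eq_bigr => l _; rewrite !pevalD !pevalM !peval_xderiv.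
by rewrite !mxE /=; ring.
Qed.
End Schouten.

Lemma ev_param (K : fieldType) (d : nat) (a : nat -> K) (p : zpoly d) :
  peval (env d a) p = (peval a p)%:MP.
Proof.
rewrite (@eq_peval _ _ (fun k => (a k)%:MP_[8])) => [|k lt_k]; last first.
  by rewrite /env lt_k.
by rewrite -(peval_morph (@mpolyC 8 K)).
Qed.

Lemma ev_embed (K : fieldType) (d : nat) (a : nat -> K) (p : zpoly d) :
  peval (env d a) (pembed 8 p) = (peval a p)%:MP.
Proof. by rewrite peval_embed ev_param. Qed.

Section Homogeneous.
Variables (d : nat).

(** Homogeneity in the outer variables only. *)
Fixpoint phomog (n k : nat) : zpoly (n + d) -> bool :=
  match n with
  | 0 => fun p => (k == 0) || pis0 p
  | m.+1 => (fix go k (l : seq (zpoly (m + d))) :=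
      if l is a :: l' then
        @phomog m k a && (if k is k'.+1 then go k' l' else @pis0 (m + d).+1 l')
      else true) k
  end.

Lemma phomog_homog (K : fieldType) (a : nat -> K) (n k : nat) (p : zpoly (n + d)) :
  (n <= 8)%N -> phomog k p -> peval (env d a) p \is k.-homog.
Proof.
elim: n k p => [|n IH] k p le_n8.
  rewrite (ev_param a) => /orP[/eqP ->|/peval_eq0 ->].
    by rewrite -[_%:MP]mulr1 mul_mpolyC; apply/dhomogZ/dhomog1.
  by rewrite mpolyC0; exact: dhomog0.
have {}IH j (q : zpoly (n + d)) : phomog j q -> peval (env d a) q \is j.-homog.
  exact: (IH _ _ (ltnW le_n8)).
elim: p k => [|q p IHp] k; first by move=> _; exact: dhomog0.
have -> : @phomog n.+1 k (q :: p) = phomog k q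
    && (if k is k'.+1 then @phomog n.+1 k' p else @pis0 (n + d).+1 p).
  by case: k.
move=> /andP[/IH q_homog p_homog].
change (peval (env d a) q + env d a (n + d)%N * @peval _ (env d a) (n + d).+1 p
  \is k.-homog).
apply: dhomogD => //; case: k p_homog {q_homog} => [/peval_eq0 ->|k /IHp p_homog].
  by rewrite mulr0; exact: dhomog0.
rewrite -[k.+1]add1n; apply: dhomogM => //.
by rewrite /env ltnNge leq_addl dhomogX /= mdeg1.
Qed.
End Homogeneous.

(** * Reified closed formulas *)

(** The closed formulas are polymorphic in the ring, but integer polynomials
    satisfy the ring laws only up to evaluation.  Hence they are reified once
    and then both computed with and interpreted. *)
Inductive pexpr : Type :=
  | EN of nat | EB of 'I_10 | EX of 'I_8 | EOpp of pexpr
  | EAdd of pexpr & pexpr | EMul of pexpr & pexpr | EPow of pexpr & nat.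

Fixpoint denote (A : comNzRingType) (b : 'I_10 -> A) (x : 'I_8 -> A)
    (t : pexpr) : A :=
  match t with
  | EN k => k%:R
  | EB i => b i
  | EX i => x i
  | EOpp t1 => - denote b x t1
  | EAdd t1 t2 => denote b x t1 + denote b x t2
  | EMul t1 t2 => denote b x t1 * denote b x t2
  | EPow t1 k => denote b x t1 ^+ k
  end.

Fixpoint pnorm (n : nat) (b x : nat -> zpoly n) (t : pexpr) : zpoly n :=
  match t with
  | EN k => pconst n (Z.of_nat k)
  | EB i => b i
  | EX i => x i
  | EOpp t1 => popp (pnorm b x t1)
  | EAdd t1 t2 => padd (pnorm b x t1) (pnorm b x t2)
  | EMul t1 t2 => pmul (pnorm b x t1) (pnorm b x t2)
  | EPow t1 k => iterop k (@pmul n) (pnorm b x t1) (pconst n Z.one)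
  end.

Lemma peval_norm (A : comNzRingType) (e : nat -> A) n (b x : nat -> zpoly n) t :
  peval e (pnorm b x t)
  = denote (fun i : 'I_10 => peval e (b i)) (fun i : 'I_8 => peval e (x i)) t.
Proof.
elim: t => //= [k|t <-|t1 <- t2 <-|t1 <- t2 <-|t <- k].
- by rewrite pevalC zr_nat.
- exact: pevalN.
- exact: pevalD.
- exact: pevalM.
rewrite /GRing.exp; case: k => [|k]; first by rewrite pevalC zr1.
by rewrite !iteropS; elim: k => //= k IH; rewrite pevalM IH.
Qed.

Lemma eq_denote (A : comNzRingType) (b1 b2 : 'I_10 -> A) x1 x2 t :
  b1 =1 b2 -> x1 =1 x2 -> denote b1 x1 t = denote b2 x2 t.
Proof. by move=> eqb eqx; elim: t => //= [t ->|t -> u ->|t -> u ->|t ->]. Qed.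

Ltac reify b x t :=
  lazymatch t with
  | ?u + ?v => let u' := reify b x u in let v' := reify b x v in constr:(EAdd u' v')
  | ?u * ?v => let u' := reify b x u in let v' := reify b x v in constr:(EMul u' v')
  | - ?u => let u' := reify b x u in constr:(EOpp u')
  | ?u ^+ ?k => let u' := reify b x u in constr:(EPow u' k)
  | GRing.natmul 1 ?k => constr:(EN k)
  | 1 => constr:(EN 1)
  | 0 => constr:(EN 0)
  | b ?i => constr:(EB i)
  | x ?i => constr:(EX i)
  end.


Lemma Q_expr_reified : {t : pexpr |
  forall (A : comNzRingType) b x, @Q_expr A b x = denote b x t}.
Proof.
eexists => A b x.
let t := eval cbv beta zeta delta [Q_expr] in (Q_expr b x) in
let t' := reify b x t in instantiate (1 := t').
reflexivity.
Defined.

Lemma k_expr_reified : {t : pexpr |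
  forall (A : comNzRingType) b x, @k_expr A b x = denote b x t}.
Proof.
eexists => A b x.
let t := eval cbv beta zeta delta [k_expr] in (k_expr b x) in
let t' := reify b x t in instantiate (1 := t').
reflexivity.
Defined.

Lemma M_expr_reified : {t : pexpr |
  forall (A : comNzRingType) b x, @M_expr A b x = denote b x t}.
Proof.
eexists => A b x.
let t := eval cbv beta zeta delta [M_expr] in (M_expr b x) in
let t' := reify b x t in instantiate (1 := t').
reflexivity.
Defined.

Ltac reify_seq b x t :=
  lazymatch t with
  | [::] => constr:(@nil pexpr)
  | ?u :: ?v =>
      let u' := reify b x u in let v' := reify_seq b x v in
      constr:(u' :: v')
  end.

Ltac reify_seq2 b x t :=
  lazymatch t with
  | [::] => constr:(@nil (seq pexpr))
  | ?u :: ?v =>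
      let u' := reify_seq b x u in let v' := reify_seq2 b x v in
      constr:(u' :: v')
  end.

Lemma field_expr_reified : {t : seq (seq pexpr) |
  forall (A : comNzRingType) b x,
    @field_expr A x = map (map (denote b x)) t}.
Proof.
eexists => A b x.
let t := eval cbv beta zeta delta [field_expr] in (field_expr x) in
let t' := reify_seq2 b x t in instantiate (1 := t').
reflexivity.
Defined.

(** * The Lie-Poisson bivector and the Killing form in integers *)

Definition zsum (k : nat) (F : nat -> Z) : Z :=
  foldr (fun i => Z.add (F i)) Z.zero (iota 0 k).

Lemma zr_sum (A : nzRingType) k F :
  zr A (zsum k F) = \sum_(i < k) zr A (F i).
Proof.
rewrite -(big_mkord xpredT (fun i => zr A (F i))) /zsum /index_iota subn0.
elim: (iota 0 _) => [|i s IH]; rewrite ?big_nil ?big_cons //=.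
by rewrite zrD IH.
Qed.

(** Integer matrices as functions, since the entries of ring matrices do not
    compute. *)
Definition zmat := nat -> nat -> Z.

Definition zmx (A : nzRingType) (n : nat) (M : zmat) : 'M[A]_n :=
  \matrix_(i, j) zr A (M i j).

Definition zdelta (k l : nat) : zmat :=
  fun i j => if (i == k) && (j == l) then Z.one else Z.zero.

Definition zmul (M N : zmat) : zmat :=
  fun i j => zsum 3 (fun k => Z.mul (M i k) (N k j)).

Definition zlie (M N : zmat) : zmat :=
  fun i j => Z.sub (zmul M N i j) (zmul N M i j).

Definition zcoord (M : zmat) (i : nat) : Z :=
  nth Z.zero [:: M 0 1; M 0 2; M 1 0; M 1 2; M 2 0; M 2 1; M 0 0; M 1 1]%N i.

Definition zbasis (i : nat) : zmat :=
  nth (fun _ _ => Z.zero)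
    [:: zdelta 0 1; zdelta 0 2; zdelta 1 0; zdelta 1 2; zdelta 2 0; zdelta 2 1;
        fun i j => Z.sub (zdelta 0 0 i j) (zdelta 2 2 i j);
        fun i j => Z.sub (zdelta 1 1 i j) (zdelta 2 2 i j)] i.

Definition zconst (i j k : nat) : Z := zcoord (zlie (zbasis i) (zbasis j)) k.

Definition zkilling (i j : nat) : Z :=
  zsum 8 (fun k => zcoord (zlie (zbasis i) (zlie (zbasis j) (zbasis k))) k).

(** 18 times the inverse of the Gram matrix of the Killing form, which is six
    times the trace form: the basis vectors for the roots are dual in opposite
    pairs, and the Cartan block of the trace form is (2 1 / 1 2). *)
Definition zgram_inv (i j : nat) : Z :=
  nth Z.zero (nth [::] (map (map Z_of_int)
    [:: [:: 0; 0; 3]; [:: 0; 0; 0; 0; 3]; [:: 3]; [:: 0; 0; 0; 0; 0; 3];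
        [:: 0; 3]; [:: 0; 0; 0; 3];
        [:: 0; 0; 0; 0; 0; 0; 2; -1]; [:: 0; 0; 0; 0; 0; 0; -1; 2]]) i) j.

Lemma gram_check : all (fun i => all (fun j =>
   Z.eqb (zsum 8 (fun k => Z.mul (zkilling i k) (zgram_inv k j)))
     (if i == j then Z.of_nat 18 else Z.zero)) (iota 0 8)) (iota 0 8).
Proof. by vm_compute. Qed.

Lemma zrB (A : nzRingType) : {morph zr A : x y / Z.sub x y >-> x - y}.
Proof. by move=> x y; rewrite -Z.add_opp_r zrD zrN. Qed.

Section Tables.
Variable K : fieldType.
Hypothesis charK0 : forall k : nat, (k.+1%:R : K) != 0.

Lemma zmx_mul (M N : zmat) : zmx K 3 M *m zmx K 3 N = zmx K 3 (zmul M N).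
Proof.
apply/matrixP => i j; rewrite !mxE zr_sum.
by apply: eq_bigr => k _; rewrite !mxE zrM.
Qed.

Lemma zmx_lie (M N : zmat) : lie (zmx K 3 M) (zmx K 3 N) = zmx K 3 (zlie M N).
Proof. by rewrite /lie !zmx_mul; apply/matrixP => i j; rewrite !mxE zrB. Qed.

Lemma sl_coord_zmx (M : zmat) (i : 'I_8) :
  sl_coord (zmx K 3 M) i = zr K (zcoord M i).
Proof.
by case: i => [[|[|[|[|[|[|[|[|//]]]]]]]] li]; rewrite /sl_coord /= !mxE.
Qed.

Lemma sl_basis_zmx (i : 'I_8) : sl_basis K i = zmx K 3 (zbasis i).
Proof.
apply/matrixP => k l; rewrite /zmx mxE.
case: i k l => [[|[|[|[|[|[|[|[|//]]]]]]]] li] [[|[|[|//]]] lk] [[|[|[|//]]] ll];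
  by rewrite /sl_basis /= !mxE /= ?subr0 ?sub0r.
Qed.

Lemma sl_const (i j k : 'I_8) :
  sl_coord (lie (sl_basis K i) (sl_basis K j)) k = zr K (zconst i j k).
Proof. by rewrite !sl_basis_zmx zmx_lie sl_coord_zmx. Qed.

Lemma killing_gram_zmx : killing_gram K = zmx K 8 zkilling.
Proof.
apply/matrixP => i j; rewrite !mxE zr_sum; apply: eq_bigr => k _.
by rewrite !sl_basis_zmx !zmx_lie sl_coord_zmx.
Qed.

Lemma invmx_killing_gram :
  invmx (killing_gram K) = 18%:R^-1 *: zmx K 8 zgram_inv.
Proof.
have gramK : killing_gram K *m (18%:R^-1 *: zmx K 8 zgram_inv) = 1%:M.
  rewrite -scalemxAr killing_gram_zmx; apply/matrixP => i j; rewrite !mxE.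
  have inI (l : 'I_8) : (l : nat) \in iota 0 8 by rewrite mem_iota /=.
  have /Z.eqb_spec eqij := allP (allP gram_check i (inI i)) j (inI j).
  have -> : \sum_k zmx K 8 zkilling i k * zmx K 8 zgram_inv k j
      = zr K (if (i : nat) == j then Z.of_nat 18 else Z.zero).
    by rewrite -eqij zr_sum; apply: eq_bigr => k _; rewrite !mxE zrM.
  rewrite (inj_eq val_inj); case: eqP => _; last by rewrite mulr0.
  by rewrite zr_nat mulVf.
have [unitG _] := mulmx1_unit gramK.
by rewrite -[RHS]mul1mx -(mulVmx unitG) -mulmxA gramK mulmx1.
Qed.

Section Env.
Variables (d : nat) (a : nat -> K).
Local Notation ev := (peval (env d a)).

Definition Pz : seq (seq (zpoly (8 + d))) :=
  btab (fun i j => psum 8 (fun k => pscale (zconst i j k) (xvar d k))).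

Lemma mpoly_zr z : zr {mpoly K[8]} z = (zr K z)%:MP.
Proof. by rewrite rmorph_zr. Qed.

Lemma evb_Pz : evb a Pz = sl_poisson K.
Proof.
rewrite evb_btab; apply/matrixP => i j; rewrite !mxE peval_sum.
apply: eq_bigr => k _.
by rewrite pevalZ peval_xvar sl_const mpoly_zr mul_mpolyC.
Qed.

(** The entries of 18 times the generic point [killing_dual]. *)
Definition dualz (r c : nat) : zpoly (8 + d) :=
  psum 8 (fun i => psum 8 (fun j =>
    pscale (Z.mul (zgram_inv i j) (zbasis j r c)) (xvar d i))).

Lemma killing_dualE : killing_dual K
  = (18%:R^-1)%:MP *: \matrix_(r, c) ev (dualz r c).
Proof.
apply/matrixP => r c; rewrite /killing_dual summxE !mxE peval_sum mulr_sumr.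
apply: eq_bigr => i _; rewrite summxE peval_sum mulr_sumr.
apply: eq_bigr => j _.
rewrite invmx_killing_gram !mxE sl_basis_zmx mxE pevalZ peval_xvar zrM !mpoly_zr.
by rewrite -!mul_mpolyC rmorphM /=; ring.
Qed.

Definition pmx3 := nat -> nat -> zpoly (8 + d).
Definition pmul3 (M N : pmx3) : pmx3 :=
  fun i j => psum 3 (fun k => pmul (M i k) (N k j)).
Definition ptr3 (M : pmx3) : zpoly (8 + d) := psum 3 (fun i => M i i).

Definition C2z := ptr3 (pmul3 dualz dualz).
Definition C3z := ptr3 (pmul3 dualz (pmul3 dualz dualz)).

Lemma ev_pmul3 (M N : pmx3) :
  (\matrix_(i < 3, j < 3) ev (M i j)) *m (\matrix_(i < 3, j < 3) ev (N i j))
  = \matrix_(i < 3, j < 3) ev (pmul3 M N i j).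
Proof.
apply/matrixP => i j; rewrite !mxE peval_sum.
by apply: eq_bigr => k _; rewrite !mxE pevalM.
Qed.

Lemma ev_ptr3 (M : pmx3) : \tr (\matrix_(i < 3, j < 3) ev (M i j)) = ev (ptr3 M).
Proof. by rewrite peval_sum; apply: eq_bigr => i _; rewrite mxE. Qed.

Lemma killing_trace2 : killing_trace K 2 = 18%:R^-2 *: ev C2z.
Proof.
rewrite /killing_trace killing_dualE exprZn mxtraceZ -rmorphXn /= mul_mpolyC.
set D := \matrix_(r, c) _.
by rewrite exprVn [D ^+ 2]expr2 -[D * D]/(D *m D) ev_pmul3 ev_ptr3.
Qed.

Lemma killing_trace3 : killing_trace K 3 = 18%:R^-3 *: ev C3z.
Proof.
rewrite /killing_trace killing_dualE exprZn mxtraceZ -rmorphXn /= mul_mpolyC.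
set D := \matrix_(r, c) _.
rewrite exprVn [D ^+ 3]exprS [D ^+ 2]expr2 -[D * _]/(D *m (D *m D)).
by rewrite !ev_pmul3 ev_ptr3.
Qed.
End Env.

End Tables.

(** For [eta] = P this is the bracket of the i-th coordinate with p. *)
Definition bf_at (d : nat) (eta : seq (seq (zpoly (8 + d)))) (i : nat)
    (p : zpoly (8 + d)) : zpoly (8 + d) :=
  psum 8 (fun j => pmul (bco eta i j) (xderiv j p)).

Lemma ev_bf_at (K : fieldType) d (a : nat -> K) (i : 'I_8) (p : zpoly (8 + d)) :
  peval (env d a) (bf_at (Pz d) i p)
  = schouten_bf (sl_poisson K) (peval (env d a) p) 0 i.
Proof.
rewrite mxE peval_sum; apply: eq_bigr => j _.
by rewrite pevalM peval_xderiv -(evb_Pz d a) mxE.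
Qed.

(** * The polynomials X_b, Q_b, k_b and M_b in integers *)

Section Covariants.
Variable K : fieldType.
Hypothesis charK0 : forall k : nat, (k.+1%:R : K) != 0.

Variable b : 'I_10 -> K.

Definition bpar (k : nat) : K := b (inord k).
Local Notation ev := (peval (env 10 bpar)).
Local Notation N := (8 + 10)%N.

Definition bvar (k : nat) : zpoly N := pvar N k.

Lemma ev_bvar (k : 'I_10) : ev (bvar k) = (b k)%:MP.
Proof.
rewrite pevalX; last exact: ltn_addl (ltn_ord k).
by rewrite /env ltn_ord /bpar inord_val.
Qed.

Definition fieldz (i j : nat) : zpoly N :=
  pnorm bvar (xvar 10) (nth (EN 0) (nth [::] (sval field_expr_reified) i) j).

Definition Xz : seq (zpoly N) :=
  tab (fun j => psum 10 (fun i => pmul (bvar i) (fieldz i j))).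

Lemma nth_map2 (S T : Type) (f : S -> T) x0 y0 (t : seq (seq S)) i j :
  f x0 = y0 ->
  nth y0 (nth [::] (map (map f) t) i) j = f (nth x0 (nth [::] t i) j).
Proof.
move=> fx0; have nth_map0 s k : nth y0 (map f s) k = f (nth x0 s k).
  by elim: s k => [|x s IH] [|k] /=.
by elim: t i => [|s t IH] [|i] /=; rewrite ?nth_nil ?nth_map0 ?IH.
Qed.

Lemma evv_Xz : evv bpar Xz = X_field b.
Proof.
rewrite evv_tab; apply/rowP => j; rewrite !mxE peval_sum.
apply: eq_bigr => i _; rewrite pevalM ev_bvar mul_mpolyC; congr (_ *: _).
rewrite peval_norm (svalP field_expr_reified _ (fun i => ev (bvar i))).
rewrite (nth_map2 (x0 := EN 0)) //; apply: eq_denote => // l.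
exact: peval_xvar.
Qed.

Definition relabelz (i : nat) : zpoly N :=
  nth (pzero N) [:: pscale (Z.of_nat 2) (bvar 0); bvar 1; bvar 2; bvar 4;
    bvar 3; bvar 5; bvar 6; bvar 8; bvar 7; bvar 9] i.

Lemma ev_relabelz (i : 'I_10) : ev (relabelz i) = (relabel b i)%:MP.
Proof.
case: i => [[|[|[|[|[|[|[|[|[|[|//]]]]]]]]]] li] /=; rewrite /relabel /=;
  try by rewrite -ev_bvar.
by rewrite pevalZ zr_nat rmorphM /= rmorph_nat -ev_bvar.
Qed.

Definition closedz (t : pexpr) : zpoly N := pnorm relabelz (xvar 10) t.

Lemma ev_closedz t : ev (closedz t)
  = denote (fun i => (relabel b i)%:MP_[8]) (fun l : 'I_8 => 'X_l) t.
Proof.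
by rewrite peval_norm; apply: eq_denote => i; rewrite (ev_relabelz, peval_xvar).
Qed.

(** Coefficientwise division by two, which is exact in the two uses below. *)
Fixpoint phalf (n : nat) : zpoly n -> zpoly n :=
  match n with 0 => Z.div2 | m.+1 => map (@phalf m) end.

Definition kz : zpoly N := closedz (sval k_expr_reified).
Definition Qz : zpoly N :=
  phalf (pscale (Z.opp (Z.of_nat 3)) (closedz (sval Q_expr_reified))).
Definition Mz : zpoly N :=
  phalf (pscale (Z.of_nat 3) (closedz (sval M_expr_reified))).

Lemma Qz_check : peq (pscale (Z.of_nat 2) Qz)
  (pscale (Z.opp (Z.of_nat 3)) (closedz (sval Q_expr_reified))).
Proof. by vm_compute. Qed.
Lemma Mz_check : peq (pscale (Z.of_nat 2) Mz)
  (pscale (Z.of_nat 3) (closedz (sval M_expr_reified))).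
Proof. by vm_compute. Qed.

Lemma ev_kz : ev kz = k_poly b.
Proof. by rewrite ev_closedz -(svalP k_expr_reified). Qed.

(* Unification would otherwise evaluate these closed terms. *)
Opaque Qz Mz kz.

Lemma peval_half (p q : zpoly N) c (t : K) r :
    peq (pscale (Z.of_nat 2) q) (pscale c p) -> ev p = r -> zr K c = t ->
  ev q = (t / 2%:R) *: r.
Proof.
move=> /peval_scale_eq eq2 <- <-; apply: (@scalerI _ _ 2%:R); first exact: charK0.
rewrite scalerA [_ * (_ / _)]mulrC mulfVK ?charK0 // -!mul_mpolyC rmorph_nat.
by rewrite -mpoly_zr -eq2 zr_nat.
Qed.

Lemma ev_Qz : ev Qz = Q_poly b.
Proof.
have c_eq : zr K (Z.opp (Z.of_nat 3)) = - 3 by rewrite zrN zr_nat.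
rewrite (peval_half Qz_check (ev_closedz _) c_eq) /Q_poly mulNr.
by rewrite -(svalP Q_expr_reified).
Qed.

Lemma ev_Mz : ev Mz = M_poly b.
Proof.
rewrite (peval_half Mz_check (ev_closedz _) (zr_nat K 3)) /M_poly.
by rewrite -(svalP M_expr_reified).
Qed.
End Covariants.

(** * Identities over the integers *)

(** Each component is decided by a separate computation, so that the
    intermediate polynomials of one can be discarded before the next. *)
Ltac check_components :=
  let i := fresh "i" in move=> i; do 8![case: i => [_|i]; first by vm_compute].

Definition piz := zschouten_vb Xz (Pz 10).
Definition PQz := zschouten_bf (Pz 10) Qz.

Lemma C2_check : veq (zschouten_bf (Pz 10) (C2z 10)) [::].
Proof. by check_components. Qed.
Lemma C3_check : veq (zschouten_bf (Pz 10) (C3z 10)) [::].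
Proof. by check_components. Qed.
Lemma XC3_check : pis0 (zschouten_vf Xz (C3z 10)).
Proof. by vm_compute. Qed.
Lemma k_check : peq (zschouten_vf Xz (C2z 10)) (pscale (Z.of_nat 18) kz).
Proof. by vm_compute. Qed.
Lemma K2_check : veq (zschouten_bf piz (zschouten_vf Xz (C2z 10)))
  (zvscale (C2z 10) PQz).
Proof. by check_components. Qed.
Lemma piQ_check : veq (zschouten_bf piz Qz) (zschouten_bf (Pz 10) Mz).
Proof. by check_components. Qed.
Lemma piM_check : veq (zschouten_bf piz Mz) (zvscale (popp Qz) PQz).
Proof. by check_components. Qed.
Lemma jacobi_check : teq (zjacobi piz) (zwedge_vb PQz (Pz 10)).
Proof. by vm_compute. Qed.

Lemma m_check : phomog 3 (padd Mz (zschouten_vf Xz Qz)).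
Proof. by vm_compute. Qed.

(** * The submodule U *)

Fixpoint pcoef (n d : nat) (e : nat -> nat) : zpoly (n + d) -> zpoly d :=
  match n with
  | 0 => id
  | m.+1 => fun p => @pcoef m d e (nth (pzero (m + d)) p (e m))
  end.

Definition quad_coef (i j : nat) : zpoly 10 :=
  @pcoef 8 10 (fun k => (k == i) + (k == j))%N Qz.

Definition Pz10 := Pz 10.

Definition highest : zpoly (8 + 10) := pmul (xvar 10 1) (xvar 10 1).

Definition act_word (w : seq nat) : zpoly (8 + 10) :=
  foldr (bf_at Pz10) highest w.

(** The words, in which the last letter acts first, give a basis of U, found by
    closing x13^2 under brackets with x21, x32 and x31.  A triple (z, i, j)
    stands for z times the coefficient in Q of the product of the coordinates
    number i and j.  Since a weight space of U has dimension at
    most 3, one or two such coefficients determine each coordinate of Q in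
    this basis; 24 is the common denominator. *)
Definition U_words : seq (seq nat * seq (int * nat * nat)) :=
  [:: ([::], [:: (24, 1, 1)]);
      ([:: 2], [:: (12, 1, 3)]);
      ([:: 5], [:: (-12, 0, 1)]);
      ([:: 4], [:: (-12, 1, 6)]);
      ([:: 2; 2], [:: (12, 3, 3)]);
      ([:: 5; 2], [:: (-12, 0, 3)]);
      ([:: 4; 2], [:: (-12, 1, 2)]);
      ([:: 5; 5], [:: (12, 0, 0)]);
      ([:: 4; 5], [:: (12, 0, 6)]);
      ([:: 4; 4], [:: (-6, 0, 2); (-6, 1, 4)]);
      ([:: 5; 2; 2], [:: (-6, 3, 7)]);
      ([:: 4; 2; 2], [:: (-6, 2, 3)]);
      ([:: 5; 5; 2], [:: (6, 0, 7)]);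
      ([:: 4; 5; 2], [:: (12, 0, 2)]);
      ([:: 4; 4; 2], [:: (6, 2, 6)]);
      ([:: 4; 5; 5], [:: (6, 0, 5)]);
      ([:: 4; 4; 5], [:: (6, 0, 4); (-6, 5, 7)]);
      ([:: 4; 4; 4], [:: (-2, 2, 5); (2, 4, 6)]);
      ([:: 5; 5; 2; 2], [:: (-3, 0, 2); (-3, 3, 5)]);
      ([:: 4; 5; 2; 2], [:: (6, 2, 7)]);
      ([:: 4; 4; 2; 2], [:: (6, 2, 2)]);
      ([:: 4; 5; 5; 2], [:: (6, 5, 7)]);
      ([:: 4; 4; 5; 2], [:: (6, 2, 5)]);
      ([:: 4; 4; 4; 2], [:: (2, 2, 4)]);
      ([:: 4; 4; 5; 5], [:: (6, 5, 5)]);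
      ([:: 4; 4; 4; 5], [:: (2, 4, 5)]);
      ([:: 4; 4; 4; 4], [:: (1, 4, 4)])].

Definition U_coef (l : seq (int * nat * nat)) : zpoly 10 :=
  psum_seq l (fun q => pscale (Z_of_int q.1.1) (quad_coef q.1.2 q.2)).

Definition U_combination : zpoly (8 + 10) :=
  psum_seq U_words (fun q => pmul (pembed 8 (U_coef q.2)) (act_word q.1)).

Lemma U_check : peq (pscale (Z.of_nat 24) Qz) U_combination.
Proof. by vm_compute. Qed.

Section InU.
Variable K : fieldType.
Hypothesis charK0 : forall k : nat, (k.+1%:R : K) != 0.
Variable b : 'I_10 -> K.
Local Notation ev := (peval (env 10 (bpar b))).

Lemma in_U0 : in_U (0 : {mpoly K[8]}).
Proof. by rewrite -(scale0r ('X_(@Ordinal 8 1 isT) ^+ 2)); apply/in_U_scale/in_U_gen. Qed.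

Lemma in_U_act_word w : all (fun i => i < 8)%N w -> in_U (ev (act_word w)).
Proof.
elim: w => [_|i w IH /= /andP[lt_i /IH]].
  by rewrite pevalM (@peval_xvar 10 K (bpar b) (@Ordinal 8 1 isT)); exact: in_U_gen.
move/(in_U_act (Ordinal lt_i)).
by rewrite -(ev_bf_at _ (Ordinal lt_i)).
Qed.

Lemma in_U_Q : in_U (Q_poly b).
Proof.
have eqQ : 24%:R * Q_poly b = ev U_combination.
  by rewrite -(ev_Qz charK0); exact: (peval_scale_nat_eq _ U_check).
have -> : Q_poly b = 24%:R^-1 *: (24%:R * Q_poly b).
  by rewrite -(rmorph_nat (@mpolyC 8 K)) mul_mpolyC scalerA mulVf ?scale1r.
rewrite eqQ; apply: in_U_scale.
rewrite /U_combination peval_sum_seq big_seq; apply: (big_ind (@in_U K)) => [||q q_U].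
- exact: in_U0.
- exact: in_U_add.
rewrite pevalM ev_embed mul_mpolyC; apply/in_U_scale/in_U_act_word.
by have /allP/(_ q q_U) : all (fun q => all (fun i => i < 8)%N q.1) U_words by [].
Qed.
End InU.

(** * Cubic Casimir functions of P *)

Fixpoint compositions (n k : nat) : seq (seq nat) :=
  if n is m.+1 then
    flatten [seq map (cons i) (compositions m (k - i)) | i <- iota 0 k.+1]
  else if k is 0 then [:: [::]] else [::].

Lemma mem_compositions s : s \in compositions (size s) (sumn s).
Proof.
elim: s => // i s IH; apply/(@flattenP _ [seq map (cons j)
  (compositions (size s) (sumn (i :: s) - j)) | j <- iota 0 (sumn (i :: s)).+1]).
exists (map (cons i) (compositions (size s) (sumn s))).
  apply/mapP; exists i; last by rewrite /= addKn.
  by rewrite mem_iota add0n ltnS; exact: leq_addr.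
by apply/mapP; exists s.
Qed.

(** For i = 6, 7 the bracket of the i-th coordinate, y13 or y23, with x_j is
    zconst i j j times x_j, so this is the eigenvalue of a monomial. *)
Definition weight (i : nat) (e : seq nat) : Z :=
  zsum 8 (fun j => Z.mul (zconst i j j) (Z.of_nat (nth 0 e j))).

Definition weight0_exps : seq (seq nat) :=
  [seq e <- compositions 8 3 | Z.eqb (weight 6 e) Z.zero && Z.eqb (weight 7 e) Z.zero].

Definition zmonom (e : seq nat) : zpoly (8 + 12) :=
  pprod 8 (fun i => ppow (xvar 12 i) (nth 0%N e i)).

(** The generic cubic polynomial of weight zero; its 12 coefficients are the
    parameters. *)
Definition cubic0 : zpoly (8 + 12) :=
  psum 12 (fun s => pmul (pvar (8 + 12) s) (zmonom (nth [::] weight0_exps s))).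

Definition Pz12 := Pz 12.

(** An entry (i, s) is the linear equation on the coefficients of a cubic
    Casimir function c that says that the bracket of the i-th coordinate with
    c vanishes at the point with coordinates 1 on s and 0 elsewhere.  These
    supports are small so that each equation has two or three terms. *)
Definition points : seq (nat * seq nat) :=
  [:: (0, [:: 0; 2]); (1, [:: 1; 4]); (1, [:: 1; 7]); (3, [:: 3; 5]);
      (3, [:: 3; 6]); (1, [:: 0; 3; 7]); (5, [:: 0; 4; 6]); (0, [:: 0; 6]);
      (0, [:: 0; 7]); (1, [:: 0; 1; 2]); (0, [:: 0; 1; 4])]%N.

Definition indicator (s : seq nat) (i : nat) : Z :=
  if i \in s then Z.one else Z.zero.

Definition point_eqs : seq (zpoly 12) :=
  [seq psubst (indicator q.2) (bf_at Pz12 q.1 cubic0) | q <- points].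

(** Row s expresses 18 t_s - 3 c_s t_0, for t the unknown coefficients and c
    those of C3z, as a combination of the eleven equations; c_0 is 6. *)
Definition elimination : seq (seq Z) := map (map Z_of_int)
  [:: [::]; [:: 0; 0; -9];
  [:: 6; 0; -3; 0; -6; 0; 0; 6; 6];
  [:: -4; 0; 2; 0; -2; 0; 0; -4; -4];
  [:: 0; 0; 9; 0; 0; 18; 0; 0; -18];
  [:: 0; 0; -18; -18; 0; -36; 0; 0; 36];
  [:: 36; -18; -18; 0; 0; 0; 36; 0; 36];
  [:: -18; 0; 9; 0; 0; 0; -18; 0; -18];
  [:: -36; 0; 27; 0; 0; 0; 0; 0; -54; 18];
  [:: -54; 18; 27; 0; 0; 0; -54; 0; -54; 0; 18];
  [:: 0; 0; 9; 0; 0; 0; 0; 0; -18]; [:: -18; 0; 9; 0; 0; 0; 0; 0; -18]].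

Definition elim_row (s : nat) : zpoly 12 :=
  psum 11 (fun t => pscale (nth Z.zero (nth [::] elimination s) t)
                           (nth (pzero 12) point_eqs t)).

Lemma elimination_check :
  peq (psub (pscale (Z.of_nat 18) cubic0)
            (pscale (Z.of_nat 3) (pmul (pvar (8 + 12) 0) (C3z 12))))
      (psum 12 (fun s => pmul (pembed 8 (elim_row s))
                              (zmonom (nth [::] weight0_exps s)))).
Proof. by vm_compute. Qed.

Lemma weight0_uniq : 
  [&& uniq weight0_exps, size weight0_exps == 12
    & all (fun e => size e == 8) weight0_exps].
Proof. by vm_compute. Qed.

Lemma weight_check :
  all (fun i => all (fun j => all (fun k =>
    Z.eqb (zconst i j k) (if k == j then zconst i j j else Z.zero))
  (iota 0 8)) (iota 0 8)) [:: 6; 7]%N.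
Proof. by vm_compute. Qed.

(** Monomials are eigenvectors of x_j d/dx_j. *)
Lemma mcoeff_euler (K : fieldType) n (p : {mpoly K[n]}) (j : 'I_n) m :
  ('X_j * p^`M(j))@_m = (m j)%:R * p@_m.
Proof.
elim/mpolyind: p => [|a k p _ _ IH]; first by rewrite mderiv0 mulr0 !mcoeff0 mulr0.
rewrite mderivD mulrDr !mcoeffD {}IH mulrDr; congr (_ + _).
rewrite mderivZ mderivX -!scalerAr !mcoeffZ -mpolyXD !mcoeffX.
have [k_j0|k_j] := posnP (k j).
  rewrite k_j0 mul0r mulr0; case: eqP => [<-|_]; last by rewrite !mulr0.
  by rewrite k_j0 mul0r.
have -> : (U_(j) + (k - U_(j)))%MM = k.
  by rewrite addmC submK //; apply/mnm_lepP => i; rewrite mnm1E; case: eqP => // <-.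
by case: eqP => [->|_]; rewrite ?mulr0 // !mulr1 mulrC.
Qed.

Definition mnm_of (e : seq nat) : 'X_{1..8} := [multinom nth 0%N e i | i < 8].

Definition exps (m : 'X_{1..8}) : seq nat := [seq m i | i <- enum 'I_8].

Lemma exps_nth m (i : 'I_8) : nth 0%N (exps m) i = m i.
Proof. by rewrite (nth_map i) ?size_enum_ord // nth_ord_enum. Qed.

Lemma exps_mnm_of e : size e = 8 -> exps (mnm_of e) = e.
Proof.
move=> size_e; apply: (@eq_from_nth _ 0%N); rewrite size_map size_enum_ord //.
by move=> i lt_i; rewrite (exps_nth _ (Ordinal lt_i)) mnmE.
Qed.

Lemma mnm_ofK m : mnm_of (exps m) = m.
Proof. by apply/mnmP => i; rewrite mnmE exps_nth. Qed.

Lemma sum_mcoeff (K : fieldType) (p : {mpoly K[8]}) (L : seq (seq nat)) n :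
    uniq L -> size L = n -> all (fun e => size e == 8)%N L ->
    (forall m, m \in msupp p -> exps m \in L) ->
  \sum_(s < n) p@_(mnm_of (nth [::] L s)) *: 'X_[mnm_of (nth [::] L s)] = p.
Proof.
move=> uniqL sizeL /allP size8 supp_L; apply/mpolyP => m; rewrite raddf_sum /=.
under eq_bigr => s _ do rewrite mcoeffZ mcoeffX.
have [m_p|m_p] := boolP (m \in msupp p); last first.
  rewrite (memN_msupp_eq0 m_p) big1 // => s _; case: eqP => [->|_].
    by rewrite (memN_msupp_eq0 m_p) mul0r.
  by rewrite mulr0.
have m_L := supp_L m m_p.
have lt_s : (index (exps m) L < n)%N by rewrite -sizeL index_mem.
rewrite (bigD1 (Ordinal lt_s)) //= nth_index // mnm_ofK eqxx mulr1 big1 ?addr0 //.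
move=> s ne_s; case: eqP => [eq_s|_]; last by rewrite mulr0.
case/eqP: ne_s; apply/ord_inj; rewrite -[RHS]/(index (exps m) L).
rewrite -eq_s exps_mnm_of ?index_uniq ?sizeL //.
by apply/eqP/size8/mem_nth; rewrite sizeL.
Qed.

Section CubicCasimir.
Variable K : fieldType.
Hypothesis charK0 : forall k : nat, (k.+1%:R : K) != 0.
Variable c : {mpoly K[8]}.
Hypothesis c_homog : c \is 3.-homog.
Hypothesis c_casimir : casimir (sl_poisson K) c.

Lemma zr_eq0 z : (zr K z == 0) = (Z.eqb z Z.zero).
Proof.
have [->|] := Z.eqb_spec z Z.zero; first by rewrite zr0 eqxx.
have zr_pos p : zr K (Zpos p) == 0 = false.
  by rewrite -positive_nat_Z zr_nat; have [k ->] := Pos2Nat.is_succ p; exact/negbTE.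
case: z => // p _.
by rewrite -Pos2Z.opp_pos zrN oppr_eq0 zr_pos.
Qed.

(** The bracket with y13 or y23 acts on monomials by their weight, so the
    coefficients of a Casimir function vanish outside weight zero. *)
Lemma weight_coef (y : 'I_8) (m : 'X_{1..8}) : (y : nat) \in [:: 6; 7]%N ->
  zr K (weight y (exps m)) * c@_m = 0.
Proof.
move=> y_cartan.
have inI (l : 'I_8) : (l : nat) \in iota 0 8 by rewrite mem_iota /=.
have Py j : sl_poisson K y j = (zr K (zconst y j j))%:MP * 'X_j.
  rewrite mxE (bigD1 j) //= big1 ?addr0 => [|k ne_kj].
    by rewrite sl_const mul_mpolyC.
  have := allP (allP (allP weight_check y y_cartan) j (inI j)) k (inI k).
  by rewrite ifN // => /Z.eqb_spec; rewrite sl_const => ->; rewrite zr0 scale0r.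
have /rowP/(_ y) := c_casimir; rewrite !mxE => /(congr1 (mcoeff m)).
rewrite mcoeff0 raddf_sum => <- /=; rewrite zr_sum mulr_suml.
apply: eq_bigr => j _; rewrite Py -mulrA mul_mpolyC mcoeffZ zrM -mulrA zr_nat exps_nth.
by rewrite mcoeff_euler.
Qed.

Lemma msupp_weight0 m : m \in msupp c -> exps m \in weight0_exps.
Proof.
move=> m_c; have nz : c@_m != 0 by rewrite mcoeff_eq0 m_c.
rewrite mem_filter -!zr_eq0.
have wt0 (y : 'I_8) : (y : nat) \in [:: 6; 7]%N -> zr K (weight y (exps m)) == 0.
  by move/(weight_coef m)/eqP; rewrite mulf_eq0 (negPf nz) orbF.
rewrite (wt0 (@Ordinal 8 6 isT)) // (wt0 (@Ordinal 8 7 isT)) //=.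
have sumn_m : sumn (exps m) = 3.
  by rewrite sumnE big_map big_enum -mdegE (dhomog_mf c_homog m_c).
by have := mem_compositions (exps m); rewrite sumn_m size_map size_enum_ord.
Qed.

Definition par (s : nat) : K := c@_(mnm_of (nth [::] weight0_exps s)).

Local Notation ev := (peval (env 12 par)).

Lemma ev_zmonom e : ev (zmonom e) = 'X_[mnm_of e].
Proof.
rewrite mpolyXE_id peval_prod; apply: eq_bigr => i _.
by rewrite peval_pow peval_xvar mnmE.
Qed.

Lemma ev_cubic0 : ev cubic0 = c.
Proof.
have /and3P[uniqL /eqP sizeL size8] := weight0_uniq.
rewrite /cubic0 peval_sum -[RHS](sum_mcoeff uniqL sizeL size8 msupp_weight0).
apply: eq_bigr => s _; rewrite pevalM ev_zmonom pevalX; last exact: ltn_addl.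
by rewrite /env ltn_ord mul_mpolyC.
Qed.

(** Evaluating c at an integer point is a ring morphism to K. *)
Lemma point_eq0 (t : nat) : peval par (nth (pzero 12) point_eqs t) = 0.
Proof.
case: (ltnP t (size points)) => [lt_t|le_t]; last first.
  by rewrite nth_default ?peval0 // size_map.
rewrite (nth_map (0, [::])%N) //.
have /allP/(_ _ (mem_nth (0, [::])%N lt_t)) : all (fun q => q.1 < 8)%N points by [].
case: (nth _ _ _) => i s /= lt_i8.
pose f := meval (fun j : 'I_8 => zr K (indicator s j)).
have f_env k : (k < 12)%N -> par k = f (env 12 par k).
  by move=> lt_k; rewrite /env lt_k /f mevalC.
rewrite (eq_peval _ f_env) peval_subst => [|j lt_j]; last first.
  rewrite /env ltnNge leq_addl addnK /f mevalXU.
  by rewrite inordK.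
rewrite -peval_morph (ev_bf_at _ (Ordinal lt_i8)) ev_cubic0 c_casimir mxE.
exact: rmorph0.
Qed.

Lemma elim_row0 (s : nat) : peval par (elim_row s) = 0.
Proof.
rewrite /elim_row peval_sum; apply: big1 => t _.
by rewrite pevalZ point_eq0 mulr0.
Qed.

Lemma elimination_eq (p q : zpoly (8 + 12)) F :
    peq (psub (pscale (Z.of_nat 18) p)
              (pscale (Z.of_nat 3) (pmul (pvar (8 + 12) 0) q))) (psum 12 F) ->
    (forall s, ev (F s) = 0) ->
  ev p = c -> 18%:R * c = 3%:R * ((par 0)%:MP * ev q).
Proof.
move=> /(peval_eq (env 12 par)).
rewrite pevalB !pevalZ !zr_nat pevalM pevalX // peval_sum => eq_pq F0 <-.
by apply/eqP; rewrite -subr_eq0 eq_pq big1.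
Qed.

Lemma embed_elim_row0 (s : nat) (q : zpoly (8 + 12)) :
  ev (pmul (pembed 8 (elim_row s)) q) = 0.
Proof.
by rewrite pevalM ev_embed elim_row0 mpolyC0 mul0r.
Qed.

(** With only weight zero left, 18 c - 3 t_0 C3 is the combination of
    vanishing equations recorded in [elimination].  This is the part in degree
    3 of the fact that the invariants of sl(3) are generated in degrees 2
    and 3. *)
Lemma cubic_casimir : exists t, c = t *: killing_trace K 3.
Proof.
have C3E := killing_trace3 charK0 12 par.
have := elimination_eq elimination_check (fun s => embed_elim_row0 s _) ev_cubic0.
move: (ev _) C3E => C3 -> eq_c; exists (18%:R ^+ 2 * (3%:R * par 0)).
apply: (@scalerI _ _ 18%:R); first exact: charK0.
rewrite !scalerA -!mul_mpolyC rmorph_nat eq_c.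
have -> : 18%:R * (18%:R ^+ 2 * (3%:R * par 0)) * 18%:R^-3 = 3%:R * par 0.
  by field; exact: charK0.
by rewrite rmorphM rmorph_nat mulrA.
Qed.
End CubicCasimir.

(** * Consequences for X_b, Q_b and the Casimir functions *)

Lemma real_or_complex_char0 (R : realType) (K : fieldType) :
  real_or_complex R K -> forall k : nat, (k.+1%:R : K) != 0.
Proof. by case=> k; rewrite Num.Theory.pnatr_eq0. Qed.

(* As above, unification must not evaluate these. *)
Opaque Xz Pz Qz Mz kz C2z C3z piz PQz zschouten_vf zschouten_vb zschouten_bf.

Section Facts.
Variable K : fieldType.
Hypothesis charK0 : forall k : nat, (k.+1%:R : K) != 0.
Variable b : 'I_10 -> K.
Local Notation ev := (peval (env 10 (bpar b))).
Local Notation P := (sl_poisson K).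
Local Notation X := (X_field b).
Local Notation Q := (Q_poly b).
Local Notation pi := (schouten_vb X P).
Local Notation C2 := (killing_trace K 2).
Local Notation C3 := (killing_trace K 3).

Lemma evP : evb (bpar b) (Pz 10) = P. Proof. exact: evb_Pz. Qed.
Lemma evX : evv (bpar b) Xz = X. Proof. exact: evv_Xz. Qed.
Lemma evQ : ev Qz = Q. Proof. exact: ev_Qz. Qed.
Lemma evM : ev Mz = M_poly b. Proof. exact: ev_Mz. Qed.
Lemma evpi : evb (bpar b) piz = pi.
Proof. by rewrite zschouten_vbE evX evP. Qed.
Lemma evPQ : evv (bpar b) PQz = schouten_bf P Q.
Proof. exact: zschouten_bf_val evP evQ. Qed.
Lemma evC2 : C2 = 18%:R^-2 *: ev (C2z 10). Proof. exact: killing_trace2. Qed.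
Lemma evC3 : C3 = 18%:R^-3 *: ev (C3z 10). Proof. exact: killing_trace3. Qed.

Lemma P_C2 : schouten_bf P C2 = 0.
Proof.
rewrite evC2 schouten_bfZ -(zschouten_bf_val evP erefl).
by rewrite (evv_eq _ C2_check) evv_nil scaler0.
Qed.

Lemma P_C3 : schouten_bf P C3 = 0.
Proof.
rewrite evC3 schouten_bfZ -(zschouten_bf_val evP erefl).
by rewrite (evv_eq _ C3_check) evv_nil scaler0.
Qed.

Lemma X_C3 : schouten_vf X C3 = 0.
Proof.
rewrite evC3 schouten_vfZr -(zschouten_vf_val evX erefl).
by rewrite (peval_eq0 _ XC3_check) scaler0.
Qed.

Lemma X_C2z : schouten_vf X (ev (C2z 10)) = 18%:R * k_poly b.
Proof.
rewrite -(zschouten_vf_val evX erefl) (peval_eq _ k_check).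
by rewrite pevalZ zr_nat ev_kz.
Qed.

Lemma X_C2 : schouten_vf X (18%:R *: C2) = k_poly b.
Proof.
rewrite schouten_vfZr evC2 schouten_vfZr X_C2z.
rewrite -(rmorph_nat (@mpolyC 8 K)) mul_mpolyC !scalerA.
have -> : 18%:R * 18%:R^-2 * 18%:R = 1 :> K by field; exact: charK0.
by rewrite scale1r.
Qed.

Lemma pi_k : schouten_bf pi (schouten_vf X C2) = C2 *: schouten_bf P Q.
Proof.
rewrite evC2 schouten_vfZr schouten_bfZ.
have <- := zschouten_bf_val evpi (zschouten_vf_val evX erefl).
rewrite (evv_eq _ K2_check) zvscaleE evPQ.
by rewrite scalerA mul_mpolyC.
Qed.

Lemma pi_Q : schouten_bf pi Q = schouten_bf P (M_poly b).
Proof.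
rewrite -(zschouten_bf_val evpi evQ) -(zschouten_bf_val evP evM).
exact: evv_eq piQ_check.
Qed.

Lemma pi_M : schouten_bf pi (M_poly b) = - Q *: schouten_bf P Q.
Proof.
rewrite -(zschouten_bf_val evpi evM) (evv_eq _ piM_check) zvscaleE evPQ.
by rewrite pevalN evQ.
Qed.

Lemma m_homog : M_poly b + schouten_vf X Q \is 3.-homog.
Proof.
rewrite -evM -(zschouten_vf_val evX evQ) -pevalD.
by apply: (@phomog_homog 10 K (bpar b) 8 3 _ (leqnn 8)); exact: m_check.
Qed.

Lemma skewP : skew P.
Proof.
move=> i j; rewrite !mxE -sumrN; apply: eq_bigr => k _.
have -> : lie (sl_basis K i) (sl_basis K j) = - lie (sl_basis K j) (sl_basis K i).
  by rewrite /lie opprB.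
rewrite -scaleNr; congr (_ *: _).
by case: k => [[|[|[|[|[|[|[|[|//]]]]]]]] lk]; rewrite /sl_coord /= mxE.
Qed.

Lemma skew_pi : skew pi. Proof. exact/skew_vb/skewP. Qed.

Lemma pi_pi : schouten_bb pi pi = wedge_vb (schouten_bf P Q) P *+ 2.
Proof.
have := @schouten_bb_eq_wedge 10 K (bpar b) piz PQz (Pz 10) (charK0 1).
rewrite evpi evP evPQ => bb_eq.
by apply: bb_eq jacobi_check; [exact: skew_pi | exact: skewP].
Qed.

Lemma pi_casimir f : schouten_bf P f = 0 ->
  schouten_bf pi f = - schouten_bf P (schouten_vf X f).
Proof.
move=> Pf0; rewrite schouten_vb_bf Pf0.
have -> : schouten_vv X (0 : vfield K 8) = 0.
  apply/rowP => i; rewrite !mxE schouten_vf0 sub0r /schouten_vf big1 ?oppr0 //.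
  by move=> l _; rewrite mxE mul0r.
by rewrite sub0r.
Qed.
End Facts.

Theorem theorem7p1 (R : realType) (K : fieldType) (hK : real_or_complex R K)
    (lambda : K) (hlambda : lambda != 0) (b : 'I_10 -> K) :
  let P := sl_poisson K in
  let X := X_field b in
  let Q := Q_poly b in
  let C2 := killing_trace K 2 in
  let C3 := killing_trace K 3 in
  let x0 : {mpoly K[9]} := 'X_ord_max in
  let Cas := casimir (pi2 lambda b) in
  [/\ in_U Q /\
      schouten_bb (schouten_vb X P) (schouten_vb X P)
        = wedge_vb (schouten_bf P Q) P *+ 2,
      Cas (mwiden C3),
      Cas (mwiden (schouten_vf X C2) + mwiden C2 * x0) /\
      schouten_vf X (18 *: C2) = k_poly b,
      forall m : {mpoly K[8]}, m \is 3.-homog ->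
        schouten_vv X (schouten_bf P Q) = schouten_bf P m ->
        Cas (- 3 *: mwiden (m - schouten_vf X Q)
             + 3 *: (mwiden Q * x0) + x0 ^+ 3)
    & exists m : {mpoly K[8]},
        [/\ m \is 3.-homog,
            schouten_vv X (schouten_bf P Q) = schouten_bf P m
          & m - schouten_vf X Q = M_poly b]].
Proof.
have charK0 := real_or_complex_char0 hK.
move=> P X Q C2 C3 x0 Cas; set pi := schouten_vb X P.
have skP : skew P by exact: skewP.
have skpi : skew pi by exact: skew_pi.
have P_C2 : schouten_bf P C2 = 0 by exact: P_C2.
have P_C3 : schouten_bf P C3 = 0 by exact: P_C3.
have pi_Q : schouten_bf pi Q = schouten_bf P (M_poly b) by exact: pi_Q.
have pi_C3 : schouten_bf pi C3 = 0.
  by rewrite /pi pi_casimir // X_C3 // schouten_bf0 oppr0.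
have PQ_cas f : schouten_bf P f = 0 -> schouten_vf (schouten_bf P Q) f = 0.
  move=> Pf; rewrite schouten_vf_bf_skew // Pf /schouten_vf big1 ?oppr0 //.
  by move=> i _; rewrite mxE mul0r.
have cas_K3 M : schouten_bf pi Q = schouten_bf P M ->
    schouten_bf pi M = - Q *: schouten_bf P Q ->
  Cas (- 3 *: mwiden M + 3 *: (mwiden Q * x0) + x0 ^+ 3).
  move=> pi_Q_M pi_M; rewrite -mwidenZ scalerAl -mwidenZ -[x0 ^+ 3]scale1r.
  have PQ_Q : schouten_vf (schouten_bf P Q) Q = 0.
    exact: schouten_vf_bf_diag (charK0 1) skP.
  apply: casimir_pi2; rewrite -/P -/X -/pi -/Q.
  - by rewrite schouten_bfZ pi_M scalerA mulrN rmorphN mulNr opprK mul_mpolyC.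
  - rewrite (schouten_bfZ pi 3) (schouten_bfZ P (- 3)) pi_Q_M -scalerDl -mpolyCD addrN.
    by rewrite mpolyC0 scale0r.
  - by rewrite schouten_bfZ mulr1.
  - rewrite schouten_vfZr schouten_vf_bf_skew // -pi_Q_M.
    by rewrite schouten_vf_bf_diag ?oppr0 ?scaler0 //; exact: (charK0 1).
  - by rewrite schouten_vfZr PQ_Q scaler0.
split.
- by split; [exact: in_U_Q | exact: pi_pi].
- have -> : mwiden C3 = mwiden C3 + mwiden 0 * x0 + 0 *: x0 ^+ 3.
    by rewrite mwiden0 mul0r scale0r !addr0.
  apply: casimir_pi2; rewrite -/P -/X -/pi -/Q.
  + by rewrite pi_C3 scale0r.
  + by rewrite schouten_bf0 P_C3 addr0.
  + by rewrite schouten_bf0 mulr0 mpolyC0 scale0r.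
  + exact: PQ_cas.
  + exact: schouten_vf0.
- split; last exact: X_C2.
  have P_XC2 : schouten_bf P (schouten_vf X C2) = - schouten_bf pi C2.
    by rewrite /pi pi_casimir // opprK.
  have -> : mwiden (schouten_vf X C2) + mwiden C2 * x0
      = mwiden (schouten_vf X C2) + mwiden C2 * x0 + 0 *: x0 ^+ 3.
    by rewrite scale0r addr0.
  apply: casimir_pi2; rewrite -/P -/X -/pi -/Q.
  + exact: pi_k.
  + by rewrite P_XC2 addrN.
  + by rewrite P_C2 mulr0 mpolyC0 scale0r.
  + rewrite schouten_vf_bf_skew // P_XC2.
    have -> : schouten_vf (- schouten_bf pi C2) Q = - schouten_vf (schouten_bf pi C2) Q.
      by rewrite /schouten_vf -sumrN; apply: eq_bigr => i _; rewrite mxE mulNr.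
    rewrite opprK schouten_vf_bf_skew // pi_Q schouten_vf_bf_skew // P_C2 opprK.
    by rewrite /schouten_vf big1 // => i _; rewrite mxE mul0r.
  + exact: PQ_cas.
- move=> m m_homog' eq_m.
  have pi_Q_m : schouten_bf pi Q = schouten_bf P (m - schouten_vf X Q).
    by rewrite schouten_vb_bf eq_m schouten_bfB.
  apply: cas_K3 => //.
  set c := m - schouten_vf X Q - M_poly b.
  have -> : m - schouten_vf X Q = M_poly b + c.
    by rewrite /c [RHS]addrC subrK.
  have c_homog : c \is 3.-homog.
    rewrite /c -addrA -opprD [_ + M_poly b]addrC rpredB //; exact: m_homog.
  have Pc : casimir P c.
    by rewrite /casimir /c schouten_bfB -pi_Q_m pi_Q subrr.
  have [t c_t] := cubic_casimir charK0 c_homog Pc.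
  rewrite schouten_bfD c_t (schouten_bfZ pi t) pi_C3 scaler0 addr0; exact: pi_M.
exists (M_poly b + schouten_vf X Q); split; last by rewrite addrK.
- exact: m_homog.
rewrite schouten_bfD -pi_Q schouten_vb_bf subrK.
by [].
Qed.
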